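(* Let $T=[T_1,\ldots,T_n]$ be a completely non-coisometric row contraction on a separable Hilbert space $\mathcal H$. Then there is a non-trivial subspace of $\mathcal H$ (different from $\{0\}$ and $\mathcal H$) which is invariant under each operator $T_1,\ldots,T_n$ if and only if the characteristic function $\Theta_T$ has a non-trivial regular factorization.
   Context: Conventions: $n\in\{1,2,\ldots\}$ or $n=\infty$; Hilbert spaces are complex, operators are bounded, subspaces are closed, infinite operator sums converge strongly. $H_n$ is an $n$-dimensional Hilbert space with orthonormal basis $e_1,e_2,\ldots$; $F^2(H_n)=\bigoplus_{k\ge0}H_n^{\otimes k}$ is the full Fock space ($H_n^{\otimes0}=\mathbb C1$), and $S_i\varphi=e_i\otimes\varphi$ are the left creation operators. $\mathbb F_n^+$ is the free semigroup with generators $g_1,\ldots,g_n$ and identity $g_0$; for $\alpha=g_{i_1}\cdots g_{i_k}$, $|\alpha|=k$, $e_\alpha=e_{i_1}\otimes\cdots\otimes e_{i_k}$, $T_\alpha=T_{i_1}\cdots T_{i_k}$; $|g_0|=0$, $e_{g_0}=1$, $T_{g_0}=I$. A bounded operator $A:F^2(H_n)\otimes\mathcal K\to F^2(H_n)\otimes\mathcal K'$ is multi-analytic if $A(S_i\otimes I_{\mathcal K})=(S_i\otimes I_{\mathcal K'})A$ for all $i$; it is determined by its symbol $k\mapsto A(1\otimes k)$. It is a unitary constant if $A=I\otimes W$ with $W\in B(\mathcal K,\mathcal K')$ unitary. $T=[T_1,\ldots,T_n]$, $T_i\in B(\mathcal H)$, is a row contraction if $\sum_iT_iT_i^*\le I$;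 $T$ is also regarded as the row operator from $\mathcal H^{(n)}=\bigoplus_{i=1}^n\mathcal H$ to $\mathcal H$. It is completely non-coisometric if the only $h\in\mathcal H$ with $\sum_{|\alpha|=k}\|T_\alpha^*h\|^2=\|h\|^2$ for all $k=1,2,\ldots$ is $h=0$. Put $\Delta_{T^*}=(I-\sum_iT_iT_i^* )^{1/2}$, $\Delta_T=(I-T^*T)^{1/2}$, $\mathcal D_*=\overline{\Delta_{T^*}\mathcal H}$, $\mathcal D=\overline{\Delta_T\mathcal H^{(n)}}$. The characteristic function $\Theta_T:F^2(H_n)\otimes\mathcal D\to F^2(H_n)\otimes\mathcal D_*$ is the contractive multi-analytic operator with symbol $\theta_T(h)=-1\otimes\sum_iT_iP_ih+\sum_i(S_i\otimes I_{\mathcal D_*})\big(\sum_{\alpha\in\mathbb F_n^+}e_\alpha\otimes\Delta_{T^*}T_\alpha^*P_i\Delta_Th\big)$, $h\in\mathcal D$, where $P_i$ is the projection of $\mathcal H^{(n)}$ onto its $i$-th component. Regular factorization: for contractive multi-analytic $\Theta:F^2(H_n)\otimes\mathcal E\to F^2(H_n)\otimes\mathcal E_*$ put $\Delta_\Theta=(I-\Theta^*\Theta)^{1/2}$. If $\Theta=\Theta_2\Theta_1$ with $\Theta_1:F^2(H_n)\otimes\mathcal E\to F^2(H_n)\otimes\mathcal F$, $\Theta_2:F^2(H_n)\otimes\mathcal F\to F^2(H_n)\otimes\mathcal E_*$ contractive multi-analytic ($\mathcal F$ a Hilbert space) and $\Delta_j=(I-\Theta_j^*\Theta_j)^{1/2}$,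 then $X_\Theta(\Delta_\Theta f)=\Delta_2\Theta_1f\oplus\Delta_1f$ defines an isometry $X_\Theta:\overline{\Delta_\Theta(F^2(H_n)\otimes\mathcal E)}\to\overline{\Delta_2(F^2(H_n)\otimes\mathcal F)}\oplus\overline{\Delta_1(F^2(H_n)\otimes\mathcal E)}$; the factorization is regular if $X_\Theta$ is unitary. It is non-trivial if neither factor is a unitary constant. *)

(* Defs.v *)
From HB Require Import structures.
From mathcomp Require Import all_boot all_order all_algebra.
From mathcomp Require Import sesquilinear complex finmap.
From mathcomp Require Import boolp classical_sets functions cardinality reals topology normedtype.
From mathcomp Require Import summability.

Set Implicit Arguments.
Unset Strict Implicit.
Unset Printing Implicit Defensive.

Import Order.TTheory GRing.Theory Num.Theory.
Import numFieldNormedType.Exports.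

Local Open Scope classical_set_scope.
Local Open Scope ring_scope.

(* dotp is linear in its first argument and antilinear in the second. *)
HB.mixin Record isHilbert (R : realType) V & CompleteNormedModule R[i] V := {
  dotp : {dot V for Num.conj};
  dotpE : forall x : V, dotp x x = `|x| ^+ 2
}.

#[short(type="hilbertType")]
HB.structure Definition Hilbert (R : realType) :=
  {V of CompleteNormedModule R[i] V & isHilbert R V}.

Section DotCauchySchwarz.
Variables (C : numClosedFieldType) (V : lmodType C).
Variable f : {dot V for Num.conj}.

Lemma dot_CauchySchwarz u v : `|f u v| ^+ 2 <= f u u * f v v.
Proof.
have [->|v0] := eqVneq v 0.
  by rewrite !linear0r normr0 expr0n /= mulr0.
have vv : 0 < f v v by rewrite dnorm_gt0.
set a := f u v / f v v.
have : 0 <= f (u - a *: v) (u - a *: v) by apply: dnorm_ge0.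
rewrite dnormB dnormZ/= linearZr_LR/= /a [_^* * f u v]mulrC.
have vvr : (f v v)^* = f v v by apply/CrealP; exact: gtr0_real.
rewrite normf_div (gtr0_norm vv) expr_div_n.
have -> : f u v * (f u v / f v v)^* = `|f u v| ^+ 2 / f v v.
  by rewrite rmorphM/= fmorphV/= vvr mulrA normCK.
have -> : (`|f u v| ^+ 2 / f v v)^* = `|f u v| ^+ 2 / f v v.
  by apply/CrealP/ger0_real; rewrite divr_ge0// ?exprn_ge0// ltW.
rewrite (expr2 (f v v)) invfM mulrA mulfVK ?gt_eqF//.
move=> H; rewrite -ler_pdivrMr//.
by move: H; rewrite opprD addrA addrK subr_ge0.
Qed.

Lemma dot_triangle u v :
  sqrtC (f (u + v) (u + v)) <= sqrtC (f u u) + sqrtC (f v v).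
Proof.
have ge0 w : 0 <= sqrtC (f w w) by rewrite sqrtC_ge0 dnorm_ge0.
rewrite -(@ler_pXn2r _ 2) ?nnegrE ?addr_ge0//.
rewrite sqrrD !sqrtCK dnormD addrAC lerD2r lerD2l.
have -> : f u v + (f u v)^* = 'Re (f u v) *+ 2.
  by rewrite ReE -mulr_natr mulfVK// pnatr_eq0.
rewrite lerMn2r/=; apply: (le_trans (leif_Re_Creal _)).
rewrite -(@ler_pXn2r _ 2) ?nnegrE ?mulr_ge0//.
rewrite exprMn !sqrtCK; exact: dot_CauchySchwarz.
Qed.

End DotCauchySchwarz.

HB.factory Record Lmodule_isHilbert (R : realType) V & GRing.Lmodule R[i] V := {
  form : V -> V -> R[i];
  form_linear : forall (a : R[i]) x y z,
    form (a *: x + y) z = a * form x z + form y z;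
  form_conj : forall x y, form x y = (form y x)^*;
  form_gt0 : forall x, x != 0 -> 0 < form x x;
  form_complete : forall F : set_system V, ProperFilter F ->
    (forall e : R[i], 0 < e ->
       exists x, F [set y | form (x - y) (x - y) < e]) ->
    exists l, forall e : R[i], 0 < e -> F [set y | form (l - y) (l - y) < e]
}.

HB.builders Context (R : realType) V & Lmodule_isHilbert R V.

Let form_bilinear : bilinear_for *%R (Num.conj \; *%R) form.
Proof.
split=> [z a x y|z a x y]; first exact: form_linear.
rewrite form_conj form_linear rmorphD rmorphM/=.
by rewrite -(form_conj z x) -(form_conj z y).
Qed.

HB.instance Definition _ :=
  bilinear_isBilinear.Build _ _ _ _ *%R (Num.conj \; *%R) form form_bilinear.

Let form_hermitian x y : form x y = (-1) ^+ false * (form y x)^*.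
Proof. by rewrite mul1r form_conj. Qed.

HB.instance Definition _ :=
  isHermitianSesquilinear.Build _ _ false Num.conj form form_hermitian.

HB.instance Definition _ := isDotProduct.Build _ _ form form_gt0.

Let norm (x : V) : R[i] := sqrtC (form x x).

Let norm_sqr x : norm x ^+ 2 = form x x. Proof. exact: sqrtCK. Qed.

Let norm_ge0 x : 0 <= norm x. Proof. by rewrite sqrtC_ge0 dnorm_ge0. Qed.

Let normD x y : norm (x + y) <= norm x + norm y.
Proof. exact: (@dot_triangle _ _ form). Qed.

Let normZ (l : R[i]) x : norm (l *: x) = `|l| * norm x.
Proof.
apply/eqP; rewrite -(@eqrXn2 _ 2)// ?mulr_ge0//.
by rewrite exprMn !norm_sqr dnormZ.
Qed.

Let norm0_eq0 x : norm x = 0 -> x = 0.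
Proof. by move/eqP; rewrite sqrtC_eq0 dnorm_eq0 => /eqP. Qed.

HB.instance Definition _ := Lmodule_isNormed.Build R[i] V normD normZ norm0_eq0.

Let norm_lt x (e : R[i]) : 0 < e -> (norm x < e) = (form x x < e ^+ 2).
Proof.
by move=> e0; rewrite -norm_sqr ltr_pXn2r// ?nnegrE ?norm_ge0 ?ltW.
Qed.

Let complete (F : set_system V) : ProperFilter F -> cauchy F -> cvg F.
Proof.
move=> FF /cauchyP Fc.
have [|l Hl] := @form_complete F FF.
  move=> e e0; have se0 : 0 < sqrtC e by rewrite sqrtC_gt0.
  have [x Fx] := Fc _ se0; exists x; move: Fx; rewrite -ball_normE.
  by apply: filterS => y /=; rewrite norm_lt// sqrtCK.
apply/cvg_ex; exists l; apply/cvgrPdist_lt => e e0.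
apply: filterS (Hl _ (exprn_gt0 2 e0)) => y /=.
by rewrite -norm_lt.
Qed.

HB.instance Definition _ := Uniform_isComplete.Build V complete.

HB.instance Definition _ := isHilbert.Build R V (fun x => esym (norm_sqr x)).

HB.end.

Section ClosedSubspace.
Variables (R : realType) (H : hilbertType R).

Record closed_subspace := ClosedSubspace {
  csub_set :> set H;
  csub_closed : closed csub_set;
  csub0 : csub_set 0;
  csub_linear : forall (a : R[i]) x y,
    csub_set x -> csub_set y -> csub_set (a *: x + y)
}.

Definition csub_pred (M : closed_subspace) : {pred H} := mem (csub_set M).

Lemma csub_submod M : submod_closed (csub_pred M).
Proof.
split; first by rewrite /csub_pred; apply/mem_set; exact: csub0.
by move=> a x y /set_mem xM /set_mem yM; apply/mem_set/csub_linear.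
Qed.

HB.instance Definition _ M :=
  GRing.isSubmodClosed.Build R[i] H (csub_pred M) (csub_submod M).

Definition csub (M : closed_subspace) := {x : H | x \in csub_pred M}.

HB.instance Definition _ M := SubChoice.on (csub M).
HB.instance Definition _ M := [SubChoice_isSubLmodule of csub M by <:].

Let csub_form M (x y : csub M) := dotp (val x) (val y).

Let csub_form_linear M a (x y z : csub M) :
  csub_form (a *: x + y) z = a * csub_form x z + csub_form y z.
Proof. by rewrite /csub_form linearP linearPl. Qed.

Let csub_form_conj M (x y : csub M) : csub_form x y = (csub_form y x)^*.
Proof. by rewrite /csub_form hermC mul1r. Qed.

Let csub_form_gt0 M (x : csub M) : x != 0 -> 0 < csub_form x x.
Proof. by move=> x0; rewrite dnorm_gt0. Qed.

Let csub_form_complete M (F : set_system (csub M)) : ProperFilter F ->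
    (forall e : R[i], 0 < e ->
       exists x, F [set y | csub_form (x - y) (x - y) < e]) ->
    exists l, forall e : R[i], 0 < e -> F [set y | csub_form (l - y) (l - y) < e].
Proof.
move=> FF Fc.
have fE (x y : csub M) : csub_form (x - y) (x - y) = `|val x - val y| ^+ 2.
  by rewrite /csub_form dotpE raddfB.
have /cvg_ex[l /cvgrPdist_lt Hl] : cvg (val @ F).
  apply: cauchy_cvg; apply: cauchy_exP => e e0.
  have [x Fx] := Fc _ (exprn_gt0 2 e0); exists (val x).
  have : F [set y | ball (val x) e (val y)]; last by [].
  apply: filterS Fx => y /=.
  by rewrite -ball_normE fE ltr_pXn2r// ?nnegrE ?normr_ge0 ?ltW.
have lM : csub_set M l.
  apply: (csub_closed (c := M)) => B /nbhs_ballP[e /= e0 Be].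
  have : F [set y | `|l - val y| < e] by exact: Hl.
  move=> /filter_ex[y /= Hy]; exists (val y); split.
    exact: (set_mem (valP y)).
  by apply: Be; rewrite -ball_normE.
exists (exist _ l (mem_set lM)) => e e0.
have se0 : 0 < sqrtC e by rewrite sqrtC_gt0.
apply: filterS (Hl _ se0) => y /= Hy.
by rewrite fE/= -(sqrtCK e) ltr_pXn2r// ?nnegrE ?normr_ge0 ?ltW.
Qed.

HB.instance Definition _ M := Lmodule_isHilbert.Build R (csub M)
  (@csub_form_linear M) (@csub_form_conj M) (@csub_form_gt0 M)
  (@csub_form_complete M).

End ClosedSubspace.

#[global] Existing Instance totally_filter.

Section PartialSums.
Local Open Scope fset_scope.

Lemma partial_sumE (I : choiceType) (V : zmodType) (u : I -> V) A :
  partial_sum u A = \sum_(i <- A) u i.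
Proof. by rewrite /partial_sum big_seq_fsetE. Qed.

Lemma partial_sumD (I : choiceType) (V : zmodType) (u v : I -> V) :
  partial_sum (u \+ v) = partial_sum u \+ partial_sum v.
Proof. by apply/funext => A; rewrite /partial_sum big_split. Qed.

Lemma partial_sumZ (I : choiceType) (K : pzRingType) (V : lmodType K) (a : K)
  (u : I -> V) : partial_sum (a \*: u) = a \*: partial_sum u.
Proof. by apply/funext => A; rewrite /partial_sum/= scaler_sumr. Qed.

Lemma le_partial_sum (I : choiceType) (C : numDomainType) (u : I -> C) A B :
  (forall i, 0 <= u i) -> A `<=` B -> partial_sum u A <= partial_sum u B.
Proof.
move=> u0 AB; rewrite !partial_sumE (big_fsetID _ (mem A) B)/=.
have -> : [fset x in B | x \in mem A] = A.
  by apply/fsetP => i; rewrite !inE/= andb_idl// => /(fsubsetP AB).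
by rewrite lerDl sumr_ge0.
Qed.

Lemma nneg_partial_sum_cvg (R : realType) (I : choiceType) (u : I -> R[i]) :
  (forall i, 0 <= u i) -> (exists M, forall A, partial_sum u A <= M) ->
  exists s : R[i]^o,
    [/\ forall A, partial_sum u A <= s,
        forall M, (forall A, partial_sum u A <= M) -> s <= M &
        partial_sum (u : I -> R[i]^o) @ totally --> s].
Proof.
move=> u0 [M HM]; pose v A := complex.Re (partial_sum u A).
have vE A : partial_sum u A = (v A)%:C%C.
  by rewrite /v RRe_real// ger0_real// /partial_sum sumr_ge0.
have ubE N : (forall A, partial_sum u A <= N) -> (complex.Re N)%:C%C = N.
  move=> HN; rewrite RRe_real// ger0_real// (le_trans _ (HN fset0))//.
  by rewrite /partial_sum sumr_ge0.
have hs : has_sup (range v).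
  split; first by exists (v fset0), fset0.
  exists (complex.Re M) => _ [A _ <-].
  by rewrite -lecR -vE ubE.
have vs A : v A <= sup (range v).
  by apply: sup_upper_bound => //; exists A.
exists (sup (range v))%:C%C; split=> [A|N HN|]; first by rewrite vE lecR.
  rewrite -(ubE _ HN) lecR ge_sup//; first by exists (v fset0), fset0.
  by move=> _ [A _ <-]; rewrite -lecR -vE ubE.
apply/cvgrPdist_lt => e e0.
have eE : (complex.Re e)%:C%C = e by rewrite RRe_real// gtr0_real.
have Re0 : 0 < complex.Re e by rewrite -ltcR eE.
have [_ [A _ <-] HA] := sup_adherent Re0 hs.
exists A => // B /= AB.
rewrite vE -rmorphB/= ger0_norm ?ler0c ?subr_ge0// -[ltRHS]eE ltcR.
rewrite ltrBlDr -ltrBlDl (lt_le_trans HA)//.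
by rewrite -lecR -!vE le_partial_sum.
Qed.

End PartialSums.

Section HilbertSum.
Variables (R : realType) (I : choiceType) (K : I -> hilbertType R).

Definition sq_summable (f : forall i, K i) :=
  exists M : R[i], forall A : {fset I},
    partial_sum (fun i => `|f i| ^+ 2) A <= M.

(* The Hilbert direct sum of the family K. *)
Record hsum := HSum {
  hsum_fun :> forall i, K i;
  hsum_sq_summable : sq_summable hsum_fun
}.

HB.instance Definition _ := gen_eqMixin hsum.
HB.instance Definition _ := gen_choiceMixin hsum.

Lemma hsumP (f g : hsum) : (forall i, f i = g i) -> f = g.
Proof.
case: f g => [f Pf] [g Pg] /= fg.
by have {}fg : f = g := functional_extensionality_dep fg; subst g; congr HSum.
Qed.

Let norm_sqD (V : hilbertType R) (x y : V) :
  `|x + y| ^+ 2 <= 2 * `|x| ^+ 2 + 2 * `|y| ^+ 2.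
Proof.
have : 0 <= `|x - y| ^+ 2 by rewrite exprn_ge0.
rewrite -!dotpE dnormB dnormD subr_ge0 => H.
by rewrite -mulrDr mulr_natl mulr2n lerD2l.
Qed.

Lemma sq_summable0 : sq_summable (fun i => 0).
Proof.
by exists 0 => A; rewrite /partial_sum big1// => i _; rewrite normr0 expr0n.
Qed.

Lemma sq_summableD f g : sq_summable f -> sq_summable g ->
  sq_summable (fun i => f i + g i).
Proof.
move=> [M HM] [N HN]; exists (2 * M + 2 * N) => A.
apply: (le_trans (y := 2 * partial_sum (fun i => `|f i| ^+ 2) A +
                       2 * partial_sum (fun i => `|g i| ^+ 2) A)).
  rewrite /partial_sum !mulr_sumr -big_split/=.
  by apply: ler_sum => i _; exact: norm_sqD.
by rewrite lerD// ler_pM2l.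
Qed.

Lemma sq_summableZ a f : sq_summable f -> sq_summable (fun i => a *: f i).
Proof.
move=> [M HM]; exists (`|a| ^+ 2 * M) => A.
apply: (le_trans (y := `|a| ^+ 2 * partial_sum (fun i => `|f i| ^+ 2) A)).
  rewrite /partial_sum !mulr_sumr.
  by apply: ler_sum => i _; rewrite normrZ exprMn.
by rewrite ler_wpM2l// exprn_ge0.
Qed.

Lemma sq_summableN f : sq_summable f -> sq_summable (fun i => - f i).
Proof. by move=> [M HM]; exists M => A; under eq_fun do rewrite normrN. Qed.

Let hsum_zero := HSum sq_summable0.
Let hsum_add (f g : hsum) :=
  HSum (sq_summableD (hsum_sq_summable f) (hsum_sq_summable g)).
Let hsum_opp (f : hsum) := HSum (sq_summableN (hsum_sq_summable f)).
Let hsum_scale a (f : hsum) := HSum (sq_summableZ a (hsum_sq_summable f)).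

Let hsum_addA : associative hsum_add.
Proof. by move=> f g h; apply: hsumP => i /=; rewrite addrA. Qed.
Let hsum_addC : commutative hsum_add.
Proof. by move=> f g; apply: hsumP => i /=; rewrite addrC. Qed.
Let hsum_add0 : left_id hsum_zero hsum_add.
Proof. by move=> f; apply: hsumP => i /=; rewrite add0r. Qed.
Let hsum_addN : left_inverse hsum_zero hsum_opp hsum_add.
Proof. by move=> f; apply: hsumP => i /=; rewrite addNr. Qed.

HB.instance Definition _ :=
  GRing.isZmodule.Build hsum hsum_addA hsum_addC hsum_add0 hsum_addN.

Let hsum_scaleA a b f : hsum_scale a (hsum_scale b f) = hsum_scale (a * b) f.
Proof. by apply: hsumP => i /=; rewrite scalerA. Qed.
Let hsum_scale1 : left_id 1 hsum_scale.
Proof. by move=> f; apply: hsumP => i /=; rewrite scale1r. Qed.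
Let hsum_scaleDr : right_distributive hsum_scale +%R.
Proof. by move=> a f g; apply: hsumP => i /=; rewrite scalerDr. Qed.
Let hsum_scaleDl f : {morph hsum_scale^~ f : a b / a + b}.
Proof. by move=> a b; apply: hsumP => i /=; rewrite scalerDl. Qed.

HB.instance Definition _ := GRing.Zmodule_isLmodule.Build R[i] hsum
  hsum_scaleA hsum_scale1 hsum_scaleDr hsum_scaleDl.

Lemma hsumDE (f g : hsum) i : (f + g) i = f i + g i. Proof. by []. Qed.
Lemma hsumZE a (f : hsum) i : (a *: f) i = a *: f i. Proof. by []. Qed.
Lemma hsumNE (f : hsum) i : (- f) i = - f i. Proof. by []. Qed.

Let hsum_form (f g : hsum) : R[i] :=
  summability.sum (fun i => dotp (f i) (g i) : R[i]^o).

Let sq_cvg (f : hsum) : exists s : R[i]^o,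
  [/\ forall A, partial_sum (fun i => `|f i| ^+ 2) A <= s,
      forall M, (forall A, partial_sum (fun i => `|f i| ^+ 2) A <= M) -> s <= M &
      partial_sum (fun i => `|f i| ^+ 2 : R[i]^o) @ totally --> s].
Proof.
apply: nneg_partial_sum_cvg => [i|]; first by rewrite exprn_ge0.
exact: hsum_sq_summable.
Qed.

Let polarization (V : hilbertType R) (x y : V) : dotp x y = 2^-1 *
  ((`|x + y| ^+ 2 - `|x| ^+ 2 - `|y| ^+ 2) +
   'i * (`|x + 'i *: y| ^+ 2 - `|x| ^+ 2 - `|y| ^+ 2)).
Proof.
rewrite -!dotpE !dnormD dnormZ normCi expr1n mul1r.
have subXY (X Y d : R[i]) : X + Y + d - X - Y = d.
  by rewrite -addrA -opprD addrAC subrr add0r.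
rewrite !subXY linearZr_LR/= conjCi rmorphM/= rmorphN/= conjCi opprK.
rewrite [_ * (- 'i * _ + _)]mulrDr !mulrA mulrN -expr2 sqrCi opprK mul1r mulN1r addrACA subrr addr0.
by rewrite -mulr2n -(mulr_natl (dotp x y)) mulKf ?pnatr_eq0.
Qed.

Let hsum_form_cvg (f g : hsum) :
  partial_sum (fun i => dotp (f i) (g i) : R[i]^o) @ totally -->
  (hsum_form f g : R[i]^o).
Proof.
apply/cvg_ex.
have [s [_ _ Hs]] := sq_cvg f; have [t [_ _ Ht]] := sq_cvg g.
have [p [_ _ Hp]] := sq_cvg (f + g); have [q [_ _ Hq]] := sq_cvg (f + 'i *: g).
exists (2^-1 *: ((p + -1 *: s + -1 *: t) + 'i *: (q + -1 *: s + -1 *: t))).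
pose sq (h : hsum) i : R[i]^o := `|h i| ^+ 2.
have -> : (fun i => dotp (f i) (g i) : R[i]^o) =
  2^-1 \*: ((sq (f + g) \+ -1 \*: sq f \+ -1 \*: sq g) \+
   'i \*: (sq (f + 'i *: g) \+ -1 \*: sq f \+ -1 \*: sq g)).
  by apply/funext => i /=; rewrite polarization !scaleN1r.
rewrite !(partial_sumD, partial_sumZ).
have cvgP (u v w : I -> R[i]^o) (a b c : R[i]^o) :
    partial_sum u @ totally --> a -> partial_sum v @ totally --> b ->
    partial_sum w @ totally --> c ->
    (partial_sum u \+ -1 \*: partial_sum v \+ -1 \*: partial_sum w) @ totally
      --> (a + -1 *: b + -1 *: c).
  move=> ua vb wc.
  exact: (cvgD (cvgD ua (cvgZl_tmp (k := -1) vb)) (cvgZl_tmp (k := -1) wc)).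
have fg := cvgP (sq (f + g)) (sq f) (sq g) _ _ _ Hp Hs Ht.
have fig := cvgP (sq (f + 'i *: g)) (sq f) (sq g) _ _ _ Hq Hs Ht.
exact: (cvgZl_tmp (k := 2^-1) (cvgD fg (cvgZl_tmp (k := 'i) fig))).
Qed.

Let hsum_form_unique (f g : hsum) (s : R[i]^o) :
  partial_sum (fun i => dotp (f i) (g i) : R[i]^o) @ totally --> s ->
  hsum_form f g = s.
Proof. exact: (cvg_lim (@norm_hausdorff _ R[i]^o)). Qed.

Let hsum_form_linear a (f g h : hsum) :
  hsum_form (a *: f + g) h = a * hsum_form f h + hsum_form g h.
Proof.
apply: hsum_form_unique.
have -> : (fun i => dotp ((a *: f + g) i) (h i) : R[i]^o) =
  (a \*: (fun i => dotp (f i) (h i) : R[i]^o)) \+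
  (fun i => dotp (g i) (h i) : R[i]^o).
  by apply/funext => i /=; rewrite linearPl.
rewrite partial_sumD partial_sumZ.
pose s : R[i]^o := hsum_form f h; pose t : R[i]^o := hsum_form g h.
rewrite -[_ + _]/(a *: s + t).
exact: (cvgD (cvgZl_tmp (k := a) (@hsum_form_cvg f h)) (@hsum_form_cvg g h)).
Qed.

Let hsum_form_conj (f g : hsum) : hsum_form f g = (hsum_form g f)^*.
Proof.
apply: hsum_form_unique.
have -> : (fun i => dotp (f i) (g i) : R[i]^o) =
    (fun i => (dotp (g i) (f i))^*).
  by apply/funext => i /=; rewrite hermC mul1r.
apply/cvgrPdist_lt => e e0.
have /cvgrPdist_lt/(_ e e0) := @hsum_form_cvg g f.
apply: filterS => A.
rewrite -norm_conjC rmorphB/= /partial_sum [in X in X -> _]rmorph_sum/=.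
by under [in X in X -> _]eq_bigr do rewrite /=.
Qed.

Let hsum_form_lub (f : hsum) :
  (forall A, partial_sum (fun i => `|f i| ^+ 2) A <= hsum_form f f) /\
  (forall M, (forall A, partial_sum (fun i => `|f i| ^+ 2) A <= M) ->
    hsum_form f f <= M).
Proof.
have [s [Hs1 Hs2 Hs]] := sq_cvg f.
have -> : hsum_form f f = s.
  apply: hsum_form_unique; under eq_fun do rewrite dotpE; exact: Hs.
by [].
Qed.

Let hsum_form_gt0 (f : hsum) : f != 0 -> 0 < hsum_form f f.
Proof.
move=> f0; have [i fi0] : exists i, f i != 0.
  apply/not_existsP => H; move/eqP: f0; apply; apply: hsumP => i.
  by apply/eqP; have /negP := H i; rewrite negbK.
apply: lt_le_trans (_ : 0 < `|f i| ^+ 2) _; first by rewrite exprn_gt0 ?normr_gt0.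
have := (hsum_form_lub f).1 [fset i]%fset.
by rewrite partial_sumE big_seq_fset1.
Qed.

Let le_norm_form (f : hsum) i : `|f i| ^+ 2 <= hsum_form f f.
Proof.
have := (hsum_form_lub f).1 [fset i]%fset.
by rewrite partial_sumE big_seq_fset1.
Qed.

Let hsum_form_complete (F : set_system hsum) : ProperFilter F ->
    (forall e : R[i], 0 < e ->
       exists x, F [set y | hsum_form (x - y) (x - y) < e]) ->
    exists l, forall e : R[i], 0 < e ->
      F [set y | hsum_form (l - y) (l - y) < e].
Proof.
move=> FF Fc.
have [l Hl] : exists l : forall i, K i,
    forall i e, 0 < e -> F [set y : hsum | `|l i - y i| ^+ 2 < e].
  suff H i : exists li : K i,
      forall e, 0 < e -> F [set y : hsum | `|li - y i| ^+ 2 < e].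
    by exists (fun i => projT1 (cid (H i))) => i; case: cid.
  have /cvg_ex[li /cvgrPdist_lt Hli] : cvg ((fun y : hsum => y i) @ F).
    apply: cauchy_cvg; apply: cauchy_exP => e e0.
    have [x Fx] := Fc _ (exprn_gt0 2 e0); exists (x i).
    have : F [set y : hsum | ball (x i) e (y i)]; last by [].
    apply: filterS Fx => y /= xy; rewrite -ball_normE/=.
    rewrite -(@ltr_pXn2r _ 2)// ?nnegrE ?normr_ge0 ?ltW//.
    exact: le_lt_trans (le_norm_form _ _) xy.
  exists li => e e0; have se0 : 0 < sqrtC e by rewrite sqrtC_gt0.
  apply: filterS (Hli _ se0) => y /= Hy.
  by rewrite -(sqrtCK e) ltr_pXn2r// ?nnegrE ?normr_ge0 ?ltW.
have bnd d x (A : {fset I}) : 0 < d ->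
    F [set y | hsum_form (x - y) (x - y) < d] ->
    partial_sum (fun i => `|x i - l i| ^+ 2) A <= 4 * d.
  move=> d0 Fx; pose c := d / (#|{: A}|.+1)%:R.
  have c0 : 0 < c by rewrite divr_gt0.
  have Fl : F [set y : hsum | forall i : A, `|l (val i) - y (val i)| ^+ 2 < c].
    by apply: filter_forall => i; exact: Hl.
  have [y [/= xy yl]] := @filter_ex _ F _ _ (filterI Fx Fl).
  apply: (le_trans (y := \sum_(i : A)
      (2 * `|(x - y) (val i)| ^+ 2 + 2 * c))).
    apply: ler_sum => i _; rewrite -(subrKA (y (val i))).
    apply: le_trans (norm_sqD _ _) _; rewrite lerD2l ler_pM2l// ltW//.
    by rewrite distrC; exact: yl.
  rewrite big_split/= -mulr_sumr.
  have -> : 4 * d = 2 * d + 2 * d by rewrite -mulrDl -natrD.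
  apply: lerD.
    rewrite ler_pM2l//; apply: le_trans (ltW xy).
    exact: (hsum_form_lub (x - y)).1.
  rewrite sumr_const -mulrnAr ler_pM2l// /c -mulr_natr mulrAC -mulrA.
  by rewrite ler_piMr ?(ltW d0)// ler_pdivrMr// mul1r ler_nat.
have sql : sq_summable l.
  have [x Fx] := Fc 1 ltr01.
  suff : sq_summable (fun i => x i - (x i - l i)).
    by move=> [M HM]; exists M => A; under eq_fun do rewrite -(subKr (x _) (l _)); exact: HM.
  apply: sq_summableD; first exact: hsum_sq_summable.
  by apply: sq_summableN; exists (4 * 1) => A; exact: bnd.
exists (HSum sql) => e e0; pose d := e / 16.
have d0 : 0 < d by rewrite divr_gt0.
have [x Fx] := Fc _ d0.
apply: filterS (Fx) => y /= xy.
apply: le_lt_trans (_ : _ <= 10 * d) _; last first.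
  by rewrite /d mulrCA gtr_pMr// ltr_pdivrMr// mul1r ltr_nat.
apply: (hsum_form_lub _).2 => A.
apply: (le_trans (y := \sum_(i : A)
    (2 * `|x (val i) - l (val i)| ^+ 2 + 2 * `|(x - y) (val i)| ^+ 2))).
  apply: ler_sum => i _ /=; rewrite -(subrKA (x (val i))).
  by apply: le_trans (norm_sqD _ _) _; rewrite (distrC (l _)).
rewrite big_split/= -!mulr_sumr.
have -> : 10 * d = 2 * (4 * d) + 2 * d by rewrite mulrA -mulrDl -natrM -natrD.
apply: lerD; rewrite ler_pM2l//; first exact: bnd.
by apply: le_trans (ltW xy); exact: (hsum_form_lub (x - y)).1.
Qed.

HB.instance Definition _ := Lmodule_isHilbert.Build R hsum
  hsum_form_linear hsum_form_conj hsum_form_gt0 hsum_form_complete.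

Lemma hsum_dotpE (f g : hsum) :
  dotp f g = summability.sum (fun i => dotp (f i) (g i) : R[i]^o).
Proof. by []. Qed.

End HilbertSum.

Section Operators.
Variables (R : realType).

Definition bounded_op (H K : hilbertType R) (A : H -> K) :=
  linear A /\ exists M : R[i], forall x, `|A x| <= M * `|x|.

Definition contraction (H K : hilbertType R) (A : H -> K) :=
  bounded_op A /\ forall x, `|A x| <= `|x|.

Definition unitary_op (H K : hilbertType R) (A : H -> K) :=
  [/\ linear A, forall x y, dotp (A x) (A y) = dotp x y &
      forall y, exists x, A x = y].

(* In the order of R[i], 0 <= z means that z is real and nonnegative. *)
Definition positive_op (H : hilbertType R) (A : H -> H) :=
  bounded_op A /\ forall x, 0 <= dotp (A x) x.

(* The adjoint and the positive square root are defined by description: the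
   operator B is unique, and exists when A is bounded, resp. positive. *)
Definition adj (H K : hilbertType R) (A : H -> K) : K -> H :=
  xget (fun=> 0) [set B | bounded_op B /\
                          forall x y, dotp (A x) y = dotp x (B y)].

Definition psqrt (H : hilbertType R) (A : H -> H) : H -> H :=
  xget (fun=> 0) [set B | positive_op B /\ forall x, B (B x) = A x].

Lemma psqrt_linear (H : hilbertType R) (A : H -> H) : linear (psqrt A).
Proof.
rewrite /psqrt; case: xgetP => [B _ [[[]]] //|_ a x y].
by rewrite /= scaler0 addr0.
Qed.

HB.instance Definition _ (H : hilbertType R) (A : H -> H) :=
  GRing.isLinear.Build R[i] H H *:%R (psqrt A) (psqrt_linear A).

Section RangeClosure.
Variables (H K : hilbertType R) (A : {linear H -> K}).

Lemma ran_closure0 : closure (range A) 0.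
Proof. by apply: subset_closure; exists 0; rewrite ?linear0. Qed.

Lemma ran_closure_linear (a : R[i]) x y :
  closure (range A) x -> closure (range A) y ->
  closure (range A) (a *: x + y).
Proof.
move=> cx cy B nB.
have cont : (fun z : K * K => a *: z.1 + z.2) @ (x, y) --> a *: x + y.
  apply: cvgD; last exact: cvg_snd.
  by apply: cvgZl_tmp; exact: cvg_fst.
have [[P Q] [/= nP nQ] PQB] := cont _ nB.
have [_ [[u _ <-] Pu]] := cx _ nP; have [_ [[v _ <-] Qv]] := cy _ nQ.
exists (A (a *: u + v)); split; first by exists (a *: u + v).
by rewrite linearP; exact: (PQB (A u, A v)).
Qed.

Definition ran_closure : closed_subspace K :=
  ClosedSubspace (@closed_closure _ _) ran_closure0 ran_closure_linear.

End RangeClosure.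

(* (I - A^* A)^(1/2) *)
Definition defect (H K : hilbertType R) (A : H -> K) : H -> H :=
  psqrt (fun x => x - adj A (A x)).

HB.instance Definition _ (H K : hilbertType R) (A : H -> K) :=
  GRing.Linear.on (defect A).

Definition hsum2 (H K : hilbertType R) : hilbertType R :=
  hsum (fun b : bool => if b then H else K).

Definition hfst (H K : hilbertType R) (f : hsum2 H K) : H :=
  (f : hsum (fun b : bool => if b then H else K)) true.
Definition hsnd (H K : hilbertType R) (f : hsum2 H K) : K :=
  (f : hsum (fun b : bool => if b then H else K)) false.

Definition separable (H : hilbertType R) :=
  exists D : set H, countable D /\ dense D.

End Operators.

(* The index set {1, .., n}, shifted to start at 0; None stands for n = oo. *)
Definition below (n : option nat) (i : nat) : bool :=
  if n is Some m then (i < m)%N else true.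
Definition idx (n : option nat) := {i : nat | below n i}.

HB.instance Definition _ n := Choice.on (idx n).

Definition word (n : option nat) := seq (idx n).
HB.instance Definition _ n := Choice.on (word n).

Section Fock.
Variables (R : realType) (n : option nat).
Implicit Types (H K : hilbertType R).

(* F^2(H_n) (x) K. Words are the basis index of F^2(H_n), so that this is the
   space of square-summable K-valued families indexed by words; etens w x is
   e_w (x) x and creation i is S_i (x) I. *)
Definition fock K : hilbertType R := hsum (fun _ : word n => K).

Lemma etens_sq K (w : word n) (x : K) :
  sq_summable (fun v => if v == w then x else 0).
Proof.
exists (`|x| ^+ 2) => A; rewrite partial_sumE.
have [wA|wA] := boolP (w \in A).
  rewrite (big_fsetD1 w)//= eqxx big_seq_cond big1 ?addr0// => v.
  by rewrite !inE andbT => /andP[/negbTE -> _]; rewrite normr0 expr0n.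
rewrite big_seq_cond big1 ?exprn_ge0// => v; rewrite andbT => vA.
case: eqVneq => [vw|_]; first by rewrite -vw vA in wA.
by rewrite normr0 expr0n.
Qed.

Definition etens K (w : word n) (x : K) : fock K := HSum (etens_sq w x).

Lemma creation_sq K (i : idx n) (f : fock K) :
  sq_summable (fun w : word n =>
    if w is j :: v then if j == i then (f : hsum _) v else 0 else 0).
Proof.
have [M HM] := hsum_sq_summable f; exists M => A.
pose A' := [fset w in A | ohead w == Some i]%fset.
pose B := [fset behead w | w in A']%fset.
apply: (le_trans _ (HM B)); rewrite !partial_sumE big_imfset/=; last first.
  move=> [|j v] [|k w]; rewrite !inE ?andbF//=.
  by move=> /andP[_ /eqP[->]] /andP[_ /eqP[->]] ->.
rewrite (big_fsetID _ (fun w => ohead w == Some i) A)/= [X in _ + X]big1_fset.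
  rewrite addr0 le_eqVlt; apply/orP; left; apply/eqP.
  rewrite !(big_seq_cond (fun _ => true)); apply: eq_bigr => -[|j v].
    by rewrite !inE andbF.
  by rewrite !inE andbT /= => /andP[_ /eqP[->]]; rewrite eqxx.
move=> [|j v]; rewrite !inE /= => /andP[_ ji] _; rewrite ?normr0 ?expr0n//.
have -> : (j == i) = false by apply: contraNF ji => /eqP ->.
by rewrite normr0 expr0n.
Qed.

Definition creation K (i : idx n) (f : fock K) : fock K :=
  HSum (creation_sq i f).

Lemma creation_etens K i w (x : K) :
  creation i (etens w x) = etens (i :: w) x.
Proof.
apply: hsumP => -[|j v] //=; rewrite eqseq_cons.
by case: (j == i).
Qed.

Lemma dotp_etens K (f : fock K) w (x : K) :
  dotp f (etens w x) = dotp ((f : hsum _) w) x.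
Proof.
rewrite hsum_dotpE; apply: (cvg_lim (@norm_hausdorff _ R[i]^o)).
apply: cvg_near_cst; exists [fset w]%fset => // A /=.
rewrite fsub1set partial_sumE => wA.
rewrite (big_fsetD1 w)//= eqxx big_seq_cond big1 ?addr0// => v.
by rewrite !inE andbT => /andP[/negbTE -> _]; rewrite linear0r.
Qed.

Definition multi_analytic H K (A : fock H -> fock K) :=
  bounded_op A /\ forall i f, A (creation i f) = creation i (A f).

Definition unitary_constant H K (A : fock H -> fock K) :=
  exists W : H -> K, unitary_op W /\
    forall w x, A (etens w x) = etens w (W x).

End Fock.

Section RowContraction.
Variables (R : realType) (n : option nat) (H : hilbertType R).
Implicit Types (T : idx n -> H -> H).

(* summability.sum is the limit over the net of finite partial sums. For the
   operator sums below it agrees with the sum in any enumeration. *)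
Definition row_op T (h : hsum (fun _ : idx n => H)) : H :=
  summability.sum (fun i => T i (h i)).

(* \sum_i T_i T_i^* *)
Definition row_gram T (h : H) : H :=
  summability.sum (fun i => T i (adj (T i) h)).

Definition row_contraction T :=
  [/\ forall i, bounded_op (T i),
      forall h, cvg (partial_sum (fun i => T i (adj (T i) h)) @ totally) &
      forall h, dotp (row_gram T h) h <= dotp h h].

Definition word_op T (w : word n) : H -> H :=
  foldr (fun i A => T i \o A) id w.

Definition completely_non_coisometric T :=
  forall h : H,
    (forall k, (0 < k)%N ->
       partial_sum (fun w : k.-tuple (idx n) =>
         `|adj (word_op T w) h| ^+ 2 : R[i]^o) @ totally -->
       (`|h| ^+ 2 : R[i]^o)) ->
    h = 0.

(* (I - \sum_i T_i T_i^* )^(1/2) *)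
Definition defect_star T : H -> H := psqrt (fun h => h - row_gram T h).

HB.instance Definition _ T := GRing.Linear.on (defect_star T).

Definition Dspace T : hilbertType R := csub (ran_closure (defect (row_op T))).
Definition Dstar T : hilbertType R := csub (ran_closure (defect_star T)).

(* Only applied below to vectors of H that lie in Dstar T. *)
Definition to_Dstar T (x : H) : Dstar T := insubd (0 : csub _) x.

Definition char_symbol T (h : Dspace T) : fock n (Dstar T) :=
  - etens [::] (to_Dstar T (row_op T (val h))) +
  summability.sum (fun i : idx n => creation i
    (summability.sum (fun w : word n => etens w
      (to_Dstar T (defect_star T
        (adj (word_op T w) (defect (row_op T) (val h) i))))))).

(* By description: a multi-analytic operator is determined by its symbol. *)
Definition char_fun T : fock n (Dspace T) -> fock n (Dstar T) :=
  xget (fun=> 0) [set A | [/\ contraction A, multi_analytic A &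
    forall h, A (etens [::] h) = char_symbol h]].

End RowContraction.

Arguments char_symbol {R n H} T h.
Arguments char_fun {R n H} T.

Section Factorization.
Variables (R : realType) (n : option nat) (E Es : hilbertType R).
Variable A : fock n E -> fock n Es.

(* The last clause says that X_A, the isometry with
   X_A (Delta_A f) = Delta_2 (A1 f) (+) Delta_1 f, is unitary; the formula
   determines a bounded X on the closure of the range of Delta_A. *)
Definition regular_factorization (F : hilbertType R)
    (A1 : fock n E -> fock n F) (A2 : fock n F -> fock n Es) :=
  [/\ contraction A1 /\ multi_analytic A1,
      contraction A2 /\ multi_analytic A2,
      A = A2 \o A1 &
      exists X : csub (ran_closure (defect A)) ->
                 hsum2 (csub (ran_closure (defect A2)))
                       (csub (ran_closure (defect A1))),
        unitary_op X /\
        forall x f, val x = defect A f ->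
          val (hfst (X x)) = defect A2 (A1 f) /\
          val (hsnd (X x)) = defect A1 f].

Definition has_nontrivial_regular_factorization :=
  exists (F : hilbertType R) (A1 : fock n E -> fock n F)
      (A2 : fock n F -> fock n Es),
    [/\ regular_factorization A1 A2,
        ~ unitary_constant A1 & ~ unitary_constant A2].

End Factorization.

Definition has_nontrivial_invariant_subspace (R : realType) (n : option nat)
    (H : hilbertType R) (T : idx n -> H -> H) :=
  exists M : closed_subspace H,
    [/\ csub_set M <> [set 0], csub_set M <> setT &
        forall i x, csub_set M x -> csub_set M (T i x)].

(* Main.v *)
Require Import Defs.
From HB Require Import structures.
From mathcomp Require Import all_boot all_order all_algebra.
From mathcomp Require Import sesquilinear complex finmap.
From mathcomp Require Import boolp classical_sets reals topology normedtype.
From mathcomp Require Import summability ring.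
Require Import Defs.

Set Implicit Arguments.
Unset Strict Implicit.
Unset Printing Implicit Defensive.

Import Order.TTheory GRing.Theory Num.Theory.
Import numFieldNormedType.Exports.

Local Open Scope classical_set_scope.
Local Open Scope ring_scope.

(** The theorem is a statement about the minimal isometric dilation of T. Write
    F2 (x) D for [fock n D], and let D, D' be the two defect spaces. On the
    space K = H (+) F2 (x) D the operators V_i (h, f) = (T_i h, 1 (x) Delta_T
    h_i + S_i f), with h_i the vector h in the i-th place, are isometries with
    orthogonal ranges; they extend the S_i on F2 (x) D and compress to the T_i
    on H. The vectors j x = (Delta_T' x, - 1 (x) T^* x), for x in D' and
    Delta_T' its defect operator, are the wandering vectors of V, so that k |->
    (j^* V_w^* k)_w is a coisometry Phi : K -> F2 (x) D' with Phi V_i = S_i Phi.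
    On F2 (x) D it is the characteristic function, since both sides are
    multi-analytic with the same symbol ([char_funE]).

    Let R be the kernel of Phi, on which V is of Cuntz type, and P its
    projection. For a completely non-coisometric T, R meets H only in 0
    ([completely_non_coisometric_model]). Therefore P maps F2 (x) D onto a dense
    subspace of R ([residual_dense]); since |P f|^2 = |f|^2 - |Theta f|^2, the
    vector P f takes the place of Delta_Theta f. Regularity of Theta = Theta_2
    Theta_1 then becomes an approximation property of the quadratic forms |f|^2
    - |Theta_j f|^2, free of closures and square roots ([regular_dense],
    [regular_surjective]).

    An invariant subspace M gives the V-invariant subspace N = M (+) F2 (x) D.
    Let F be the space of wandering vectors of the restriction of V to N and Xi
    its Fourier coisometry, from K to F2 (x) F. Then Theta_1 = Xi on F2 (x) D
    and Theta_2 = Phi Xi^* are multi-analytic. The kernel of Xi on N lies in R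
    ([restricted_kernel]), which yields the factorization and its regularity. If
    Theta_1 is a unitary constant then M = 0, if Theta_2 is one then M = H.

    Conversely, a regular factorization yields an isometry Psi : F2 (x) F -> K
    with V_i Psi = Psi S_i, Phi Psi = Theta_2 and <Psi u, f> = <u, Theta_1 f>
    for f in F2 (x) D ([embedding_creation], [Phi_embedding], [embedding_iD]).
    The closure M of the projection of its range to H is invariant. If M = 0,
    then every vector is the image under Theta_1 of a vector of the same norm,
    and likewise for Theta_2 if M = H. A contractive multi-analytic operator
    with this property that kills no constant is a unitary constant
    ([unitary_constant_criterion]), and neither factor kills a constant, because
    the vectors j x and V_i k together span K ([dilation_total]). *)

(** * The inner product and orthogonal projections *)

Section Dot.
Variables (R : realType) (V : hilbertType R).
Implicit Types (x y z : V) (a : R[i]).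

Lemma dotDl x y z : dotp (x + y) z = dotp x z + dotp y z.
Proof. exact: linearDl. Qed.
Lemma dotDr x y z : dotp z (x + y) = dotp z x + dotp z y.
Proof. exact: linearDr. Qed.
Lemma dotBl x y z : dotp (x - y) z = dotp x z - dotp y z.
Proof. exact: linearBl. Qed.
Lemma dotBr x y z : dotp z (x - y) = dotp z x - dotp z y.
Proof. exact: linearBr. Qed.
Lemma dotNl x y : dotp (- x) y = - dotp x y.
Proof. exact: linearNl. Qed.
Lemma dotNr x y : dotp x (- y) = - dotp x y.
Proof. exact: linearNr. Qed.
Lemma dot0l x : dotp (0 : V) x = 0.
Proof. exact: linear0l. Qed.
Lemma dot0r x : dotp x (0 : V) = 0.
Proof. exact: linear0r. Qed.
Lemma dotZl a x y : dotp (a *: x) y = a * dotp x y.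
Proof. exact: linearZl_LR. Qed.
Lemma dotZr a x y : dotp x (a *: y) = a^* * dotp x y.
Proof. exact: linearZr_LR. Qed.
Lemma dotC x y : dotp x y = (dotp y x)^*.
Proof. by rewrite hermC mul1r. Qed.
Lemma dot_suml I (r : seq I) (P : pred I) (F : I -> V) y :
  dotp (\sum_(i <- r | P i) F i) y = \sum_(i <- r | P i) dotp (F i) y.
Proof. exact: linear_sumlz. Qed.
Lemma dot_sumr I (r : seq I) (P : pred I) (F : I -> V) y :
  dotp y (\sum_(i <- r | P i) F i) = \sum_(i <- r | P i) dotp y (F i).
Proof. exact: linear_sumr. Qed.

Lemma dot_ge0 x : 0 <= dotp x x. Proof. by rewrite dotpE exprn_ge0. Qed.
Lemma dot_eq0 x : dotp x x = 0 -> x = 0.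
Proof. by move/eqP; rewrite dotpE sqrf_eq0 normr_eq0 => /eqP. Qed.
Lemma dot_eq0C x y : dotp x y = 0 -> dotp y x = 0.
Proof. by rewrite (dotC y) => ->; rewrite conjC0. Qed.
Lemma dot_ext x y : (forall z, dotp x z = dotp y z) -> x = y.
Proof.
move=> h; apply/eqP; rewrite -subr_eq0; apply/eqP/dot_eq0.
by rewrite dotBl !h subrr.
Qed.

Lemma dotD2 x y :
  dotp (x + y) (x + y) = dotp x x + dotp y y + (dotp x y + dotp y x).
Proof. rewrite dotDl !dotDr; ring. Qed.
Lemma dotB2 x y :
  dotp (x - y) (x - y) = dotp x x + dotp y y - (dotp x y + dotp y x).
Proof. rewrite dotBl !dotBr; ring. Qed.
Lemma dot_pyth x y : dotp x y = 0 ->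
  dotp (x + y) (x + y) = dotp x x + dotp y y.
Proof. by move=> h; rewrite dotD2 h (dot_eq0C h) !addr0. Qed.
Lemma parallelogram x y : dotp (x + y) (x + y) + dotp (x - y) (x - y) =
  2 * dotp x x + 2 * dotp y y.
Proof. rewrite dotD2 dotB2; ring. Qed.

Lemma normr_lt_sqr x a : 0 < a -> (`|x| < a) = (dotp x x < a ^+ 2).
Proof. by move=> a0; rewrite dotpE ltr_pXn2r// ?nnegrE ?normr_ge0 ?ltW. Qed.

Lemma norm_eqP x (W : hilbertType R) (y : W) :
  dotp x x = dotp y y -> `|x| = `|y|.
Proof.
rewrite !dotpE => /eqP; rewrite eqrXn2 ?normr_ge0// => /eqP//.
Qed.

End Dot.

(** Polarization: the diagonal at x + y gives s x y = - s y x, and at x + 'i *: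
    y it gives s x y = s y x. *)
Lemma sesqui_eq0 (R : realType) (W : lmodType R[i]) (s : W -> W -> R[i]) :
  (forall x y z, s (x + y) z = s x z + s y z) ->
  (forall x y z, s z (x + y) = s z x + s z y) ->
  (forall a x y, s (a *: x) y = a * s x y) ->
  (forall a x y, s x (a *: y) = a^* * s x y) ->
  (forall x, s x x = 0) -> forall x y, s x y = 0.
Proof.
move=> Dl Dr Zl Zr d x y.
have h1 : s x y = - s y x.
  apply/eqP; rewrite -addr_eq0 -[X in _ == X](d (x + y)) Dl !Dr !d.
  by rewrite add0r addr0.
have h2 : s y x = s x y.
  have : s x ('i *: y) = - s ('i *: y) x.
    apply/eqP; rewrite -addr_eq0 -[X in _ == X](d (x + 'i *: y)) Dl !Dr.
    by rewrite !d add0r addr0.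
  by rewrite Zr Zl conjCi mulNr => /oppr_inj/(mulfI (neq0Ci _)).
apply/eqP; move: h1; rewrite h2 => /eqP.
by rewrite -addr_eq0 -mulr2n mulrn_eq0.
Qed.

(** Rules for a function that comes with a proof of linearity. *)
Section Lin.
Variables (R : realType) (V W : hilbertType R) (A : V -> W).
Hypothesis lA : linear A.

Lemma linB x y : A (x - y) = A x - A y.
Proof. by rewrite -[x - y]addrC -scaleN1r lA scaleN1r addrC. Qed.
Lemma lin0 : A 0 = 0.
Proof. by rewrite -(subrr 0) linB subrr. Qed.
Lemma linN x : A (- x) = - A x.
Proof. by rewrite -(sub0r x) linB lin0 sub0r. Qed.
Lemma linD x y : A (x + y) = A x + A y.
Proof. by rewrite -(opprK y) linB linN !opprK. Qed.
Lemma linZ a x : A (a *: x) = a *: A x.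
Proof. by rewrite -[a *: x]addr0 lA lin0 addr0. Qed.
Lemma lin_sum I (r : seq I) (P : pred I) (F : I -> V) :
  A (\sum_(i <- r | P i) F i) = \sum_(i <- r | P i) A (F i).
Proof. exact: (big_morph A linD lin0). Qed.
End Lin.

Section Topology.
Variables (R : realType) (V : hilbertType R).
Implicit Types (x y z : V).

(** Completeness in the form used for all limits below: the limit is taken along
    a filter on an arbitrary index type. *)
Lemma complete_filter (T : Type) (F : set_system T) (FF : ProperFilter F)
    (u : T -> V) :
  (forall e : R[i], 0 < e -> exists x, F [set t | `|x - u t| < e]) ->
  exists l, forall e : R[i], 0 < e -> F [set t | `|l - u t| < e].
Proof.
move=> Fc; have /cvg_ex[l /cvgrPdist_lt Hl] : cvg (u @ F).
  apply: cauchy_cvg; apply: cauchy_exP => e e0.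
  have [x Fx] := Fc _ e0; exists x.
  have : F [set t | ball x e (u t)]; last by [].
  by apply: filterS Fx => t; rewrite /= -ball_normE.
by exists l => e e0; exact: Hl.
Qed.

Lemma closureP (A : set V) x :
  closure A x <-> forall e : R[i], 0 < e -> exists2 y, A y & `|x - y| < e.
Proof.
split=> [cx e e0|h B /nbhs_ballP[e /= e0 Be]].
  have [y [Ay xy]] := cx _ (nbhsx_ballx x e e0).
  by exists y => //; move: xy; rewrite -ball_normE.
have [y Ay xy] := h e e0; exists y; split=> //.
by apply: Be; rewrite -ball_normE.
Qed.

Lemma closure_sqP (A : set V) x : closure A x <->
  forall e : R[i], 0 < e -> exists2 y, A y & dotp (x - y) (x - y) < e.
Proof.
rewrite closureP; split=> h e e0.
  have se0 : 0 < sqrtC e by rewrite sqrtC_gt0.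
  by have [y Ay] := h _ se0; rewrite normr_lt_sqr// sqrtCK; exists y.
by have [y Ay xy] := h _ (exprn_gt0 2 e0); exists y; rewrite ?normr_lt_sqr.
Qed.

Lemma norm_small (W : normedZmodType R[i]) (x : W) :
  (forall e : R[i], 0 < e -> `|x| < e) -> x = 0.
Proof.
move=> h; apply/eqP; apply: contraT; rewrite -normr_gt0 => /h.
by rewrite ltxx.
Qed.

Lemma norm_le_eps (a b : R[i]) : 0 <= a -> 0 <= b ->
  (forall e, 0 < e -> a <= b + e) -> a <= b.
Proof.
move=> a0 b0 h; rewrite real_leNgt ?ger0_real//; apply/negP => ba.
have e0 : 0 < (a - b) / 2 by rewrite divr_gt0// subr_gt0.
have := h _ e0; rewrite real_leNgt ?ger0_real ?addr_ge0 ?(ltW e0)//.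
by rewrite -ltrBrDl gtr_pMr ?subr_gt0// invf_lt1 ?ltr1n ?ltr0n.
Qed.

Lemma dot_norm_le x y : `|dotp x y| <= `|x| * `|y|.
Proof.
rewrite -(@ler_pXn2r _ 2) ?nnegrE ?mulr_ge0// exprMn -!dotpE.
exact: dot_CauchySchwarz.
Qed.

Lemma dot_small x y : (forall e : R[i], 0 < e -> exists2 w,
  `|x - w| < e & dotp w y = 0) -> dotp x y = 0.
Proof.
move=> h; apply/eqP; rewrite -normr_eq0.
apply: contraT; rewrite -normr_gt0 normr_id => d0.
have e0 : 0 < `|dotp x y| / (`|y| + 1).
  by rewrite divr_gt0// ltr_wpDl.
have [w xw wy] := h _ e0.
have : `|dotp x y| <= `|x - w| * `|y|.
  by rewrite -[dotp x y]subr0 -wy -dotBl dot_norm_le.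
move=> /le_lt_trans -/(_ `|dotp x y|).
suff H : `|x - w| * `|y| < `|dotp x y| by move=> /(_ H); rewrite ltxx.
apply: le_lt_trans (_ : _ <= `|x - w| * (`|y| + 1)) _.
  by rewrite ler_wpM2l// lerDl.
by rewrite -ltr_pdivlMr// ltr_wpDl.
Qed.

Definition operp_set (S : set V) : set V :=
  [set x | forall s, S s -> dotp x s = 0].

Lemma operp_set_closed (S : set V) : closed (operp_set S).
Proof.
move=> x /closureP cx s Ss; apply: dot_small => e e0.
by have [y Sy xy] := cx _ e0; exists y => //; exact: Sy.
Qed.

Lemma operp_set0 (S : set V) : operp_set S 0.
Proof. by move=> s _; rewrite dot0l. Qed.

Lemma operp_set_linear (S : set V) (a : R[i]) x y :
  operp_set S x -> operp_set S y -> operp_set S (a *: x + y).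
Proof. by move=> hx hy s Ss; rewrite dotDl dotZl hx// hy// mulr0 addr0. Qed.

Definition operp (S : set V) : closed_subspace V :=
  ClosedSubspace (@operp_set_closed S) (@operp_set0 S) (@operp_set_linear S).

End Topology.

Section Projection.
Variables (R : realType) (V : hilbertType R) (M : closed_subspace V).

Lemma csubZ a (x : V) : csub_set M x -> csub_set M (a *: x).
Proof.
by move=> Mx; rewrite -[a *: x]addr0; apply: csub_linear => //; exact: csub0.
Qed.
Lemma csubD (x y : V) : csub_set M x -> csub_set M y -> csub_set M (x + y).
Proof. by move=> Mx My; rewrite -(scale1r x); exact: csub_linear. Qed.
Lemma csubN (x : V) : csub_set M x -> csub_set M (- x).
Proof. by rewrite -scaleN1r; exact: csubZ. Qed.
Lemma csubB (x y : V) : csub_set M x -> csub_set M y -> csub_set M (x - y).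
Proof. by move=> Mx My; apply: csubD => //; exact: csubN. Qed.

Lemma csub_closureP (x : V) :
  (forall e : R[i], 0 < e -> exists2 y, csub_set M y & `|x - y| < e) ->
  csub_set M x.
Proof. by move=> h; apply: (csub_closed (c := M)); apply/closureP. Qed.

(** A minimizing filter for the distance to M is Cauchy by the parallelogram
    identity; its limit is the foot of the perpendicular. *)
Theorem projection (x : V) :
  exists2 p, csub_set M p & forall m, csub_set M m -> dotp (x - p) m = 0.
Proof.
pose f m : R := complex.Re (dotp (x - m) (x - m)).
have fE m : (f m)%:C%C = dotp (x - m) (x - m).
  by rewrite /f RRe_real// ger0_real// dot_ge0.
pose D := f @` (M : set V).
have hD : has_inf D.
  split; first by exists (f 0), 0 => //; exact: csub0.
  by exists 0 => _ [m _ <-]; rewrite -ler0c fE dot_ge0.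
pose d := inf D; have dle m : csub_set M m -> d <= f m.
  by move=> Mm; apply: ge_inf; [exact: hD.2|exists m].
pose F : set_system V :=
  filter_from [set e : R | 0 < e]
    (fun e => [set m | csub_set M m /\ f m < d + e]).
have FF : ProperFilter F.
  apply: filter_from_proper; last first.
    move=> e e0; have [_ [m Mm <-] fm] := inf_adherent e0 hD.
    by exists m.
  apply: filter_from_filter; first by exists 1; exact: ltr01.
  move=> i j i0 j0; exists (Order.min i j); first by rewrite /= lt_min i0.
  move=> m [Mm]; rewrite -ltrBlDl lt_min => /andP[].
  by rewrite !ltrBlDl.
have par m m' : csub_set M m -> csub_set M m' ->
    dotp (m - m') (m - m') <= (2 * (f m - d) + 2 * (f m' - d))%:C%C.
  move=> Mm Mm'; have Mh : csub_set M (2^-1 *: (m + m')).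
    by apply: csubZ; exact: csubD.
  have := parallelogram (x - m') (x - m).
  have -> : x - m' - (x - m) = m - m' by rewrite opprB addrC addrA subrK.
  have -> : x - m' + (x - m) = 2 *: (x - 2^-1 *: (m + m')).
    rewrite scalerBr scalerA mulfV ?pnatr_eq0// scale1r scaler_nat mulr2n.
    by rewrite opprD addrACA [- m' + _]addrC.
  rewrite dotZl dotZr conjC_nat -!fE => h.
  have -> : dotp (m - m') (m - m') =
      (2 * f m + 2 * f m' - 4 * f (2^-1 *: (m + m')))%:C%C.
    apply: (addrI (2 * (2 * (f (2^-1 *: (m + m')))%:C%C))); rewrite h.
    by rewrite rmorphB rmorphD !rmorphM/= !rmorph_nat; ring.
  rewrite lecR; have := dle _ Mh => h2.
  rewrite !mulrBr addrACA lerD2l -opprD lerN2 -mulrDl -natrD.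
  by rewrite ler_wpM2l.
have [e e0|p Hp] := @complete_filter R V V F FF id.
  pose r := complex.Re (e ^+ 2) / 4.
  have eE : (complex.Re (e ^+ 2))%:C%C = e ^+ 2.
    by rewrite RRe_real// gtr0_real// exprn_gt0.
  have r0 : 0 < r by rewrite divr_gt0// -ltcR eE exprn_gt0.
  have [m [Mm fm]] := filter_ex (ex_intro2 _ _ r r0 (fun _ h => h) : F _).
  exists m, r => // m' [Mm' fm']; rewrite /= normr_lt_sqr//.
  apply: le_lt_trans (par _ _ Mm Mm') _; rewrite -eE ltcR.
  have -> : complex.Re (e ^+ 2) = 2 * r + 2 * r.
    by rewrite -mulrDl -natrD /r mulrCA mulfV ?pnatr_eq0// mulr1.
  by rewrite ltrD// ltr_pM2l// ltrBlDl.
have Mp : csub_set M p.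
  apply: csub_closureP => e e0.
  have F1 : F [set m | csub_set M m] by exists 1 => [|m []//]; exact: ltr01.
  by have [m [/= Mm pm]] := filter_ex (filterI F1 (Hp _ e0)); exists m.
exists p => // m Mm; apply: norm_small => e e0 /=.
have [->|m0] := eqVneq m 0; first by rewrite dot0r normr0.
have nm0 : 0 < `|m| by rewrite normr_gt0.
pose c := e / 2 / `|m|; have c0 : 0 < c by rewrite !divr_gt0.
pose r := complex.Re (c ^+ 2).
have rE : r%:C%C = c ^+ 2 by rewrite RRe_real// gtr0_real// exprn_gt0.
have r0 : 0 < r by rewrite -ltcR rE exprn_gt0.
have Fr : F [set m | csub_set M m /\ f m < d + r] by exists r.
have [m' [[Mm' fm'] /= pm']] := filter_ex (filterI Fr (Hp _ c0)).
have : `|dotp (x - m') m| < c * `|m|.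
  rewrite -(@ltr_pXn2r _ 2) ?nnegrE ?(mulr_ge0 (ltW c0))//.
  rewrite exprMn -rE -dotpE.
  pose t := dotp (x - m') m / dotp m m.
  have Mt : csub_set M (m' + t *: m) by apply: csubD => //; exact: csubZ.
  have mm0 : 0 < dotp m m by rewrite dotpE exprn_gt0.
  have : (f (m' + t *: m))%:C%C =
      dotp (x - m') (x - m') - `|dotp (x - m') m| ^+ 2 / dotp m m.
    rewrite fE opprD addrA (dotB2 (x - m')) !(dotZl, dotZr).
    rewrite (dotC m (x - m')) normCK /t.
    rewrite rmorphM fmorphV/= -(dotC m m); field.
    by rewrite gt_eqF.
  rewrite -fE => h.
  have : (d%:C <= (f m')%:C - `|dotp (x - m') m| ^+ 2 / dotp m m)%C.
    by rewrite -h lecR dle.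
  rewrite lerBrDr addrC -lerBrDr => /le_lt_trans; rewrite -ltr_pdivrMr//; apply.
  by rewrite -rmorphB/= ltcR ltrBlDl.
move=> h.
apply: le_lt_trans (_ : _ <= `|dotp (x - m') m| + `|dotp (p - m') m|) _.
  have -> : dotp (x - p) m = dotp (x - m') m - dotp (p - m') m.
    by rewrite -dotBl opprB addrA subrK.
  exact: ler_normB.
have -> : e = c * `|m| + c * `|m|.
  by rewrite /c divfK ?gt_eqF// -splitr.
rewrite ltrD//; apply: le_lt_trans (dot_norm_le _ _) _.
by rewrite ltr_pM2r.
Qed.

End Projection.

(** * Adjoints *)

Section Adjoint.
Variable R : realType.
Implicit Types (V W U : hilbertType R).

(** For the projection p of x to M, the vector x - p is orthogonal to M and thus
    to both x and p. *)
Lemma csub_perp V (M : closed_subspace V) (x : V) :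
  (forall y, (forall m, csub_set M m -> dotp y m = 0) -> dotp x y = 0) ->
  csub_set M x.
Proof.
move=> h; have [p Mp px] := projection M x.
suff -> : x = p by [].
apply/eqP; rewrite -subr_eq0; apply/eqP/dot_eq0.
by rewrite dotBl (h _ px) (dot_eq0C (px _ Mp)) subr0.
Qed.

Lemma csub_full V (M : closed_subspace V) :
  (forall y, (forall m, csub_set M m -> dotp y m = 0) -> y = 0) ->
  forall x, csub_set M x.
Proof. by move=> h x; apply: csub_perp => y /h ->; rewrite dot0r. Qed.

Lemma bounded_opE V W (A : V -> W) : bounded_op A ->
  linear A /\ exists2 M : R[i], 0 <= M & forall x, `|A x| <= M * `|x|.
Proof.
move=> [lA [M hM]]; split=> //; exists `|M| => // x.
have h := hM x; have h0 := le_trans (normr_ge0 _) h.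
by rewrite -[X in _ * X]normr_id -normrM (ger0_norm h0).
Qed.

Lemma contraction_bounded V W (A : V -> W) :
  linear A -> (forall x, `|A x| <= `|x|) -> bounded_op A.
Proof. by move=> lA cA; split=> //; exists 1 => x; rewrite mul1r. Qed.

Lemma contractionP V W (A : V -> W) : contraction A <->
  linear A /\ forall x, dotp (A x) (A x) <= dotp x x.
Proof.
have e x : (dotp (A x) (A x) <= dotp x x) = (`|A x| <= `|x|).
  by rewrite !dotpE ler_pXn2r// ?nnegrE.
split=> [[[lA _] cA]|[lA cA]]; first by split=> // x; rewrite e.
have cA' x : `|A x| <= `|x| by rewrite -e.
by split=> //; exact: contraction_bounded.
Qed.

Lemma isometry_contraction V W (A : V -> W) :
  linear A -> (forall x, dotp (A x) (A x) = dotp x x) -> contraction A.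
Proof. by move=> lA iA; apply/contractionP; split=> // x; rewrite iA. Qed.

Lemma isometry_dot V W (A : V -> W) : linear A ->
  (forall x, dotp (A x) (A x) = dotp x x) ->
  forall x y, dotp (A x) (A y) = dotp x y.
Proof.
move=> lA iA x y; apply/eqP; rewrite -subr_eq0; apply/eqP.
apply: (@sesqui_eq0 R V (fun x y => dotp (A x) (A y) - dotp x y))
  => [u v w|u v w|a u v|a u v|u].
- by rewrite (linD lA) !dotDl; ring.
- by rewrite (linD lA) !dotDr; ring.
- by rewrite (linZ lA) !dotZl mulrBr.
- by rewrite (linZ lA) !dotZr mulrBr.
by rewrite iA subrr.
Qed.

Lemma bounded_comp V W U (A : V -> W) (B : W -> U) :
  bounded_op A -> bounded_op B -> bounded_op (B \o A).
Proof.
move=> /bounded_opE[lA [M M0 hM]] /bounded_opE[lB [N N0 hN]]; split.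
  by move=> a x y /=; rewrite lA lB.
exists (N * M) => x /=; apply: le_trans (hN _) _.
by rewrite -mulrA ler_wpM2l.
Qed.

(** A nonzero vector orthogonal to the kernel represents phi up to a factor. *)
Theorem riesz V (phi : V -> R[i]) (C : R[i]) : 0 <= C ->
  (forall a x y, phi (a *: x + y) = a * phi x + phi y) ->
  (forall x, `|phi x| <= C * `|x|) -> exists y, forall x, phi x = dotp x y.
Proof.
move=> C0 lp bp.
have p0 : phi 0 = 0.
  by have := lp (-1) 0 0; rewrite scaler0 addr0 mulN1r addNr.
have pB x y : phi (x - y) = phi x - phi y.
  by rewrite -[x - y]addrC -scaleN1r lp mulN1r addrC.
pose K : set V := [set x | phi x = 0].
have cK : closed K.
  move=> x /closureP cx; apply: norm_small => e e0.
  have c0 : 0 < e / (C + 1) by rewrite divr_gt0// ltr_wpDl.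
  have [y Ky xy] := cx _ c0.
  rewrite -[phi x]subr0 -Ky -pB; apply: le_lt_trans (bp _) _.
  apply: le_lt_trans (_ : _ <= (C + 1) * `|x - y|) _.
    by rewrite ler_wpM2r// lerDl.
  by rewrite mulrC -ltr_pdivlMr// ltr_wpDl.
have lK (a : R[i]) x y : K x -> K y -> K (a *: x + y).
  by rewrite /K /= lp => -> ->; rewrite mulr0 addr0.
pose M := ClosedSubspace cK p0 lK.
have [[x0 x0M]|nM] := pselect (exists x, phi x <> 0); last first.
  exists 0 => x; rewrite dot0r.
  by apply/eqP/negPn/negP => /eqP h; apply: nM; exists x.
have [p Mp xp] := projection M x0.
pose z := x0 - p.
have pz : phi z != 0 by rewrite /z pB (Mp : phi p = 0) subr0; apply/eqP.
have z0 : dotp z z != 0.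
  apply: contra_neq pz => /dot_eq0 ->; exact: p0.
exists ((phi z / dotp z z)^* *: z) => x.
rewrite dotZr conjCK.
have : dotp z (x - (phi x / phi z) *: z) = 0.
  apply: xp; rewrite /= /K /= pB -[_ *: z]addr0 lp p0 addr0 divfK// subrr//.
move/dot_eq0C; rewrite dotBl dotZl => /eqP; rewrite subr_eq0 => /eqP ->.
by field; rewrite z0 pz.
Qed.

Lemma kernel_closed V W (A : V -> W) : bounded_op A -> closed [set x | A x = 0].
Proof.
move=> /bounded_opE[lA [M M0 hM]] x /closureP cx; apply: norm_small => e e0.
have c0 : 0 < e / (M + 1) by rewrite divr_gt0// ltr_wpDl.
have [y Ky xy] := cx _ c0.
rewrite -[A x]subr0 -Ky -(linB lA); apply: le_lt_trans (hM _) _.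
apply: le_lt_trans (_ : _ <= (M + 1) * `|x - y|) _.
  by rewrite ler_wpM2r// lerDl.
by rewrite mulrC -ltr_pdivlMr// ltr_wpDl.
Qed.

Definition kernel_csub V W (A : V -> W) (bA : bounded_op A) : closed_subspace V.
Proof.
apply: (ClosedSubspace (kernel_closed bA)); first exact: (lin0 bA.1).
by move=> a x y /= Ax Ay; rewrite bA.1 Ax Ay scaler0 addr0.
Defined.

Lemma adj_exists V W (A : V -> W) : bounded_op A ->
  exists B, bounded_op B /\ forall x y, dotp (A x) y = dotp x (B y).
Proof.
move=> /bounded_opE[lA [M M0 hM]].
have E y : exists z, forall x, dotp (A x) y = dotp x z.
  apply: (@riesz V (fun x => dotp (A x) y) (M * `|y|)).
    by rewrite mulr_ge0.
    by move=> a u v; rewrite lA dotDl dotZl.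
  move=> x; apply: le_trans (dot_norm_le _ _) _.
  by rewrite [leRHS]mulrAC ler_wpM2r.
have [B hB] := choice E.
have lB : linear B.
  move=> a u v; apply: dot_ext => x; apply/(can_inj conjCK).
  rewrite -!(dotC x) dotDr dotZr -!hB dotDr dotZr //.
exists B; split=> //; split=> //; exists M => y.
have [->|B0] := eqVneq (B y) 0; first by rewrite normr0 mulr_ge0.
have : `|B y| * `|B y| <= M * `|y| * `|B y|.
  rewrite -expr2 -dotpE -hB; apply: le_trans (real_ler_norm _) _.
    by rewrite hB ger0_real ?dot_ge0.
  by apply: le_trans (dot_norm_le _ _) _; rewrite mulrAC ler_wpM2r.
by rewrite ler_pM2r ?normr_gt0.
Qed.

Section AdjTheory.
Variables (V W : hilbertType R) (A : V -> W).
Hypothesis bA : bounded_op A.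

Let adj_spec :
  bounded_op (adj A) /\ forall x y, dotp (A x) y = dotp x (adj A y).
Proof.
have [B hB] := adj_exists bA.
rewrite /adj; case: xgetP => [C _ //|/(_ B)]; exact.
Qed.

Lemma adj_bounded : bounded_op (adj A). Proof. exact: adj_spec.1. Qed.
Lemma adj_lin : linear (adj A). Proof. exact: adj_bounded.1. Qed.
Lemma adjP x y : dotp (A x) y = dotp x (adj A y). Proof. exact: adj_spec.2. Qed.
Lemma adjPr x y : dotp y (A x) = dotp (adj A y) x.
Proof. by rewrite dotC adjP -dotC. Qed.

Lemma adj_unique (B : W -> V) :
  (forall x y, dotp (A x) y = dotp x (B y)) -> forall y, adj A y = B y.
Proof.
move=> h y; apply: dot_ext => x; apply/(can_inj conjCK).
by rewrite -!(dotC x) -adjP h.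
Qed.

Lemma adj_contraction : (forall x, `|A x| <= `|x|) ->
  forall y, `|adj A y| <= `|y|.
Proof.
move=> cA y; have [->|B0] := eqVneq (adj A y) 0; first by rewrite normr0.
rewrite -(@ler_pM2r _ `|adj A y|) ?normr_gt0//.
rewrite -expr2 -dotpE -adjP; apply: le_trans (real_ler_norm _) _.
  by rewrite adjP ger0_real ?dot_ge0.
by apply: le_trans (dot_norm_le _ _) _; rewrite mulrC ler_wpM2l.
Qed.

End AdjTheory.

Lemma adj_comp V W U (A : V -> W) (B : W -> U) :
  bounded_op A -> bounded_op B ->
  forall y, adj (B \o A) y = adj A (adj B y).
Proof.
move=> bA bB; apply: adj_unique; first exact: bounded_comp.
by move=> x y /=; rewrite !adjP.
Qed.

End Adjoint.

(** * Positive square roots and defect operators *)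

Section Continuity.
Variables (R : realType) (V W : hilbertType R).

Lemma bounded_cvg (T : Type) (F : set_system T) {FF : Filter F} (A : V -> W)
    (u : T -> V) (l : V) : bounded_op A -> u @ F --> l -> (A \o u) @ F --> A l.
Proof.
move=> /bounded_opE[lA [M M0 hM]] /cvgrPdist_lt ul; apply/cvgrPdist_lt => e e0.
have c0 : 0 < e / (M + 1) by rewrite divr_gt0// ltr_wpDl.
apply: filterS (ul _ c0) => t /= ut; rewrite -(linB lA).
apply: le_lt_trans (hM _) _.
apply: le_lt_trans (_ : _ <= (M + 1) * `|l - u t|) _.
  by rewrite ler_wpM2r// lerDl.
by rewrite mulrC -ltr_pdivlMr// ltr_wpDl.
Qed.

Lemma dot_cvg (T : Type) (F : set_system T) {FF : Filter F}
    (u : T -> V) (l y : V) :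
  u @ F --> l -> (fun t => dotp (u t) y : R[i]^o) @ F --> (dotp l y : R[i]^o).
Proof.
move=> /cvgrPdist_lt ul; apply/cvgrPdist_lt => e e0.
have c0 : 0 < e / (`|y| + 1) by rewrite divr_gt0// ltr_wpDl.
apply: filterS (ul _ c0) => t /= ut; rewrite -dotBl.
apply: le_lt_trans (dot_norm_le _ _) _.
apply: le_lt_trans (_ : _ <= `|l - u t| * (`|y| + 1)) _.
  by rewrite ler_wpM2l// lerDl.
by rewrite -ltr_pdivlMr// ltr_wpDl.
Qed.

Lemma cvg_uniq (U : normedModType R[i]) (T : Type) (F : set_system T)
    {FF : ProperFilter F} (u : T -> U) (l l' : U) :
  u @ F --> l -> u @ F --> l' -> l = l'.
Proof. by apply: cvg_unique; exact: norm_hausdorff. Qed.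

End Continuity.

Section SquareRootIteration.
Variable R : realType.

(** The scalar instance of the iteration below. It increases to 1 and dominates
    the operator iteration, increment by increment, so that the latter converges
    in norm at every point. *)
Fixpoint sqiter_bound (k : nat) : R :=
  if k is k'.+1 then 2^-1 * (1 + sqiter_bound k' ^+ 2) else 0.

(** The limit C satisfies 2 C = Y + C^2, that is (I - C)^2 = I - Y. *)
Fixpoint sqiter (V : hilbertType R) (Y : V -> V) (k : nat) : V -> V :=
  if k is k'.+1 then fun x => 2^-1 *: (Y x + sqiter Y k' (sqiter Y k' x))
  else fun=> 0.

Local Notation c := sqiter_bound.

Lemma sqiter_bound_ge0 k : 0 <= c k.
Proof.
by case: k => //= k; rewrite mulr_ge0 ?invr_ge0// addr_ge0// sqr_ge0.
Qed.

Lemma sqiter_bound_le1 k : c k <= 1.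
Proof.
elim: k => [|k IH] /=; first exact: ler01.
rewrite mulrC ler_pdivrMr// mul1r -[2]/(1 + 1) lerD2l.
by rewrite expr_le1// sqiter_bound_ge0.
Qed.

Lemma sqiter_bound_homo k : c k <= c k.+1.
Proof.
elim: k => [|k IH]; first exact: sqiter_bound_ge0.
suff: 2^-1 * (1 + c k ^+ 2) <= 2^-1 * (1 + c k.+1 ^+ 2) by [].
rewrite ler_pM2l ?invr_gt0// lerD2l.
by rewrite ler_pXn2r ?nnegrE ?sqiter_bound_ge0.
Qed.

Lemma sqiter_bound_cauchy (e : R) : 0 < e ->
  exists N, forall m, (N <= m)%N -> c m - c N < e.
Proof.
move=> e0; have hs : has_sup (range c).
  by split; [exists (c 0), 0%N|exists 1 => _ [k _ <-]; exact: sqiter_bound_le1].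
have [_ [N _ <-] hN] := sup_adherent e0 hs; exists N => m Nm.
rewrite ltrBlDr; apply: le_lt_trans (_ : c m <= sup (range c)) _.
  by apply: ub_le_sup; [exact: hs.2|exists m].
by rewrite -ltrBlDl.
Qed.

Lemma sqiter_intertwine (V W : hilbertType R) (Y : V -> V) (Z : W -> W)
    (P : V -> W) : linear P -> (forall x, P (Y x) = Z (P x)) ->
  forall k x, P (sqiter Y k x) = sqiter Z k (P x).
Proof.
move=> lP h; elim=> [|k IH] x /=; first exact: (lin0 lP).
by rewrite (linZ lP) (linD lP) h !IH.
Qed.

Variables (V : hilbertType R) (Y : V -> V).
Hypotheses (lY : linear Y) (cY : forall x, `|Y x| <= `|x|).

Local Notation C := (sqiter Y).

Lemma sqiter_lin k : linear (C k).
Proof.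
elim: k => [|k IH] a x y /=; first by rewrite scaler0 addr0.
rewrite lY !IH addrACA -scalerDr.
by rewrite (scalerDr 2^-1) !scalerA mulrC.
Qed.

Lemma sqiter_le k x : `|C k x| <= (c k)%:C%C * `|x|.
Proof.
elim: k x => [|k IH] x /=; first by rewrite normr0 mul0r.
rewrite normrZ ger0_norm ?invr_ge0// rmorphM/= fmorphV/= rmorph_nat -mulrA.
rewrite ler_pM2l ?invr_gt0// rmorphD rmorphXn/= mulrDl mul1r.
apply: le_trans (ler_normD _ _) _; apply: lerD => //.
rewrite expr2 -mulrA; apply: le_trans (IH _) _.
by rewrite ler_wpM2l// ler0c sqiter_bound_ge0.
Qed.

(** a^2 - b^2 = a (a - b) + (a - b) b holds for operators that need not commute
    and bounds the increments by those of the scalar iteration. *)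
Lemma sqiter_step k x : `|C k.+1 x - C k x| <= (c k.+1 - c k)%:C%C * `|x|.
Proof.
elim: k x => [|k IH] x.
  by rewrite [C 0]/= [c 0]/= !subr0; exact: sqiter_le.
have -> : C k.+2 x - C k.+1 x =
  2^-1 *: (C k.+1 (C k.+1 x - C k x) + (C k.+1 (C k x) - C k (C k x))).
  rewrite [C k.+2 x]/= [in X in _ - X]/= -scalerBr; congr (_ *: _).
  rewrite (linB (sqiter_lin _)) addrA subrK opprD addrACA subrr add0r.
  by [].
have -> : c k.+2 - c k.+1 =
    2^-1 * (c k.+1 * (c k.+1 - c k) + (c k.+1 - c k) * c k).
  transitivity (2^-1 * (1 + c k.+1 ^+ 2) - 2^-1 * (1 + c k ^+ 2)) => //.
  ring.
move: (sqiter_le k.+1) (sqiter_le k) IH (sqiter_bound_ge0 k.+1).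
move: (sqiter_bound_homo k).
move: (c k.+1) (c k) (C k.+1) (C k) => d d' D D' dd' hD hD' IH d0.
rewrite normrZ ger0_norm ?invr_ge0// rmorphM fmorphV rmorph_nat -mulrA.
rewrite ler_pM2l ?invr_gt0// rmorphD mulrDl !rmorphM -!mulrA.
apply: le_trans (ler_normD _ _) _; apply: lerD.
  by apply: le_trans (hD _) _; rewrite ler_wpM2l ?ler0c// IH.
by apply: le_trans (IH _) _; rewrite ler_wpM2l ?ler0c ?subr_ge0.
Qed.

Lemma sqiter_dist m k x : (k <= m)%N ->
  `|C m x - C k x| <= (c m - c k)%:C%C * `|x|.
Proof.
move=> /subnK <-; elim: (m - k)%N => [|j IH].
  by rewrite add0n !subrr normr0 mul0r.
rewrite addSn -(subrK (C (j + k) x) (C (j + k).+1 x)) -addrA.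
apply: le_trans (ler_normD _ _) _.
have -> : c (j + k).+1 - c k = (c (j + k).+1 - c (j + k)) + (c (j + k) - c k).
  by rewrite addrA subrK.
rewrite rmorphD mulrDl; apply: lerD => //; exact: sqiter_step.
Qed.

Lemma sqiter_cvg x : exists l : V, (C ^~ x) @ \oo --> l.
Proof.
have [e e0|l Hl] := @complete_filter R V nat \oo _ (C ^~ x).
  pose r := complex.Re (e / (`|x| + 1)).
  have c0 : 0 < e / (`|x| + 1) by rewrite divr_gt0// ltr_wpDl.
  have rE : r%:C%C = e / (`|x| + 1) by rewrite RRe_real// gtr0_real.
  have r0 : 0 < r by rewrite -ltcR rE.
  have [N hN] := sqiter_bound_cauchy r0.
  exists (C N x), N => // m Nm; rewrite /= distrC.
  apply: le_lt_trans (sqiter_dist _ Nm) _.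
  apply: le_lt_trans (_ : _ <= (c m - c N)%:C%C * (`|x| + 1)) _.
    rewrite ler_wpM2l ?lerDl// ler0c subr_ge0.
    rewrite -(subnK Nm); elim: (m - N)%N => [|j IH] //.
    by rewrite addSn; apply: le_trans IH (sqiter_bound_homo _).
  by rewrite -ltr_pdivlMr ?ltr_wpDl// -rE ltcR hN.
by exists l; apply/cvgrPdist_lt => e e0; exact: Hl.
Qed.

Definition sqlim (x : V) : V := projT1 (cid (sqiter_cvg x)).

Lemma sqlim_cvg x : (C ^~ x) @ \oo --> sqlim x.
Proof. by rewrite /sqlim; case: cid. Qed.

Lemma sqlim_lin : linear sqlim.
Proof.
move=> a x y; apply: (cvg_uniq (@sqlim_cvg (a *: x + y))).
have -> : C ^~ (a *: x + y) = (fun k => a *: C k x + C k y).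
  by apply/funext => k; rewrite sqiter_lin.
by apply: cvgD (@sqlim_cvg y); apply: cvgZl_tmp; exact: sqlim_cvg.
Qed.

Lemma sqiter_contr k x : `|C k x| <= `|x|.
Proof.
apply: le_trans (sqiter_le _ _) _.
by rewrite ler_piMl// (_ : 1 = 1%:C%C)// lecR sqiter_bound_le1.
Qed.

Lemma sqlim_contr x : `|sqlim x| <= `|x|.
Proof.
apply: norm_le_eps => // e e0.
have /cvgrPdist_lt/(_ e e0)/filter_ex[k hk] := @sqlim_cvg x.
rewrite -(subrK (C k x) (sqlim x)); apply: le_trans (ler_normD _ _) _.
by rewrite addrC lerD ?sqiter_contr// ltW.
Qed.

Lemma sqlim_fix x : sqlim x + sqlim x = Y x + sqlim (sqlim x).
Proof.
have h : (fun k => C k.+1 x) @ \oo --> sqlim x.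
  apply/cvgrPdist_lt => e e0.
  have /cvgrPdist_lt/(_ _ e0)[N _ hN] := @sqlim_cvg x.
  by exists N => // k Nk; exact: (hN k.+1 (leqW Nk)).
have CC : (fun k => C k (C k x)) @ \oo --> sqlim (sqlim x).
  apply/cvgrPdist_lt => e e0; have e20 : 0 < e / 2 by rewrite divr_gt0.
  have /cvgrPdist_lt/(_ _ e20) h1 := @sqlim_cvg x.
  have /cvgrPdist_lt/(_ _ e20) h2 := @sqlim_cvg (sqlim x).
  apply: filterS2 h1 h2 => k /= h1 h2.
  have -> : sqlim (sqlim x) - C k (C k x) =
      (sqlim (sqlim x) - C k (sqlim x)) + C k (sqlim x - C k x).
    by rewrite (linB (sqiter_lin _)) addrA subrK.
  apply: le_lt_trans (ler_normD _ _) _; rewrite (splitr e) ltrD//.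
  exact: le_lt_trans (sqiter_contr _ _) h1.
have h' := cvgZl_tmp (k := 2^-1) (cvgD (cvg_cst (Y x)) CC).
have E : sqlim x = 2^-1 *: (Y x + sqlim (sqlim x)).
  by apply: (cvg_uniq h); exact: h'.
rewrite {1 2}E.
by rewrite -scalerDl [X in X *: _](_ : _ = 1) ?scale1r// [RHS]splitr mul1r.
Qed.

Lemma sqlim_sym : (forall x y, dotp (Y x) y = dotp x (Y y)) ->
  forall x y, dotp (sqlim x) y = dotp x (sqlim y).
Proof.
move=> sY x y.
have sC k : forall u v, dotp (C k u) v = dotp u (C k v).
  elim: k => [|k IH] u v /=; first by rewrite dot0l dot0r.
  by rewrite dotZl dotZr dotDl dotDr sY !IH fmorphV/= conjC_nat.
have h1 : (fun k => dotp (C k x) y : R[i]^o) @ \oo -->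
    (dotp (sqlim x) y : R[i]^o).
  by apply: dot_cvg; exact: sqlim_cvg.
have h2 : (fun k => dotp (C k y) x : R[i]^o) @ \oo -->
    (dotp (sqlim y) x : R[i]^o).
  by apply: dot_cvg; exact: sqlim_cvg.
have h3 : (fun k => dotp (C k x) y : R[i]^o) @ \oo -->
    (dotp x (sqlim y) : R[i]^o).
  apply/cvgrPdist_lt => e e0; have /cvgrPdist_lt/(_ e e0) := h2.
  apply: filterS => k /=.
  by rewrite (sC k x y) (dotC x) (dotC x (C k y)) -rmorphB/= norm_conjC.
exact: (cvg_uniq (U := R[i]^o) h1 h3).
Qed.

End SquareRootIteration.

Lemma sqlim_intertwine (R : realType) (V W : hilbertType R)
    (Y : V -> V) (lY : linear Y) (cY : forall x, `|Y x| <= `|x|)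
    (Z : W -> W) (lZ : linear Z) (cZ : forall x, `|Z x| <= `|x|)
    (P : V -> W) : bounded_op P -> (forall x, P (Y x) = Z (P x)) ->
  forall x, P (sqlim lY cY x) = sqlim lZ cZ (P x).
Proof.
move=> bP h x.
have h1 : (P \o (sqiter Y)^~ x) @ \oo --> P (sqlim lY cY x).
  by apply: bounded_cvg => //; exact: sqlim_cvg.
have h2 := @sqlim_cvg _ _ _ lZ cZ (P x).
apply: (cvg_uniq h1); rewrite (_ : P \o _ = (sqiter Z)^~ (P x))//.
by apply/funext => k /=; rewrite (sqiter_intertwine bP.1 h).
Qed.

Section SquareRoot.
Variable R : realType.

Lemma positive_sym (V : hilbertType R) (A : V -> V) : linear A ->
  (forall x, 0 <= dotp (A x) x) -> forall x y, dotp (A x) y = dotp x (A y).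
Proof.
move=> lA pA x y; apply/eqP; rewrite -subr_eq0; apply/eqP.
apply: (@sesqui_eq0 R V (fun x y => dotp (A x) y - dotp x (A y)))
  => [u v w|u v w|a u v|a u v|u].
- by rewrite (linD lA) !dotDl; ring.
- by rewrite (linD lA) !dotDr; ring.
- by rewrite (linZ lA) !dotZl mulrBr.
- by rewrite (linZ lA) !dotZr mulrBr.
by rewrite (dotC u) (CrealP _) ?ger0_real// subrr.
Qed.

(** The quadratic polynomial s |-> <B (z - s B z), z - s B z> is nonnegative and
    vanishes at 0, so its derivative there, -2 |B z|^2, is nonnegative. *)
Lemma positive_ker (V : hilbertType R) (B : V -> V) (z : V) : linear B ->
  (forall x, 0 <= dotp (B x) x) -> dotp (B z) z = 0 -> B z = 0.
Proof.
move=> lB pB Bz; have sB := positive_sym lB pB.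
apply/dot_eq0/eqP; apply: contraT => a0.
pose a := dotp (B z) (B z); pose q := dotp (B (B z)) (B z).
have a_gt0 : 0 < a by rewrite lt_def a0 dot_ge0.
have q1 : 0 < q + 1 by rewrite ltr_wpDl ?pB.
(* a value of s small enough for the polynomial to be negative if a > 0 *)
pose s := a / (q + 1); have s0 : 0 < s by rewrite divr_gt0.
have sR : s^* = s by apply/CrealP; rewrite ger0_real ?ltW.
have : 0 <= s * (s * q - 2 * a).
  have := pB (z - s *: B z).
  rewrite (linB lB) (linZ lB) dotBl !dotBr !dotZl !dotZr Bz (sB (B z) z) sR.
  rewrite -/a -/q => h; apply: le_trans h _.
  by rewrite le_eqVlt -subr_eq0; apply/orP; left; apply/eqP; ring.
rewrite pmulr_rge0// subr_ge0 => h.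
have : 2 * a < a.
  apply: le_lt_trans h _; rewrite /s -mulrA gtr_pMr// mulrC.
  by rewrite ltr_pdivrMr// mul1r ltrDl.
by rewrite gtr_pMl// (ltr_nat _ 2 1).
Qed.

(** For z = (B - C) x one has <Bz,z> + <Cz,z> = <(B^2 - C^2) x, z> = 0. So B and
    C kill z, and |z|^2 = <x, (B - C) z> = 0. *)
Lemma positive_sqrt_unique (V : hilbertType R) (B C : V -> V) :
  linear B -> linear C ->
  (forall x, 0 <= dotp (B x) x) -> (forall x, 0 <= dotp (C x) x) ->
  (forall x, B (B x) = C (C x)) -> (forall x, B (C x) = C (B x)) ->
  forall x, B x = C x.
Proof.
move=> lB lC pB pC BC com x.
have sB := positive_sym lB pB; have sC := positive_sym lC pC.
set z := B x - C x.
have sum0 : dotp (B z) z + dotp (C z) z = 0.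
  rewrite -dotDl {1 3}/z (linB lB) (linB lC) BC com.
  by rewrite addrC addrA subrK subrr dot0l.
have Bz : B z = 0.
  apply: positive_ker => //; apply/eqP; rewrite eq_le pB andbT.
  by rewrite -sum0 lerDl.
have Cz : C z = 0.
  apply: positive_ker => //; apply/eqP; rewrite eq_le pC andbT.
  by rewrite -sum0 lerDr.
apply/eqP; rewrite -subr_eq0; apply/eqP/dot_eq0; rewrite -/z.
by rewrite {1}/z dotBl sB sC Bz Cz subrr.
Qed.

Definition unit_positive (V : hilbertType R) (A : V -> V) :=
  linear A /\ forall x, 0 <= dotp (A x) x <= dotp x x.

Section PSqrt.
Variables (V : hilbertType R) (A : V -> V).
Hypothesis uA : unit_positive A.

Local Notation Y := (fun x => x - A x).

Lemma unit_positive_compl_lin : linear Y.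
Proof. by move=> a x y; rewrite uA.1 scalerBr opprD addrACA. Qed.

(** With Y = I - A one has Y - Y^2 = Y A Y + A Y A, a positive operator. *)
Lemma unit_positive_compl_contr x : `|x - A x| <= `|x|.
Proof.
have [lA hA] := uA; have pA z : 0 <= dotp (A z) z by have /andP[] := hA z.
have sA := positive_sym lA pA.
have pY z : 0 <= dotp (z - A z) z.
  by rewrite dotBl subr_ge0; have /andP[] := hA z.
suff : dotp (x - A x) (x - A x) <= dotp x x.
  by rewrite !dotpE ler_pXn2r// ?nnegrE.
have /andP[_] := hA x; rewrite -subr_ge0.
rewrite -dotBl => h1.
have h2 : 0 <= dotp (x - A x) x - dotp (x - A x) (x - A x).
  have := addr_ge0 (pA (x - A x)) (pY (A x)).
  rewrite (linB lA) !dotBl !dotBr !(sA _ x) !(sA (A x)) => h.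
  apply: le_trans h _; rewrite le_eqVlt -subr_eq0; apply/orP; left.
  apply/eqP; rewrite !sA; ring.
have h3 : 0 <= dotp x x - dotp (x - A x) x.
  by rewrite dotBl opprB addrC subrK; exact: pA.
by rewrite -subr_ge0; have := addr_ge0 h3 h2; rewrite addrA subrK.
Qed.

Definition sqroot (x : V) : V :=
  x - sqlim unit_positive_compl_lin unit_positive_compl_contr x.

Local Notation L := (sqlim unit_positive_compl_lin unit_positive_compl_contr).

Lemma sqroot_lin : linear sqroot.
Proof. by move=> a x y; rewrite /sqroot sqlim_lin scalerBr opprD addrACA. Qed.

Lemma sqroot_bounded : bounded_op sqroot.
Proof.
split; first exact: sqroot_lin.
exists 2 => x; apply: le_trans (ler_normB _ _) _.
by rewrite mulrDl !mul1r lerD2l sqlim_contr.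
Qed.

Lemma sqroot_sq x : sqroot (sqroot x) = A x.
Proof.
rewrite /sqroot (linB (sqlim_lin _ _)) opprB.
have h := sqlim_fix unit_positive_compl_lin unit_positive_compl_contr x.
have -> : L (L x) = L x + L x - (x - A x) by rewrite h addrC addKr.
by apply: dot_ext => z; rewrite !(dotBl, dotDl); ring.
Qed.

Lemma sqroot_ge0 x : 0 <= dotp (sqroot x) x.
Proof.
have [lA hA] := uA; have pA z : 0 <= dotp (A z) z by have /andP[] := hA z.
have sA := positive_sym lA pA.
have sY u v : dotp (u - A u) v = dotp u (v - A v) by rewrite dotBl dotBr sA.
have sL := sqlim_sym unit_positive_compl_lin unit_positive_compl_contr sY.
have Lreal : dotp (L x) x \is Num.real.
  by apply/CrealP; rewrite -dotC -sL.
rewrite /sqroot dotBl subr_ge0; apply: le_trans (real_ler_norm Lreal) _.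
apply: le_trans (dot_norm_le _ _) _; rewrite dotpE expr2 ler_wpM2r//.
exact: sqlim_contr.
Qed.

Lemma psqrt_spec : positive_op (psqrt A) /\ forall x, psqrt A (psqrt A x) = A x.
Proof.
rewrite /psqrt; case: xgetP => [B _ //|/(_ sqroot) []].
by split; [split; [exact: sqroot_bounded|exact: sqroot_ge0]|exact: sqroot_sq].
Qed.

(** An arbitrary positive square root of A commutes with A, hence with the limit
    of an iteration built from A; so uniqueness applies. *)
Lemma psqrtE x : psqrt A x = sqroot x.
Proof.
have [[bB pB] sB] := psqrt_spec.
apply: positive_sqrt_unique => {x}.
- exact: bB.1.
- exact: sqroot_lin.
- exact: pB.
- exact: sqroot_ge0.
- by move=> x; rewrite sB sqroot_sq.
move=> x; rewrite /sqroot (linB bB.1); congr (_ - _).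
apply: sqlim_intertwine => // y.
by rewrite (linB bB.1) -!sB.
Qed.

Lemma psqrt_bounded : bounded_op (psqrt A). Proof. exact: psqrt_spec.1.1. Qed.
Lemma psqrt_lin : linear (psqrt A). Proof. exact: psqrt_bounded.1. Qed.
Lemma psqrt_sq x : psqrt A (psqrt A x) = A x. Proof. exact: psqrt_spec.2. Qed.
Lemma psqrt_sym x y : dotp (psqrt A x) y = dotp x (psqrt A y).
Proof. exact: positive_sym psqrt_lin psqrt_spec.1.2 x y. Qed.
Lemma psqrt_dot x y : dotp (psqrt A x) (psqrt A y) = dotp (A x) y.
Proof. by rewrite -psqrt_sym psqrt_sq. Qed.

End PSqrt.

(** Not evident for roots given by description; it holds for each step of the
    iteration that produces them. *)
Lemma psqrt_intertwine (V W : hilbertType R) (A : V -> V) (B : W -> W)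
    (P : V -> W) : unit_positive A -> unit_positive B -> bounded_op P ->
  (forall x, P (A x) = B (P x)) -> forall x, P (psqrt A x) = psqrt B (P x).
Proof.
move=> uA uB bP h x; rewrite (psqrtE uA) (psqrtE uB) /sqroot (linB bP.1).
congr (_ - _); apply: sqlim_intertwine => // y.
by rewrite (linB bP.1) h.
Qed.

Section Defect.
Variables (V W : hilbertType R) (A : V -> W).
Hypothesis cA : contraction A.

Lemma defect_unit_positive : unit_positive (fun x => x - adj A (A x)).
Proof.
have [lA hA] := (contractionP A).1 cA; have bA := cA.1.
split=> [a x y|x].
  by rewrite lA (adj_lin bA) scalerBr opprD addrACA.
rewrite dotBl -(adjPr bA) subr_ge0 hA/=.
by rewrite gerBl dot_ge0.
Qed.

Lemma defect_dot x y :
  dotp (defect A x) (defect A y) = dotp x y - dotp (A x) (A y).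
Proof.
by rewrite /defect (psqrt_dot defect_unit_positive) dotBl -(adjPr cA.1).
Qed.

Lemma defect_lin : linear (defect A).
Proof. exact: psqrt_lin defect_unit_positive. Qed.

Lemma defect_bounded : bounded_op (defect A).
Proof. exact: psqrt_bounded defect_unit_positive. Qed.

End Defect.

End SquareRoot.

(** * Regular factorizations *)

Section Pair.
Variables (R : realType) (H K : hilbertType R).

Definition pair_fun (x : H) (y : K) : forall b : bool, (if b then H else K) :=
  fun b => match b return (if b then H else K : hilbertType R) with
           | true => x | false => y end.

Lemma bool_partial_sum (V : zmodType) (u : bool -> V) (A : {fset bool}) :
  ([fset true; false] `<=` A)%fset -> partial_sum u A = u true + u false.
Proof.
move=> h; have -> : A = [fset true; false]%fset.
  apply/eqP; rewrite eqEfsubset h andbT.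
  by apply/fsubsetP => -[] _; rewrite !inE.
by rewrite partial_sumE big_fsetU1 ?inE//= big_seq_fset1.
Qed.

Lemma bool_sq_summable (K' : bool -> hilbertType R) (f : forall b, K' b) :
  sq_summable f.
Proof.
exists (`|f true| ^+ 2 + `|f false| ^+ 2) => A.
rewrite -(@bool_partial_sum _ (fun b => `|f b| ^+ 2)
  (A `|` [fset true; false])%fset).
  by apply: le_partial_sum => [b|]; rewrite ?exprn_ge0// fsubsetUl.
exact: fsubsetUr.
Qed.

Definition hpair (x : H) (y : K) : hsum2 H K :=
  HSum (@bool_sq_summable _ (pair_fun x y)).

Lemma hpair_fst x y : hfst (hpair x y) = x. Proof. by []. Qed.
Lemma hpair_snd x y : hsnd (hpair x y) = y. Proof. by []. Qed.

Lemma hsum2P (f g : hsum2 H K) : hfst f = hfst g -> hsnd f = hsnd g -> f = g.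
Proof. by move=> h1 h2; apply: hsumP => -[]. Qed.

Lemma hsum2_dot (f g : hsum2 H K) :
  dotp f g = dotp (hfst f) (hfst g) + dotp (hsnd f) (hsnd g).
Proof.
rewrite hsum_dotpE; apply: (cvg_lim (@norm_hausdorff _ R[i]^o)).
apply: cvg_near_cst; exists [fset true; false]%fset => // A /= hA.
by rewrite bool_partial_sum.
Qed.

Lemma hpair_linear a x x' y y' :
  hpair (a *: x + x') (a *: y + y') = a *: hpair x y + hpair x' y'.
Proof. by apply: hsum2P. Qed.

End Pair.

Section IsometricExtension.
Variable R : realType.

(** Two maps with equal norms have isometric ranges: the B-images of vectors
    whose A-images converge to x are Cauchy. The distances to the range
    determine z. *)
Lemma closure_transport (V H K : hilbertType R) (A : V -> H) (B : V -> K) x :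
  linear A -> linear B ->
  (forall f, dotp (A f) (A f) = dotp (B f) (B f)) -> closure (range A) x ->
  exists2 z, closure (range B) z & forall f, `|z - B f| = `|x - A f|.
Proof.
move=> lA lB AB cx.
have {}AB f : `|A f| = `|B f| by apply: norm_eqP.
pose F : set_system V := filter_from (nbhs x) (fun U => A @^-1` U).
have FF : ProperFilter F.
  apply: filter_from_proper; last first.
    by move=> U /cx[_ [[f _ <-] Uf]]; exists f.
  apply: filter_from_filter; first by exists setT; exact: filterT.
  by move=> U U' nU nU'; exists (U `&` U'); [exact: filterI|].
have Fx e : 0 < e -> F [set f | `|x - A f| < e].
  move=> e0; exists (ball x e); first exact: nbhsx_ballx.
  by move=> f; rewrite /= -ball_normE.
have [e e0|z Hz] := @complete_filter R K V F FF B.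
  have e20 : 0 < e / 2 by rewrite divr_gt0.
  have [f0 /= hf0] := filter_ex (Fx _ e20); exists (B f0).
  apply: filterS (Fx _ e20) => f /= hf.
  rewrite -(linB lB) -AB (linB lA) (splitr e).
  have -> : A f0 - A f = (x - A f) - (x - A f0).
    by rewrite opprB [RHS]addrC subrKA.
  by apply: le_lt_trans (ler_normB _ _) _; rewrite ltrD.
have near e : 0 < e -> exists g, `|z - B g| < e /\ `|x - A g| < e.
  move=> e0; have [g [/= h1 h2]] := filter_ex (filterI (Hz _ e0) (Fx _ e0)).
  by exists g.
exists z.
  by apply/closureP => e /near[g [h _]]; exists (B g) => //; exists g.
move=> f; apply/eqP; rewrite eq_le; apply/andP; split.
  apply: norm_le_eps => // e e0; have e20 : 0 < e / 2 by rewrite divr_gt0.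
  have [g [h1 h2]] := near _ e20.
  have -> : z - B f = (z - B g) + (B g - B f) by rewrite addrA subrK.
  apply: le_trans (ler_normD _ _) _.
  rewrite -(linB lB) -AB (linB lA) (splitr e) addrA addrC lerD ?(ltW h1)//.
  have -> : A g - A f = (x - A f) - (x - A g).
    by rewrite opprB [RHS]addrC subrKA.
  by apply: le_trans (ler_normB _ _) _; rewrite lerD2l ltW.
apply: norm_le_eps => // e e0; have e20 : 0 < e / 2 by rewrite divr_gt0.
have [g [h1 h2]] := near _ e20.
have -> : x - A f = (x - A g) + (A g - A f) by rewrite addrA subrK.
apply: le_trans (ler_normD _ _) _.
rewrite -(linB lA) AB (linB lB) (splitr e) addrA addrC lerD ?(ltW h2)//.
have -> : B g - B f = (z - B f) - (z - B g) by rewrite opprB [RHS]addrC subrKA.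
by apply: le_trans (ler_normB _ _) _; rewrite lerD2l ltW.
Qed.

Lemma csub_dot (H : hilbertType R) (M : closed_subspace H) (x y : csub M) :
  dotp x y = dotp (val x) (val y).
Proof. by []. Qed.

Lemma csub_val (H : hilbertType R) (M : closed_subspace H) (x : csub M) :
  csub_set M (val x).
Proof. exact: (set_mem (valP x)). Qed.

Lemma csub_norm (H : hilbertType R) (M : closed_subspace H) (x : csub M) :
  `|x| = `|val x|.
Proof. exact: norm_eqP. Qed.

Lemma isometric_extension (V H K : hilbertType R) (A : {linear V -> H})
    (B : V -> K) : linear B ->
  (forall f, dotp (A f) (A f) = dotp (B f) (B f)) ->
  exists U : csub (ran_closure A) -> K, [/\ linear U,
    forall x y, dotp (U x) (U y) = dotp x y,
    forall x f, val x = A f -> U x = B f &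
    forall z, closure (range B) z -> exists x, U x = z].
Proof.
move=> lB AB; have lA : linear A by move=> a x y; exact: linearP.
have E (x : csub (ran_closure A)) :
    exists z, forall f, `|z - B f| = `|val x - A f|.
  have cx : closure (range A) (val x) by exact: (csub_val x).
  by have [z _ hz] := closure_transport lA lB AB cx; exists z.
have [U hU] := choice E.
have near (x : csub (ran_closure A)) e : 0 < e -> exists f, `|val x - A f| < e.
  move=> e0; have /closureP/(_ e e0)[_ [f _ <-] hf] : closure (range A) (val x).
    exact: (csub_val x).
  by exists f.
have lU : linear U.
  move=> a x y; apply/eqP; rewrite -subr_eq0; apply/eqP.
  apply: norm_small => e e0.
  pose d := e / 2 / (`|a| + 1).
  have a1 : 0 < `|a| + 1 by rewrite ltr_wpDl.
  have d0 : 0 < d by rewrite !divr_gt0.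
  have [f hf] := near x _ d0; have [g hg] := near y _ d0.
  have bnd (W : hilbertType R) (p q : W) :
      `|p| < d -> `|q| < d -> `|a *: p + q| < e / 2.
    move=> hp hq; apply: le_lt_trans (ler_normD _ _) _.
    have -> : e / 2 = `|a| * d + d.
      by rewrite -[X in _ + X]mul1r -mulrDl /d [RHS]mulrC divfK// gt_eqF.
    by apply: ler_ltD => //; rewrite normrZ ler_wpM2l// ltW.
  have -> : U (a *: x + y) - (a *: U x + U y) =
     (U (a *: x + y) - B (a *: f + g)) - (a *: (U x - B f) + (U y - B g)).
    by rewrite scalerBr addrACA -opprD -lB opprB addrA subrK.
  rewrite (splitr e); apply: le_lt_trans (ler_normB _ _) _; apply: ltrD.
    have -> : `|U (a *: x + y) - B (a *: f + g)| =
        `|a *: (val x - A f) + (val y - A g)|.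
      rewrite hU lA (_ : val (a *: x + y) = a *: val x + val y)//.
      by rewrite scalerBr addrACA -opprD.
    exact: bnd.
  by apply: bnd; rewrite hU.
have iU x : dotp (U x) (U x) = dotp x x.
  have := hU x 0; rewrite (lin0 lB) (lin0 lA) !subr0 => h.
  by rewrite !dotpE h csub_norm.
exists U; split=> //; first exact: isometry_dot.
  move=> x f xf; apply/eqP; rewrite -subr_eq0 -normr_eq0 hU xf subrr normr0//.
move=> z cz; have BA f : dotp (B f) (B f) = dotp (A f) (A f) by rewrite AB.
have [x cx hx] := closure_transport lB lA BA cz.
pose x' : csub (ran_closure A) := exist _ x (mem_set cx).
exists x'; apply/eqP; rewrite -subr_eq0; apply/eqP.
apply: norm_small => e e0; have e20 : 0 < e / 2 by rewrite divr_gt0.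
have /closureP/(_ _ e20)[_ [f _ <-] hf] := cz.
have -> : U x' - z = (U x' - B f) - (z - B f).
  by rewrite opprB addrA subrK.
rewrite (splitr e); apply: le_lt_trans (ler_normB _ _) _.
by rewrite ltrD// hU/= hx.
Qed.

End IsometricExtension.

(** |Delta_A x|^2, written without the square root. *)
Definition defect_form (R : realType) (V W : hilbertType R) (A : V -> W)
    (x : V) : R[i] :=
  dotp x x - dotp (A x) (A x).

Section Regularity.
Variables (R : realType) (E F G : hilbertType R).
Variables (A1 : E -> F) (A2 : F -> G).
Hypotheses (c1 : contraction A1) (c2 : contraction A2).

Let A := A2 \o A1.

Local Notation D1 := (csub (ran_closure (defect A1))).
Local Notation D2 := (csub (ran_closure (defect A2))).

Definition ran_elem (V W : hilbertType R) (B : {linear V -> W}) (f : V) :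
  csub (ran_closure B) :=
  exist _ (B f)
    (mem_set (subset_closure (ex_intro2 _ _ f I erefl : range B (B f)))).

(** The vector (Delta_2 A1 f, Delta_1 f) of the definition of regularity. *)
Definition regular_map (f : E) : hsum2 D2 D1 :=
  hpair (ran_elem (defect A2) (A1 f)) (ran_elem (defect A1) f).

Lemma contraction_comp : contraction A.
Proof.
have [l1 h1] := (contractionP A1).1 c1; have [l2 h2] := (contractionP A2).1 c2.
apply/contractionP; split; first by move=> a x y; rewrite /A /= l1 l2.
by move=> x; apply: le_trans (h2 _) (h1 _).
Qed.

Lemma regular_map_linear : linear regular_map.
Proof.
move=> a x y; have l1 := ((contractionP A1).1 c1).1.
by rewrite -hpair_linear; congr hpair; apply: val_inj; rewrite /= ?l1 !linearP.
Qed.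

Lemma regular_map_isometric f :
  dotp (defect A f) (defect A f) = dotp (regular_map f) (regular_map f).
Proof.
rewrite hsum2_dot !csub_dot/= !defect_dot//; last exact: contraction_comp.
by rewrite /A /=; ring.
Qed.

Lemma regular_map_dist (y2 : F) (y1 : E) (f : E) :
  let y := hpair (ran_elem (defect A2) y2) (ran_elem (defect A1) y1) in
  dotp (y - regular_map f) (y - regular_map f) =
  defect_form A2 (y2 - A1 f) + defect_form A1 (y1 - f).
Proof.
move=> y; rewrite hsum2_dot !csub_dot.
have -> : val (hfst (y - regular_map f)) = defect A2 (y2 - A1 f).
  by rewrite (linB (defect_lin c2)).
have -> : val (hsnd (y - regular_map f)) = defect A1 (y1 - f).
  by rewrite (linB (defect_lin c1)).
by rewrite !defect_dot.
Qed.

(** Surjectivity of X is used only at the vectors (Delta_2 u, 0). The distances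
    in the conclusion describe the preimage of such a vector without mentioning
    X. *)
Lemma regular_surjective :
  (exists X : csub (ran_closure (defect A)) -> hsum2 D2 D1,
     unitary_op X /\ forall x f, val x = defect A f ->
       val (hfst (X x)) = defect A2 (A1 f) /\ val (hsnd (X x)) = defect A1 f) ->
  forall u, exists2 x, closure (range (defect A)) x &
    forall f, dotp (x - defect A f) (x - defect A f) =
      defect_form A2 (u - A1 f) + defect_form A1 f.
Proof.
move=> [X [[lX iX sX] hX]] u.
have [x Xx] := sX (hpair (ran_elem (defect A2) u) (ran_elem (defect A1) 0)).
exists (val x); first exact: (csub_val x).
move=> f.
have -> : defect_form A1 f = defect_form A1 (0 - f).
  rewrite /defect_form sub0r (linN ((contractionP A1).1 c1).1).
  by rewrite !dotNl !dotNr !opprK.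
rewrite -regular_map_dist -Xx.
have -> : regular_map f = X (ran_elem (defect A) f).
  have [h1 h2] := hX (ran_elem (defect A) f) f erefl.
  by apply: hsum2P; apply: val_inj.
by rewrite -(linB lX) iX.
Qed.

(** X extends f |-> (Delta_2 A1 f, Delta_1 f) isometrically, so it is onto as
    soon as these vectors are dense; it suffices to approximate (Delta_2 u,
    Delta_1 g). *)
Lemma regular_dense :
  (forall u g (e : R[i]), 0 < e ->
     exists f, defect_form A2 (u - A1 f) + defect_form A1 (g - f) < e) ->
  exists X : csub (ran_closure (defect A)) -> hsum2 D2 D1,
     unitary_op X /\ forall x f, val x = defect A f ->
       val (hfst (X x)) = defect A2 (A1 f) /\ val (hsnd (X x)) = defect A1 f.
Proof.
move=> dense.
have [X [lX iX eX sX]] :=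
  isometric_extension regular_map_linear regular_map_isometric.
exists X; split; last by move=> x f /eX ->.
split=> // y; apply: sX; apply/closureP => e e0.
have e20 : 0 < e / 2 by rewrite divr_gt0.
have q0 : 0 < (e / 2) ^+ 2 / 2 by rewrite divr_gt0// exprn_gt0.
have /closure_sqP/(_ _ q0)[_ [u _ <-] hu] := csub_val (hfst y).
have /closure_sqP/(_ _ q0)[_ [g _ <-] hg] := csub_val (hsnd y).
have [f hf] := dense u g _ (exprn_gt0 2 e20).
exists (regular_map f); first by exists f.
pose z := hpair (ran_elem (defect A2) u) (ran_elem (defect A1) g).
rewrite -(subrKA z) (splitr e); apply: le_lt_trans (ler_normD _ _) _.
apply: ltrD; rewrite normr_lt_sqr//; last by rewrite regular_map_dist.
by rewrite hsum2_dot !csub_dot (splitr ((e / 2) ^+ 2)); apply: ltrD.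
Qed.

End Regularity.

(** * Hilbert sums and families of isometries with orthogonal ranges *)

Section HilbertSums.
Variables (R : realType) (I : choiceType) (K : hilbertType R).
Local Notation hs := (hsum (fun _ : I => K)).
Implicit Types (f g : hs).

Lemma single_sq (i : I) (x : K) :
  sq_summable (fun j : I => if j == i then x else 0).
Proof.
exists (`|x| ^+ 2) => A; rewrite partial_sumE.
have [iA|iA] := boolP (i \in A).
  rewrite (big_fsetD1 i)//= eqxx big_seq_cond big1 ?addr0// => v.
  by rewrite !inE andbT => /andP[/negbTE -> _]; rewrite normr0 expr0n.
rewrite big_seq_cond big1 ?exprn_ge0// => v; rewrite andbT => vA.
case: eqVneq => [vi|_]; first by rewrite -vi vA in iA.
by rewrite normr0 expr0n.
Qed.

Definition single (i : I) (x : K) : hs := HSum (single_sq i x).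

Lemma single_lin i : linear (single i).
Proof.
by move=> a x y; apply: hsumP => j /=; case: eqP; rewrite ?scaler0 ?addr0.
Qed.

Lemma dot_single f i x : dotp f (single i x) = dotp (f i) x.
Proof.
rewrite hsum_dotpE; apply: (cvg_lim (@norm_hausdorff _ R[i]^o)).
apply: cvg_near_cst; exists [fset i]%fset => // A /=.
rewrite fsub1set partial_sumE => iA.
rewrite (big_fsetD1 i)//= eqxx big_seq_cond big1 ?addr0// => v.
by rewrite !inE andbT => /andP[/negbTE -> _]; rewrite linear0r.
Qed.

Lemma single_dot i j x y :
  dotp (single i x) (single j y) = if i == j then dotp x y else 0.
Proof. by rewrite dot_single/= eq_sym; case: eqP => // _; rewrite dot0l. Qed.

Lemma hsum_dot_ext f g :
  (forall i x, dotp f (single i x) = dotp g (single i x)) -> f = g.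
Proof.
by move=> h; apply: hsumP => i; apply: dot_ext => x; rewrite -!dot_single.
Qed.

Lemma hsum_dot0 f g : (forall i, dotp (f i) (g i) = 0) -> dotp f g = 0.
Proof.
move=> h; rewrite hsum_dotpE; apply: (cvg_lim (@norm_hausdorff _ R[i]^o)).
apply: cvg_near_cst; exists fset0 => // A _ /=.
by rewrite partial_sumE big1.
Qed.

Lemma hsum_norm_cvg f :
  partial_sum (fun i => dotp (f i) (f i) : R[i]^o) @ totally -->
    (dotp f f : R[i]^o) /\
  forall A, partial_sum (fun i => dotp (f i) (f i)) A <= dotp f f.
Proof.
have [//|s [h1 h2 h3]] := @nneg_partial_sum_cvg R I
    (fun i => dotp (f i) (f i)) (fun i => dot_ge0 (f i)).
  have [M hM] := hsum_sq_summable f; exists M => A.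
  by apply: le_trans (hM A); under eq_fun do rewrite dotpE.
suff -> : dotp f f = s by [].
by rewrite hsum_dotpE; apply: (cvg_lim (@norm_hausdorff _ R[i]^o)).
Qed.

Lemma hsum_norm_le f (b : R[i]) : 0 <= b ->
  (forall A, partial_sum (fun i => dotp (f i) (f i)) A <= b) -> dotp f f <= b.
Proof.
move=> b0 hb; have [/cvgrPdist_lt cv le] := hsum_norm_cvg f.
apply: norm_le_eps; rewrite ?dot_ge0// => e e0.
have /filter_ex[A hA] := cv _ e0; move: hA (le A) (hb A).
move: (partial_sum _ A) (dotp f f) => s d /= hA sd sb.
rewrite -(subrK s d) addrC lerD//; apply: le_trans (ltW hA).
by apply: real_ler_norm; rewrite ger0_real// subr_ge0.
Qed.

Lemma partial_sum_single f (A : {fset I}) i :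
  (partial_sum (fun j => single j (f j)) A : hs) i = if i \in A then f i else 0.
Proof.
apply: dot_ext => x; rewrite -dot_single partial_sumE dot_suml.
case: ifPn => iA.
  rewrite (big_fsetD1 i iA) single_dot eqxx.
  rewrite big_seq_cond big1 ?Monoid.mulm1// => j.
  by rewrite !inE andbT => /andP[/negbTE ji _]; rewrite single_dot ji.
rewrite dot0l big_seq_cond big1// => j; rewrite andbT => jA.
by rewrite single_dot; case: eqP => // ji; rewrite -ji jA in iA.
Qed.

Lemma single_cvg f : partial_sum (fun i => single i (f i)) @ totally --> f.
Proof.
apply/cvgrPdist_lt => e e0.
have [/cvgrPdist_lt/(_ _ (exprn_gt0 2 e0)) h le] := hsum_norm_cvg f.
apply: filterS h => A.
set p : hs := partial_sum _ A; set q := partial_sum _ A => h.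
rewrite (_ : (`|f - p| < e) = (dotp (f - p) (f - p) < e ^+ 2)); last first.
  exact: normr_lt_sqr.
have fp : dotp f p = q.
  rewrite /p /q !partial_sumE dot_sumr; apply: eq_bigr => i _.
  by rewrite dot_single.
have pp : dotp p p = dotp f p.
  rewrite {2 3}/p partial_sumE !dot_sumr; apply: eq_big_seq => i iA.
  by rewrite !dot_single partial_sum_single iA.
have qR : q^* = q by rewrite -fp -pp -dotC.
have qf : q <= dotp f f := le A.
apply: le_lt_trans h; rewrite dotB2 pp (dotC p) fp qR.
by rewrite ger0_norm ?subr_ge0// opprD addrA addrK.
Qed.

Lemma bounded_single_sum (V : hilbertType R) (A : hs -> V) f : bounded_op A ->
  partial_sum (fun i => A (single i (f i))) @ totally --> A f.
Proof.
move=> bA.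
have -> : partial_sum (fun i => A (single i (f i))) =
    A \o partial_sum (fun i => single i (f i)).
  by apply/funext => S /=; rewrite /partial_sum (lin_sum bA.1).
by apply: bounded_cvg => //; exact: single_cvg.
Qed.

Lemma bounded_single_ext (V : hilbertType R) (A B : hs -> V) :
  bounded_op A -> bounded_op B ->
  (forall i x, A (single i x) = B (single i x)) ->
  forall f, A f = B f.
Proof.
move=> bA bB AB f; have h1 := bounded_single_sum (f := f) bA.
apply: (cvg_uniq h1).
under [X in partial_sum X]eq_fun do rewrite AB.
exact: bounded_single_sum.
Qed.

End HilbertSums.

Section OrthogonalFamily.
Variables (R : realType) (I : choiceType) (L K : hilbertType R).
Variable J : I -> L -> K.
Hypothesis bJ : forall i, bounded_op (J i).
Hypothesis oJ : forall i j x y,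
  dotp (J i x) (J j y) = if i == j then dotp x y else 0.

(** The sum p of the components J_i J_i^* k with i in A satisfies <k, p> =
    |p|^2, and |k - p|^2 is nonnegative. *)
Lemma bessel k (A : {fset I}) :
  partial_sum (fun i => dotp (adj (J i) k) (adj (J i) k)) A <= dotp k k.
Proof.
set s := partial_sum _ A.
pose p := \sum_(i <- A) J i (adj (J i) k).
have kp : dotp k p = s.
  rewrite /p /s partial_sumE dot_sumr; apply: eq_bigr => i _.
  by rewrite adjPr.
have pp : dotp p p = s.
  rewrite {2}/p /s partial_sumE dot_sumr; apply: eq_big_seq => i iA.
  rewrite /p dot_suml (big_fsetD1 i iA) oJ eqxx.
  rewrite big_seq_cond big1 ?Monoid.mulm1// => j.
  by rewrite !inE andbT => /andP[/negbTE ji _]; rewrite oJ ji.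
have sR : s^* = s by rewrite -pp -dotC.
have := dot_ge0 (k - p); rewrite dotB2 pp (dotC p) kp sR.
by rewrite opprD addrA addrK subr_ge0.
Qed.

Lemma coef_sq k : sq_summable (fun i => adj (J i) k).
Proof.
by exists (dotp k k) => A; under eq_fun do rewrite -dotpE; exact: bessel.
Qed.

(** The coefficients of a vector along a family of isometries with pairwise
    orthogonal ranges: a coisometry, whose adjoint is the sum of the family. *)
Definition coef (k : K) : hsum (fun _ : I => L) := HSum (coef_sq k).

Lemma coef_lin : linear coef.
Proof. by move=> a x y; apply: hsumP => i /=; rewrite (adj_lin (bJ i)). Qed.

Lemma coef_contraction : contraction coef.
Proof.
apply/contractionP; split; first exact: coef_lin.
by move=> k; apply: hsum_norm_le; [exact: dot_ge0|exact: bessel].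
Qed.

Lemma coef_bounded : bounded_op coef. Proof. exact: coef_contraction.1. Qed.

Lemma adj_coef_single i x : adj coef (single i x) = J i x.
Proof.
apply: dot_ext => k; rewrite [LHS]dotC -(adjP coef_bounded) dot_single.
by rewrite -(adjPr (bJ i)) -dotC.
Qed.

Lemma coef_adjK u : coef (adj coef u) = u.
Proof.
apply: (@bounded_single_ext R I L _ (coef \o adj coef) id) => [||i x].
- by apply: bounded_comp; [apply: adj_bounded|]; exact: coef_bounded.
- by split=> //; exists 1 => f; rewrite mul1r.
rewrite /= adj_coef_single; apply: hsum_dot_ext => j y.
by rewrite [LHS]dot_single -(adjPr (bJ j)) oJ single_dot.
Qed.

Lemma adj_coef_dot u v : dotp (adj coef u) (adj coef v) = dotp u v.
Proof. by rewrite -(adjP coef_bounded) coef_adjK. Qed.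

End OrthogonalFamily.

(** * Fock spaces and multi-analytic operators *)

Section FockSpace.
Variables (R : realType) (n : option nat).
Implicit Types (K L : hilbertType R).

Lemma etensE K (w : word n) (x : K) : etens w x = single w x :> fock n K.
Proof. exact: hsumP. Qed.

Lemma etens_lin K (w : word n) : linear (@etens R n K w).
Proof. by move=> a x y; rewrite !etensE single_lin. Qed.

Lemma etens_dot K (v w : word n) (x y : K) :
  dotp (etens v x) (etens w y) = if v == w then dotp x y else 0.
Proof. by rewrite !etensE single_dot. Qed.

Lemma etens_bounded K (w : word n) : bounded_op (@etens R n K w).
Proof.
apply: (isometry_contraction (@etens_lin K w) _).1 => x.
by rewrite etens_dot eqxx.
Qed.

Lemma fock_dot_ext K (f g : fock n K) :
  (forall w x, dotp f (etens w x) = dotp g (etens w x)) -> f = g.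
Proof.
by move=> h; apply: (@hsum_dot_ext R (word n) K) => w x; rewrite -etensE h.
Qed.

Lemma fock_total K L (A B : fock n K -> fock n L) :
  bounded_op A -> bounded_op B ->
  (forall w x, A (etens w x) = B (etens w x)) -> forall f, A f = B f.
Proof.
move=> bA bB h; apply: (@bounded_single_ext R (word n) K) => // w x.
by rewrite -etensE h.
Qed.

Lemma fock_csub_full K (M : closed_subspace (fock n K)) :
  (forall w x, csub_set M (etens w x)) -> forall f, csub_set M f.
Proof.
move=> h; apply: csub_full => y My; apply: fock_dot_ext => w x.
by rewrite My// dot0l.
Qed.

Section Annihilation.
Variable K : hilbertType R.

Let shifted_etens (i : idx n) (w : word n) : K -> fock n K := etens (i :: w).

Let shifted_orth i v w x y : dotp (shifted_etens i v x) (shifted_etens i w y) =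
  if v == w then dotp x y else 0.
Proof. by rewrite etens_dot eqseq_cons eqxx. Qed.

Let shifted_bounded i w : bounded_op (shifted_etens i w).
Proof. exact: etens_bounded. Qed.

(** The adjoint of [creation i], as the coefficient map of the family of
    embeddings x |-> e_(iw) (x) x; boundedness of both operators comes with this
    description. *)
Definition annihilation (i : idx n) : fock n K -> fock n K :=
  coef (shifted_bounded i) (@shifted_orth i).

Lemma annihilation_app i (f : fock n K) w :
  (annihilation i f : hsum _) w = (f : hsum _) (i :: w).
Proof.
pose B (g : fock n K) : K := (g : hsum _) (i :: w).
apply: (adj_unique (shifted_bounded i w) (B := B)) => x g.
by rewrite dotC dotp_etens -dotC.
Qed.

Lemma annihilation_bounded i : bounded_op (annihilation i).
Proof. exact: coef_bounded. Qed.

Lemma creation_adj i (f : fock n K) : creation i f = adj (annihilation i) f.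
Proof.
apply/fock_dot_ext => w y.
rewrite -(adjPr (annihilation_bounded i)) dotp_etens.
have -> : annihilation i (etens w y) =
    if w is j :: v then if j == i then etens v y else 0 else 0.
  apply: hsumP => u; rewrite annihilation_app /=.
  case: w => [|j v] //=; rewrite eqseq_cons eq_sym.
  by case: (j == i).
case: w => [|j v]; first by rewrite [RHS]dot0r; exact: dot0l.
rewrite [X in dotp X _]/=; case: (j == i); last by rewrite dot0r; exact: dot0l.
by rewrite dotp_etens.
Qed.

Lemma creation_dot i (f g : fock n K) :
  dotp (creation i f) g = dotp f (annihilation i g).
Proof. by rewrite creation_adj -(adjPr (annihilation_bounded i)). Qed.

Lemma creation_bounded i : bounded_op (@creation R n K i).
Proof.
rewrite (_ : creation i = adj (annihilation i)).
  exact: adj_bounded (annihilation_bounded i).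
by apply/funext => f; exact: creation_adj.
Qed.

Lemma creation_lin i : linear (@creation R n K i).
Proof. exact: (creation_bounded i).1. Qed.

Lemma annihilation_creation i j (f : fock n K) :
  annihilation i (creation j f) = if i == j then f else 0.
Proof.
by apply: hsumP => w; rewrite annihilation_app /=; case: (i == j).
Qed.

Lemma creation_orth i j (f g : fock n K) :
  dotp (creation i f) (creation j g) = if i == j then dotp f g else 0.
Proof.
by rewrite creation_dot annihilation_creation; case: eqP; rewrite ?dot0r.
Qed.

Lemma creation_vacuum i (f : fock n K) x :
  dotp (creation i f) (etens [::] x) = 0.
Proof. by rewrite dotp_etens dot0l. Qed.

Lemma vacuumP (f : fock n K) :
  (forall i g, dotp f (creation i g) = 0) -> f = etens [::] ((f : hsum _) [::]).
Proof.
move=> h; apply: hsumP => -[|i w] //=; apply: dot_ext => x.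
by rewrite dot0l -dotp_etens -creation_etens h.
Qed.

End Annihilation.

Section MultiAnalytic.
Variables (K L : hilbertType R) (A : fock n K -> fock n L).
Hypothesis mA : multi_analytic A.

Let lA : linear A. Proof. exact: mA.1.1. Qed.

Lemma multi_analytic_ext (B : fock n K -> fock n L) : multi_analytic B ->
  (forall x, A (etens [::] x) = B (etens [::] x)) -> forall f, A f = B f.
Proof.
move=> mB h; apply: (fock_total mA.1 mB.1); elim=> [|i w IH] x //.
by rewrite -creation_etens mA.2 mB.2 IH.
Qed.

(** A unitary that intertwines the creation operators maps the complement of
    their ranges, the vacuum space, onto the corresponding complement. *)
Lemma unitary_constantP :
  (forall f g, dotp (A f) (A g) = dotp f g) -> (forall g, exists f, A f = g) ->
  unitary_constant A.
Proof.
move=> iA sA.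
pose W x : L := (A (etens [::] x) : hsum _) [::].
have AW x : A (etens [::] x) = etens [::] (W x).
  apply: vacuumP => i g; have [f <-] := sA g.
  by rewrite -mA.2 iA; apply: dot_eq0C; exact: creation_vacuum.
have etens_inj y y' : etens [::] y = etens [::] y' :> fock n L -> y = y'.
  by move=> h; have /= := congr1 (fun f : fock n L => (f : hsum _) [::]) h.
exists W; split; last first.
  by elim=> [|i w IH] x //; rewrite -creation_etens mA.2 IH creation_etens.
split=> [a x y|x y|y].
- by apply: etens_inj; rewrite -AW !etens_lin lA !AW.
- have := iA (etens [::] x) (etens [::] y).
  by rewrite !AW !etens_dot eqxx.
have [f Af] := sA (etens [::] y).
exists ((f : hsum _) [::]); apply: etens_inj; rewrite -AW -vacuumP ?Af//.
move=> i g; rewrite -iA Af mA.2; apply: dot_eq0C; exact: creation_vacuum.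
Qed.

(** The hypothesis says that A maps the vectors on which it is isometric onto
    its codomain. The space of these vectors and the kernel of A are both
    invariant under the creation operators, so the two components of a vacuum
    vector are again in the vacuum, and one of them is a constant in ker A. *)
Lemma unitary_constant_criterion : contraction A ->
  (forall u, exists2 f, A f = u & dotp f f = dotp u u) ->
  (forall x, A (etens [::] x) = 0 -> x = 0) -> unitary_constant A.
Proof.
move=> cA sA k0; have bA := mA.1.
(* the space on which A is isometric, as the kernel of the defect operator *)
have EP f : dotp f f = dotp (A f) (A f) <-> defect A f = 0.
  split=> [h|h]; first by apply: dot_eq0; rewrite defect_dot// h subrr.
  have := defect_dot cA f f.
  by rewrite h dot0l => /esym/eqP; rewrite subr_eq0 => /eqP.
have EK f g : defect A f = 0 -> A g = 0 -> dotp f g = 0.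
  move=> hf hg; have := defect_dot cA f g.
  by rewrite hf hg dot0l dot0r subr0.
have ES i f : defect A f = 0 -> defect A (creation i f) = 0.
  move=> /EP h; apply/EP; rewrite mA.2 !creation_orth eqxx.
  exact: h.
have Edec f : exists2 a, defect A a = 0 & A (f - a) = 0.
  have [a Aa na] := sA (A f); exists a; last by rewrite (linB lA) Aa subrr.
  by apply/EP; rewrite Aa.
have vac x : defect A (etens [::] x) = 0.
  have [a Ea Kb] := Edec (etens [::] x).
  set b := etens [::] x - a in Kb.
  have bvac : b = etens [::] ((b : hsum _) [::]).
    apply: vacuumP => i g; have [c Ec Kd] := Edec g.
    rewrite -(subrK c g) (linD (creation_lin i)) dotDr.
    rewrite [X in _ + X](dot_eq0C (EK _ _ (ES i _ Ec) Kb)) addr0.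
    rewrite /b dotBl (dot_eq0C (creation_vacuum _ _ _)) (EK a)// ?subrr//.
    by rewrite mA.2 Kd (lin0 (creation_lin i)).
  have b0 : (b : hsum _) [::] = 0 by apply: k0; rewrite -bvac.
  suff -> : etens [::] x = a by [].
  apply/eqP; rewrite -subr_eq0 -/b bvac b0; apply/eqP.
  exact: (lin0 (@etens_lin K [::])).
have iso f : dotp (A f) (A f) = dotp f f.
  symmetry; apply/EP.
  pose M := kernel_csub (defect_bounded cA).
  apply: (fock_csub_full (M := M)) => {f}; elim=> [|i w IH] x; first exact: vac.
  rewrite -creation_etens; exact: (ES i _ (IH x)).
apply: unitary_constantP; first exact: isometry_dot.
by move=> g; have [f Af _] := sA g; exists f.
Qed.

End MultiAnalytic.

Lemma unitary_constant_isometric K L (A : fock n K -> fock n L) :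
  bounded_op A -> unitary_constant A -> forall f g, dotp (A f) (A g) = dotp f g.
Proof.
move=> bA [W [[lW iW sW] hW]] f g.
rewrite (adjP bA); suff -> : adj A (A g) = g by []; move: g.
apply: (@fock_total _ _ (adj A \o A) id).
- by apply: bounded_comp => //; exact: adj_bounded.
- by split=> //; exists 1 => h; rewrite mul1r.
move=> w x; apply/fock_dot_ext => v y.
by rewrite [(adj A \o A) _]/= -(adjPr bA) !hW !etens_dot iW.
Qed.

Lemma unitary_constant_surj K L (A : fock n K -> fock n L) :
  bounded_op A -> unitary_constant A -> forall g, exists f, A f = g.
Proof.
move=> bA uA g; have [W [[lW iW sW] hW]] := uA; exists (adj A g).
apply: (@fock_total _ _ (A \o adj A) id).
- by apply: bounded_comp => //; exact: adj_bounded.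
- by split=> //; exists 1 => h; rewrite mul1r.
move=> w x /=; have [y <-] := sW x; rewrite -hW; congr A.
apply/fock_dot_ext => v z.
by rewrite -(adjPr bA) (unitary_constant_isometric bA uA).
Qed.

End FockSpace.

(** * The Wold decomposition *)

Lemma word_op_bounded (R : realType) (n : option nat) (K : hilbertType R)
    (T : idx n -> K -> K) :
  (forall i, bounded_op (T i)) -> forall w, bounded_op (word_op T w).
Proof.
move=> bT; elim=> [|i w IH] /=; last exact: bounded_comp.
by split=> //; exists 1 => x; rewrite mul1r.
Qed.

(** V is a row isometry and j an isometry into its wandering vectors; the last
    hypothesis speaks of the orbit of the range of j, since V will also be
    decomposed on an invariant subspace that contains this orbit. *)
Section Wold.
Variables (R : realType) (n : option nat) (K L : hilbertType R).
Variables (V : idx n -> K -> K) (j : L -> K).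
Hypothesis bV : forall i, bounded_op (V i).
Hypothesis oV : forall i i' k l,
  dotp (V i k) (V i' l) = if i == i' then dotp k l else 0.
Hypotheses (lj : linear j) (ij : forall x y, dotp (j x) (j y) = dotp x y).
Hypothesis jV : forall i w x y, dotp (V i (word_op V w (j x))) (j y) = 0.

Definition wandering_family (w : word n) (x : L) : K := word_op V w (j x).

Lemma wandering_bounded w : bounded_op (wandering_family w).
Proof.
apply: (bounded_comp (A := j)); last exact: word_op_bounded.
by apply: (isometry_contraction lj _).1 => x; rewrite ij.
Qed.

Lemma wandering_orth v w x y :
  dotp (wandering_family v x) (wandering_family w y) =
  if v == w then dotp x y else 0.
Proof.
rewrite /wandering_family; elim: v w => [|i v IH] [|i' w] /=.
- exact: ij.
- by apply: dot_eq0C; exact: jV.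
- exact: jV.
by rewrite oV eqseq_cons; case: (i == i') => //=.
Qed.

(** The Fourier coefficients j^* V_w^* k of k. *)
Definition fourier : K -> fock n L := coef wandering_bounded wandering_orth.

Lemma fourier_contraction : contraction fourier.
Proof. exact: coef_contraction. Qed.
Lemma fourier_bounded : bounded_op fourier.
Proof. exact: fourier_contraction.1. Qed.

Lemma fourier_adj_etens w x : adj fourier (etens w x) = word_op V w (j x).
Proof. by rewrite etensE; exact: adj_coef_single. Qed.

Lemma fourier_etens k w x :
  dotp (fourier k) (etens w x) = dotp k (word_op V w (j x)).
Proof. by rewrite (adjP fourier_bounded) fourier_adj_etens. Qed.

Lemma fourier_adjK u : fourier (adj fourier u) = u.
Proof. exact: coef_adjK. Qed.

Lemma fourier_adj_dot u v : dotp (adj fourier u) (adj fourier v) = dotp u v.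
Proof. exact: adj_coef_dot. Qed.

Lemma fourier_adj_creation i u :
  V i (adj fourier u) = adj fourier (creation i u).
Proof.
have ba := adj_bounded fourier_bounded.
have b1 : bounded_op (V i \o adj fourier) by apply: bounded_comp.
have b2 : bounded_op (adj fourier \o creation i).
  by apply: bounded_comp => //; exact: creation_bounded.
apply: (@bounded_single_ext R (word n) L _
  (V i \o adj fourier) (adj fourier \o creation i)) => //.
by move=> w x; rewrite -etensE /= creation_etens !fourier_adj_etens.
Qed.

Lemma fourier_creation i k : (forall x, dotp (V i k) (j x) = 0) ->
  fourier (V i k) = creation i (fourier k).
Proof.
move=> h; apply/fock_dot_ext => -[|i' w] x; rewrite fourier_etens.
  by rewrite creation_vacuum h.
rewrite -(creation_etens i') creation_orth [word_op _ _ _]/= oV.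
by case: eqP => // _; rewrite fourier_etens.
Qed.

Lemma fourier_eq0 k :
  (forall w x, dotp k (word_op V w (j x)) = 0) -> fourier k = 0.
Proof.
by move=> h; apply/fock_dot_ext => w x; rewrite fourier_etens h dot0l.
Qed.

End Wold.

Section Residual.
Variables (R : realType) (K L : hilbertType R) (A : K -> L).
Hypotheses (bA : bounded_op A) (AK : forall u, A (adj A u) = u).

(** The orthogonal projection onto the kernel of the coisometry A. *)
Definition residual (k : K) : K := k - adj A (A k).

Lemma residual_lin : linear residual.
Proof.
move=> a x y; rewrite /residual bA.1 (adj_lin bA).
by rewrite scalerBr opprD addrACA.
Qed.

Lemma residual_ker k : A (residual k) = 0.
Proof. by rewrite /residual (linB bA.1) AK subrr. Qed.

Lemma residual_id k : A k = 0 -> residual k = k.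
Proof. by rewrite /residual => ->; rewrite (lin0 (adj_lin bA)) subr0. Qed.

Lemma residual_sym x y : dotp (residual x) y = dotp x (residual y).
Proof. by rewrite /residual dotBl dotBr -(adjPr bA) -(adjP bA). Qed.

Lemma residual_dot x :
  dotp (residual x) (residual x) = dotp x x - dotp (A x) (A x).
Proof.
rewrite -residual_sym residual_id; last exact: residual_ker.
by rewrite /residual dotBl -(adjPr bA).
Qed.

Lemma residual_eq0 x : dotp (A x) (A x) = dotp x x -> x = adj A (A x).
Proof.
move=> h; apply/eqP; rewrite -subr_eq0; apply/eqP/dot_eq0.
by rewrite residual_dot h subrr.
Qed.

End Residual.

Lemma range_dense (R : realType) (U W : hilbertType R) (A : U -> W) (x : W) :
  linear A -> (forall y, (forall f, dotp y (A f) = 0) -> dotp x y = 0) ->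
  closure (range A) x.
Proof.
move=> lA h.
pose A' : {linear U -> W} := HB.pack A (GRing.isLinear.Build _ _ _ _ A lA).
apply: (@csub_perp R W (ran_closure A')) => y hy; apply: h => f.
by apply: hy; apply: subset_closure; exists f.
Qed.

(** * Invariant subspaces and factorizations in a dilation space *)

(** V is an isometric dilation of T on K = H (+) fock D, with embeddings iH and
    iD, and j parametrizes its wandering vectors by Ds; the hypothesis [total]
    says that they and the ranges of the V_i span K. *)
Section Model.
Variables (R : realType) (n : option nat) (H K D Ds : hilbertType R).
Variables (T : idx n -> H -> H) (V : idx n -> K -> K).
Variables (iH : H -> K) (iD : fock n D -> K) (j : Ds -> K).
Hypothesis bT : forall i, bounded_op (T i).
Hypothesis bV : forall i, bounded_op (V i).
Hypothesis oV : forall i i' k l,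
  dotp (V i k) (V i' l) = if i == i' then dotp k l else 0.
Hypotheses (lH : linear iH) (iHi : forall x y, dotp (iH x) (iH y) = dotp x y).
Hypotheses (lD : linear iD) (iDi : forall x y, dotp (iD x) (iD y) = dotp x y).
Hypothesis iHD : forall h f, dotp (iH h) (iD f) = 0.
Hypothesis dec : forall k, exists h f, k = iH h + iD f.
Hypothesis ViD : forall i f, V i (iD f) = iD (creation i f).
Hypothesis VH : forall i h h', dotp (V i (iH h)) (iH h') = dotp (T i h) h'.
Hypotheses (lj : linear j) (ij : forall x y, dotp (j x) (j y) = dotp x y).
Hypothesis jV : forall i k x, dotp (V i k) (j x) = 0.
Hypothesis total : forall k,
  (forall x, dotp k (j x) = 0) -> (forall i l, dotp k (V i l) = 0) -> k = 0.

Let jVw i w x y : dotp (V i (word_op V w (j x))) (j y) = 0.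
Proof. exact: jV. Qed.

Definition model_fourier : K -> fock n Ds := fourier bV oV lj ij jVw.
Local Notation Phi := model_fourier.

Let bPhi : bounded_op Phi. Proof. exact: fourier_bounded. Qed.
Let PhiK u : Phi (adj Phi u) = u. Proof. exact: fourier_adjK. Qed.
Let PhiV i k : Phi (V i k) = creation i (Phi k).
Proof. by apply: fourier_creation => x; exact: jV. Qed.
Let VPhi i u : V i (adj Phi u) = adj Phi (creation i u).
Proof. exact: fourier_adj_creation. Qed.
Local Notation P := (residual Phi).

Lemma ker_model_adj i k : Phi k = 0 -> Phi (adj (V i) k) = 0.
Proof.
move=> Pk; apply: dot_ext => u; rewrite dot0l (adjP bPhi) -(adjPr (bV i)).
by rewrite VPhi -(adjP bPhi) Pk dot0l.
Qed.

(** Complete non-coisometry is a condition on the words of each fixed length;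
    the lemmas of this section express it through the kernel of Phi. *)
Section Words.

Lemma word_op_V_ker w k : Phi k = 0 -> Phi (word_op V w k) = 0.
Proof.
move=> Pk; elim: w => [//|i w IH] /=.
by rewrite PhiV IH (lin0 (@creation_lin R n Ds i)).
Qed.

Lemma word_op_V_orth m (v w : m.-tuple (idx n)) k l :
  dotp (word_op V v k) (word_op V w l) = if v == w then dotp k l else 0.
Proof.
rewrite -val_eqE; case: v w => [v /= /eqP <-] [w /= /eqP].
elim: v w => [|i v IH] [|i' w]//= [] vw; rewrite oV eqseq_cons.
by case: (i == i') => //=; exact: IH.
Qed.

Lemma word_op_V_adj_ker w k : Phi k = 0 -> Phi (adj (word_op V w) k) = 0.
Proof.
elim: w k => [|i w IH] k Pk.
  rewrite (_ : adj _ k = k)//.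
  exact: (adj_unique (word_op_bounded bV [::]) (B := id)).
rewrite (_ : adj (word_op V (i :: w)) k = adj (word_op V w) (adj (V i) k)).
  by apply: IH; exact: ker_model_adj.
exact: adj_comp (word_op_bounded bV w) (bV i) k.
Qed.

(** Induction on m through [total]: if all components V_w^* z with |w| = m
    vanish, so do those with |w| = m - 1. *)
Lemma word_components_eq0 m z : Phi z = 0 ->
  (forall w, size w = m -> adj (word_op V w) z = 0) -> z = 0.
Proof.
elim: m z => [|m IH] z Pz hz.
  rewrite -(hz [::] erefl); symmetry.
  exact: (adj_unique (word_op_bounded bV [::]) (B := id)).
apply: total => [x|i l].
  rewrite -[LHS](fourier_etens bV oV lj ij jVw _ [::]).
  by rewrite [X in dotp X _]Pz dot0l.
rewrite (adjPr (bV i)) (_ : adj (V i) z = 0) ?dot0l//.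
apply: IH => [|w wm]; first exact: ker_model_adj.
rewrite -(hz (i :: w)) /=; last by rewrite wm.
by symmetry; exact: adj_comp (word_op_bounded bV w) (bV i) z.
Qed.

Lemma ker_model_words m r : Phi r = 0 ->
  partial_sum (fun w : m.-tuple (idx n) =>
    dotp (adj (word_op V w) r) (adj (word_op V w) r) : R[i]^o) @ totally -->
  (dotp r r : R[i]^o).
Proof.
move=> Pr; pose J (w : m.-tuple (idx n)) := word_op V w.
have bJ w : bounded_op (J w) by exact: word_op_bounded.
have oJ v w k l : dotp (J v k) (J w l) = if v == w then dotp k l else 0.
  exact: word_op_V_orth.
pose G := coef bJ oJ.
have bG : bounded_op G := coef_bounded bJ oJ.
have GK u : G (adj G u) = u := coef_adjK bJ oJ u.
have zE : residual G r = 0.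
  apply: (@word_components_eq0 m) => [|w /eqP wm].
    rewrite /residual (linB bPhi.1) Pr sub0r.
    rewrite (_ : Phi (adj G (G r)) = 0) ?oppr0//; apply: dot_ext => u.
    rewrite dot0l (adjP bPhi) -(adjPr bG); apply: hsum_dot0 => w.
    rewrite -(adjP (bJ w)) -(adjP bPhi) word_op_V_ker ?dot0l//.
    exact: word_op_V_adj_ker.
  have := residual_ker bG GK r.
  by move=> /(congr1 (fun f : hsum _ => f (Tuple wm))).
rewrite (_ : dotp r r = dotp (G r) (G r)); first exact: (hsum_norm_cvg (G r)).1.
apply/eqP; rewrite -subr_eq0 -(residual_dot bG GK) zE dot0l//.
Qed.

Lemma V_adj_iH i h : adj (V i) (iH h) = iH (adj (T i) h).
Proof.
apply: dot_ext => k; have [a [f ->]] := dec k.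
rewrite -(adjPr (bV i)) (linD (bV i).1) !dotDr ViD !iHD iHi !addr0.
by rewrite dotC VH -dotC -(adjPr (bT i)).
Qed.

Lemma word_op_V_adj_iH w h :
  adj (word_op V w) (iH h) = iH (adj (word_op T w) h).
Proof.
elim: w h => [|i w IH] h.
  rewrite (adj_unique (word_op_bounded bV [::]) (B := id))//.
  by rewrite (adj_unique (word_op_bounded bT [::]) (B := id)).
rewrite (adj_comp (word_op_bounded bV w) (bV i)) V_adj_iH IH.
by rewrite -(adj_comp (word_op_bounded bT w) (bT i)).
Qed.

(** If Phi h = 0 for h in H, then h is the sum of its components V_w V_w^* h
    with |w| = m, and V_w^* h = T_w^* h; so the norms of the T_w^* h exhaust
    that of h. *)
Lemma completely_non_coisometric_model : completely_non_coisometric T ->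
  forall h, Phi (iH h) = 0 -> h = 0.
Proof.
move=> hT h Ph; apply: hT => m _.
have := @ker_model_words m _ Ph; rewrite iHi dotpE.
rewrite (_ : (fun w : m.-tuple (idx n) => _) =
  (fun w : m.-tuple (idx n) => `|adj (word_op T w) h| ^+ 2 : R[i]^o))//.
apply/funext => w.
by rewrite word_op_V_adj_iH iHi dotpE.
Qed.

End Words.

Hypothesis cnc : forall h, Phi (iH h) = 0 -> h = 0.

Definition model_char (f : fock n D) : fock n Ds := Phi (iD f).
Local Notation Theta := model_char.

Let bH : bounded_op iH.
Proof. exact: (isometry_contraction lH (fun x => iHi x x)).1. Qed.
Lemma ker_model k : Phi k = 0 -> (forall f, dotp k (iD f) = 0) -> k = 0.
Proof.
move=> Pk Dk; have [h [f kE]] := dec k.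
have f0 : f = 0.
  apply: dot_eq0; have := Dk f; rewrite kE dotDl iHD add0r iDi; exact.
move: Pk; rewrite kE f0 (lin0 lD) addr0 => /cnc ->.
exact: lin0.
Qed.

Lemma model_char_contraction : contraction Theta.
Proof.
apply/contractionP; split; first by move=> a x y; rewrite /Theta lD bPhi.1.
move=> f; rewrite -iDi.
exact: (((contractionP Phi).1 (fourier_contraction _ _ _ _ _)).2 (iD f)).
Qed.

Lemma model_char_multi_analytic : multi_analytic Theta.
Proof.
split; first exact: model_char_contraction.1.
by move=> i f; rewrite /Theta -ViD PhiV.
Qed.

(** The image k of a constant satisfies V_i^* k in H. If Phi k = 0, then V_i^* k
    lies in the intersection of ker Phi and H, which is 0, and [total] gives k =
    0. *)
Lemma model_char_vacuum x : Theta (etens [::] x) = 0 -> x = 0.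
Proof.
move=> h; set k := iD (etens [::] x).
have k0 : k = 0.
  apply: total => [y|i l].
    rewrite -[LHS](fourier_etens bV oV lj ij jVw k [::]).
    by rewrite [X in dotp X _]h dot0l.
  rewrite (adjPr (bV i)) (_ : adj (V i) k = 0) ?dot0l//.
  apply: ker_model => [|f]; first exact: ker_model_adj.
  rewrite -(adjPr (bV i)) ViD iDi.
  by apply: dot_eq0C; exact: creation_vacuum.
apply: dot_eq0; have := iDi (etens [::] x) (etens [::] x).
by rewrite -/k k0 dot0l etens_dot eqxx => <-.
Qed.

Let lPD : linear (P \o iD).
Proof.
by move=> a x y /=; rewrite lD; exact: (residual_lin bPhi a (iD x) (iD y)).
Qed.

(** A vector of ker Phi orthogonal to the projected fock D is orthogonal to fock
    D itself, so it lies in H; there only 0 is killed by Phi. *)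
Lemma residual_dense t : Phi t = 0 -> closure (range (P \o iD)) t.
Proof.
move=> Pt; apply: (range_dense lPD) => y hy.
rewrite -(residual_id bPhi Pt) residual_sym//.
suff -> : P y = 0 by rewrite dot0r.
apply: ker_model => [|f]; first exact: residual_ker.
by rewrite residual_sym// hy.
Qed.

Section InvariantToFactorization.
Variable M : closed_subspace H.
Hypothesis MT : forall i x, csub_set M x -> csub_set M (T i x).

Let Mperp : set H := operp_set (csub_set M).

(** M (+) fock D; as an orthogonal complement it is closed by construction. *)
Definition lift_csub : closed_subspace K := operp (iH @` Mperp).
Local Notation N := lift_csub.

Lemma lift_csubP k : csub_set N k <-> forall h, Mperp h -> dotp k (iH h) = 0.
Proof.
split=> [Nk h Mh|Nk _ [h Mh <-]]; last exact: Nk.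
by apply: Nk; exists h.
Qed.

Lemma lift_csub_iH h : csub_set N (iH h) <-> csub_set M h.
Proof.
rewrite lift_csubP; split=> [Nh|Mh y My]; last first.
  by rewrite iHi; apply: dot_eq0C; exact: My.
by apply: csub_perp => y My; rewrite -iHi; exact: Nh.
Qed.

Lemma lift_csub_iD f : csub_set N (iD f).
Proof. by apply/lift_csubP => h _; apply: dot_eq0C; exact: iHD. Qed.

Lemma lift_csub_V i k : csub_set N k -> csub_set N (V i k).
Proof.
have [h [f ->]] := dec k => Nk; rewrite (linD (bV i).1) ViD.
have Mh : csub_set M h.
  apply/lift_csub_iH; rewrite -(addrK (iD f) (iH h)).
  by apply: csubB => //; exact: lift_csub_iD.
apply: csubD; last exact: lift_csub_iD.
apply/lift_csubP => y My; rewrite VH; apply: dot_eq0C; apply: My.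
exact: MT.
Qed.

Definition wandering_csub : closed_subspace K :=
  operp ((iH @` Mperp) `|` [set s | exists i k, csub_set N k /\ s = V i k]).
Local Notation L := wandering_csub.

Lemma wandering_csubP k : csub_set L k <->
  csub_set N k /\ forall i l, csub_set N l -> dotp k (V i l) = 0.
Proof.
split=> [Lk|[Nk hk] s [Ms|[i [l [Nl ->]]]]].
- split=> [s Ms|i l Nl]; first by apply: Lk; left.
  by apply: Lk; right; exists i, l.
- exact: Nk.
exact: hk.
Qed.

Local Notation F := (csub L).

Let jL (x : F) : K := val x.
Let ljL : linear jL. Proof. by []. Qed.
Let ijL x y : dotp (jL x) (jL y) = dotp x y. Proof. by []. Qed.
Let jL_L x : csub_set L (jL x). Proof. exact: csub_val. Qed.
Let Vw_N w x : csub_set N (word_op V w (jL x)).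
Proof.
elim: w => [|i w IH] /=; first by have [] := (wandering_csubP _).1 (jL_L x).
exact: lift_csub_V.
Qed.

Let jVL i w x y : dotp (V i (word_op V w (jL x))) (jL y) = 0.
Proof.
have [_ h] := (wandering_csubP _).1 (jL_L y).
by apply: dot_eq0C; apply: h; exact: Vw_N.
Qed.

Let Xi : K -> fock n F := fourier bV oV ljL ijL jVL.
Let bXi : bounded_op Xi. Proof. exact: fourier_bounded. Qed.
Let XiK u : Xi (adj Xi u) = u. Proof. exact: fourier_adjK. Qed.
Local Notation Q := (residual Xi).

Let Xi_creation i k : csub_set N k -> Xi (V i k) = creation i (Xi k).
Proof.
move=> Nk; apply: fourier_creation => x.
have [_ h] := (wandering_csubP _).1 (jL_L x).
by apply: dot_eq0C; exact: h.
Qed.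

Let Xi_adj_N u : csub_set N (adj Xi u).
Proof.
apply/lift_csubP => h Mh; rewrite -(adjPr bXi).
rewrite (_ : Xi (iH h) = 0) ?dot0r//; apply: fourier_eq0 => w x.
by apply: dot_eq0C; exact: (lift_csubP _).1 (Vw_N w x) h Mh.
Qed.

Let Q_N k : csub_set N k -> csub_set N (Q k).
Proof. by move=> Nk; apply: csubB => //; exact: Xi_adj_N. Qed.

(** The vectors j x and V_i z, for z orthogonal to N, have projections onto N
    that are wandering for V on N. A vector k of N killed by Xi is orthogonal to
    them: so <k, j x> = 0, and V_i^* k is again in N. Induction on words
    follows. *)
Lemma restricted_kernel k : csub_set N k -> Xi k = 0 -> Phi k = 0.
Proof.
move=> Nk Xk; apply: fourier_eq0 => w x.
have XL l y : csub_set N l -> Xi l = 0 -> csub_set L y -> dotp l y = 0.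
  move=> Nl Xl Ly.
  have := fourier_etens bV oV ljL ijL jVL l [::] (exist _ y (mem_set Ly)).
  by rewrite -/Xi Xl dot0l => <-.
have XN l y : csub_set N l -> Xi l = 0 ->
    (forall i m, csub_set N m -> dotp y (V i m) = 0) -> dotp l y = 0.
  move=> Nl Xl hy; have [p Np yp] := projection N y.
  rewrite -(subrK p y) dotDr (dot_eq0C (yp _ Nl)) add0r.
  apply: XL => //; apply/wandering_csubP; split=> // i m Nm.
  have -> : p = y - (y - p) by rewrite opprB addrC subrK.
  by rewrite dotBl hy// yp ?subrr//; exact: lift_csub_V.
elim: w k Nk Xk => [|i w IH] k Nk Xk /=.
  by apply: XN => // i m _; apply: dot_eq0C; exact: jV.
rewrite (adjPr (bV i)); apply: IH.
  apply: csub_perp => z Nz; rewrite -(adjPr (bV i)); apply: XN => // i' m Nm.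
  by rewrite oV; case: eqP => // _; exact: Nz.
apply: fourier_eq0 => v y; rewrite -(adjPr (bV i)).
have := fourier_etens bV oV ljL ijL jVL k (i :: v) y.
by rewrite -/Xi Xk dot0l => <-.
Qed.

Let A1 (f : fock n D) : fock n F := Xi (iD f).
Let A2 (u : fock n F) : fock n Ds := Phi (adj Xi u).

Let c1 : contraction A1.
Proof.
apply/contractionP; split; first by move=> a x y; rewrite /A1 lD bXi.1.
move=> f; rewrite -iDi.
exact: (((contractionP Xi).1 (fourier_contraction _ _ _ _ _)).2 (iD f)).
Qed.

Let c2 : contraction A2.
Proof.
apply/contractionP; split.
  by move=> a x y; rewrite /A2 (adj_lin bXi) bPhi.1.
move=> u; rewrite -[leRHS](fourier_adj_dot bV oV ljL ijL jVL).
exact: (((contractionP Phi).1 (fourier_contraction _ _ _ _ _)).2 (adj Xi u)).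
Qed.

Let m1 : multi_analytic A1.
Proof.
split; first exact: c1.1.
by move=> i f; rewrite /A1 -ViD Xi_creation//; exact: lift_csub_iD.
Qed.

Let m2 : multi_analytic A2.
Proof.
split; first exact: c2.1.
by move=> i f; rewrite /A2 -(fourier_adj_creation bV oV ljL ijL jVL) PhiV.
Qed.

Let PhiQ f : Phi (Q (iD f)) = 0.
Proof.
apply: restricted_kernel; last exact: (residual_ker bXi XiK).
by apply: Q_N; exact: lift_csub_iD.
Qed.

Let factorE : Theta = A2 \o A1.
Proof.
apply/funext => f; rewrite /Theta /A2 /A1 /=; apply/eqP.
by rewrite -subr_eq0 -(linB bPhi.1); apply/eqP; exact: PhiQ.
Qed.

Let PQ_orth v g : dotp (P (adj Xi v)) (Q (iD g)) = 0.
Proof.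
rewrite (residual_sym bPhi) (residual_id bPhi (PhiQ g)) -(adjPr bXi).
by rewrite (residual_ker bXi XiK) dot0r.
Qed.

Let form2 v : defect_form A2 v = dotp (P (adj Xi v)) (P (adj Xi v)).
Proof.
rewrite /defect_form (residual_dot bPhi PhiK).
by rewrite (fourier_adj_dot bV oV ljL ijL jVL).
Qed.

Let form1 g : defect_form A1 g = dotp (Q (iD g)) (Q (iD g)).
Proof. by rewrite /defect_form (residual_dot bXi XiK) iDi. Qed.

(** For regularity, t = P Xi^* u + Q g is the point of ker Phi that corresponds
    to (Delta_2 u, Delta_1 g). By density some P f is close to t, and the
    difference is the orthogonal sum of P Xi^* (u - A1 f) and Q (g - f). *)
Lemma invariant_factorization :
  csub_set M <> [set 0] -> csub_set M <> setT ->
  has_nontrivial_regular_factorization Theta.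
Proof.
move=> M0 MT'; exists F, A1, A2; split.
- split=> //; rewrite factorE; apply: regular_dense => // u g e e0.
  pose t := P (adj Xi u) + Q (iD g).
  have Pt : Phi t = 0.
    by rewrite /t (linD bPhi.1) (residual_ker bPhi PhiK) PhiQ addr0.
  have /closure_sqP/(_ e e0)[_ [f _ <-] hf] := residual_dense Pt.
  exists f; apply: le_lt_trans hf.
  have -> : t - (P \o iD) f = P (adj Xi (u - A1 f)) + Q (iD (g - f)).
    have -> : (P \o iD) f = P (adj Xi (A1 f)) + Q (iD f).
      rewrite /= -[X in _ + X](residual_id bPhi (PhiQ f)).
      rewrite -(linD (residual_lin bPhi)).
      by congr (P _); rewrite /residual addrC subrK.
    rewrite (linB (adj_lin bXi)) (linB (residual_lin bPhi)).
    rewrite (linB lD) (linB (residual_lin bXi)).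
    by rewrite /t opprD addrACA.
  by rewrite (dot_pyth (PQ_orth _ _)) form1 form2.
(* Q = 0 on fock D, so a vector of N killed by Xi is orthogonal to fock D *)
- move=> uc; apply: M0; apply/seteqP; split=> [m Mm|_ ->]; last exact: csub0.
  have iso := unitary_constant_isometric c1.1 uc.
  have [f fE] := unitary_constant_surj c1.1 uc (Xi (iH m)).
  have Q0 g : Q (iD g) = 0.
    by apply: dot_eq0; rewrite -form1 /defect_form iso subrr.
  have Xi0 : Xi (iH m - iD f) = 0 by rewrite (linB bXi.1) -fE subrr.
  have Nk : csub_set N (iH m - iD f).
    by apply: csubB; [apply/lift_csub_iH|exact: lift_csub_iD].
  have : iH m - iD f = 0.
    apply: ker_model; first exact: restricted_kernel.
    move=> g; rewrite -[iD g](subrK (adj Xi (Xi (iD g)))) -/(Q (iD g)) Q0 add0r.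
    by rewrite -(adjP bXi) Xi0 dot0l.
  move/eqP; rewrite subr_eq0 => /eqP mf.
  by apply: dot_eq0; rewrite -iHi {2}mf iHD.
(* the range of Phi^* lies in N, hence is orthogonal to the complement of M *)
move=> uc; apply: MT'; apply/seteqP; split=> // m _.
have iso := unitary_constant_isometric c2.1 uc.
apply: csub_full => h Mh; apply: cnc; apply: dot_ext => v.
rewrite dot0l (adjP bPhi).
have [u uE] := unitary_constant_surj c2.1 uc v.
have -> : adj Phi v = adj Xi u.
  rewrite -uE -(residual_eq0 bPhi PhiK)//.
  by rewrite (fourier_adj_dot bV oV ljL ijL jVL) -iso.
by apply: dot_eq0C; exact: (lift_csubP _).1 (Xi_adj_N u) h Mh.
Qed.

End InvariantToFactorization.

Section FactorizationToInvariant.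
Variables (F : hilbertType R).
Variables (A1 : fock n D -> fock n F) (A2 : fock n F -> fock n Ds).
Hypothesis reg : regular_factorization Theta A1 A2.

Let c1 : contraction A1. Proof. by case: reg => -[]. Qed.
Let m1 : multi_analytic A1. Proof. by case: reg => -[]. Qed.
Let c2 : contraction A2. Proof. by case: reg => _ -[]. Qed.
Let m2 : multi_analytic A2. Proof. by case: reg => _ -[]. Qed.
Let factE f : Theta f = A2 (A1 f). Proof. by case: reg => _ _ ->. Qed.
Let l1 : linear A1. Proof. exact: c1.1.1. Qed.
Let l2 : linear A2. Proof. exact: c2.1.1. Qed.

Let conjcB (x y : R[i]) : (x - y)^* = x^* - y^*. Proof. exact: rmorphB. Qed.

Let conjcM (x y : R[i]) : (x * y)^* = x^* * y^*. Proof. exact: rmorphM. Qed.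
Let conjcN (x : R[i]) : (- x)^* = - x^*. Proof. exact: rmorphN. Qed.

(** The image of (Delta_2 u, 0) under the inverse of the isometry of the
    factorization, moved from the closure of the range of Delta_Theta to the
    kernel of Phi. *)
Lemma residual_part u : exists2 r, Phi r = 0 & forall f,
  dotp (r - P (iD f)) (r - P (iD f)) =
  defect_form A2 (u - A1 f) + defect_form A1 f.
Proof.
have [_ _ eT hX] := reg; rewrite eT in hX.
have [x cx hx] := regular_surjective c1 c2 hX u.
have cT : contraction (A2 \o A1) by exact: contraction_comp.
have eqn f : dotp (defect (A2 \o A1) f) (defect (A2 \o A1) f) =
    dotp ((P \o iD) f) ((P \o iD) f).
  by rewrite defect_dot// /= (residual_dot bPhi PhiK) iDi -/(Theta f) factE.
have [r cr hr] := closure_transport (defect_lin cT) lPD eqn cx.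
exists r; last by move=> f; rewrite -hx !dotpE -hr.
have : csub_set (kernel_csub bPhi) r; last by [].
apply: csub_closureP => e e0.
have /closureP/(_ e e0)[_ [f _ <-] hf] := cr.
by exists ((P \o iD) f) => //; exact: (residual_ker bPhi PhiK).
Qed.

Let form_dot u v := dotp u v - dotp (A2 u) (A2 v).

Let form_dotE u v : defect_form A2 (u - v) =
  defect_form A2 u + defect_form A2 v - (form_dot u v + form_dot v u).
Proof. rewrite /defect_form /form_dot (linB l2) !dotB2; ring. Qed.

(** The cross terms of the distances, first at f and then at i f. *)
Lemma residual_part_dot u r : Phi r = 0 ->
  (forall f, dotp (r - P (iD f)) (r - P (iD f)) =
     defect_form A2 (u - A1 f) + defect_form A1 f) ->
  dotp r r = defect_form A2 u /\
  forall f, dotp r (iD f) = dotp u (A1 f) - dotp (A2 u) (Theta f).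
Proof.
move=> Pr hr.
have rr : dotp r r = defect_form A2 u.
  have := hr 0; rewrite (lin0 lD) (lin0 (residual_lin bPhi)) (lin0 l1) !subr0.
  by rewrite {2}/defect_form (lin0 l1) !dot0l subrr addr0.
split=> // f.
pose c g := dotp r (iD g) - form_dot u (A1 g).
have c0 g : c g + (c g)^* = 0.
  have := hr g; rewrite dotB2 rr (residual_dot bPhi PhiK) iDi form_dotE.
  rewrite (residual_sym bPhi (iD g)) -(residual_sym bPhi r).
  rewrite (residual_id bPhi Pr).
  rewrite -/(Theta g) factE {3 4}/defect_form /c conjcB -(dotC (iD g)).
  have -> : (form_dot u (A1 g))^* = form_dot (A1 g) u.
    by rewrite /form_dot conjcB -!dotC.
  move=> /eqP; rewrite -subr_eq0 => /eqP h.
  apply/eqP; rewrite -oppr_eq0; apply/eqP.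
  rewrite -[RHS]h; ring.
have ci : c ('i *: f) = - 'i * c f.
  by rewrite /c /form_dot (linZ lD) (linZ l1) (linZ l2) !dotZr conjCi; ring.
have : c f = 0.
  have h1 := c0 f; have := c0 ('i *: f).
  rewrite ci conjcM conjcN conjCi opprK mulNr addrC -mulrBr => /eqP.
  rewrite mulf_eq0 (negbTE (neq0Ci _)) /= subr_eq0 => /eqP h2.
  by move/eqP: h1; rewrite h2 -mulr2n mulrn_eq0 => /eqP.
by rewrite /c /form_dot factE => /eqP; rewrite subr_eq0 => /eqP.
Qed.

Let rho u : K := projT1 (cid2 (residual_part u)).
Let Phi_rho u : Phi (rho u) = 0. Proof. by rewrite /rho; case: cid2. Qed.
Let rho_dist u f : dotp (rho u - P (iD f)) (rho u - P (iD f)) =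
  defect_form A2 (u - A1 f) + defect_form A1 f.
Proof. by rewrite /rho; case: cid2. Qed.

(** The isometry Psi. Its component off ker Phi is forced by Phi Psi = A2, and
    rho u is the component in ker Phi. *)
Definition factor_embedding u : K := adj Phi (A2 u) + rho u.
Local Notation Psi := factor_embedding.

Lemma Phi_embedding u : Phi (Psi u) = A2 u.
Proof. by rewrite /Psi (linD bPhi.1) PhiK Phi_rho addr0. Qed.

Lemma embedding_iD u f : dotp (Psi u) (iD f) = dotp u (A1 f).
Proof.
have [_ h] := residual_part_dot (Phi_rho u) (rho_dist u).
by rewrite /Psi dotDl h -(adjPr bPhi) addrC subrK.
Qed.

Lemma embedding_linear : linear Psi.
Proof.
move=> a u v; apply/eqP; rewrite -subr_eq0; apply/eqP; apply: ker_model.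
  by rewrite (linB bPhi.1) bPhi.1 !Phi_embedding l2 subrr.
move=> f; rewrite dotBl (dotDl (a *: Psi u)) dotZl !embedding_iD.
by rewrite dotDl dotZl subrr.
Qed.

Lemma embedding_isometric u v : dotp (Psi u) (Psi v) = dotp u v.
Proof.
apply: isometry_dot u v; first exact: embedding_linear.
move=> u; have [rr _] := residual_part_dot (Phi_rho u) (rho_dist u).
rewrite /Psi dot_pyth; last by rewrite -(adjPr bPhi) Phi_rho dot0r.
by rewrite rr (fourier_adj_dot bV oV lj ij jVw) /defect_form addrC subrK.
Qed.

Let form_creation (E G : hilbertType R) (A : fock n E -> fock n G) i x :
  multi_analytic A -> defect_form A (creation i x) = defect_form A x.
Proof. by move=> mA; rewrite /defect_form mA.2 !creation_orth eqxx. Qed.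

(** Both V_i rho u and rho (S_i u) are close to P S_i f when rho u is close to P
    f. *)
Lemma embedding_creation i u : V i (Psi u) = Psi (creation i u).
Proof.
rewrite /Psi (linD (bV i).1) VPhi -m2.2; congr (_ + _).
apply/eqP; rewrite -subr_eq0; apply/eqP; apply: norm_small => e e0.
have e20 : 0 < e / 2 by rewrite divr_gt0.
have /closureP/(_ _ e20)[_ [f _ <-] hf] := residual_dense (Phi_rho u).
have VP : V i (P (iD f)) = P (iD (creation i f)).
  by rewrite /residual (linB (bV i).1) ViD VPhi -PhiV ViD.
rewrite -(subrKA (V i (P (iD f)))) (splitr e).
apply: le_lt_trans (ler_normD _ _) _.
apply: ltrD.
  rewrite -(linB (bV i).1) (@norm_eqP R K _ K (rho u - P (iD f)))//.
  by rewrite oV eqxx.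
rewrite VP distrC (@norm_eqP R K _ K (rho u - P (iD f)))//.
rewrite !rho_dist m1.2 -(linB (creation_lin i)).
by rewrite !form_creation.
Qed.

Let bPsi : bounded_op Psi.
Proof.
apply: (isometry_contraction embedding_linear _).1 => u.
exact: embedding_isometric.
Qed.

Local Notation pPsi := (fun u => adj iH (Psi u)).

(** The closure of the projection to H of the range of Psi; as a double
    complement, its invariance is a matter of adjoints and needs no limits. *)
Definition factor_csub : closed_subspace H := operp (operp_set (range pPsi)).
Local Notation M := factor_csub.

Lemma factor_csub_invariant i x : csub_set M x -> csub_set M (T i x).
Proof.
move=> Mx y hy; rewrite (adjP (bT i)); apply: Mx => _ [u _ <-].
rewrite -(adjPr (bT i)).
suff -> : T i (adj iH (Psi u)) = adj iH (Psi (creation i u)).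
  by apply: hy; exists (creation i u).
rewrite -embedding_creation; apply: dot_ext => h.
rewrite -VH -(adjPr bH).
have [a [f kE]] := dec (Psi u).
have -> : adj iH (Psi u) = a.
  apply: dot_ext => b; rewrite -(adjPr bH) kE dotDl iHi.
  by rewrite (dot_eq0C (iHD _ _)) addr0.
rewrite kE (linD (bV i).1) ViD dotDl (dot_eq0C (iHD _ _)) addr0 //.
Qed.

(** If M = 0, the range of Psi lies in fock D, where Psi^* is A1. *)
Let zeroM : csub_set M = [set 0] -> unitary_constant A1.
Proof.
move=> M0.
have p0 u : adj iH (Psi u) = 0.
  have : csub_set M (adj iH (Psi u)); last by rewrite M0.
  by move=> y hy; apply: dot_eq0C; apply: hy; exists u.
apply: (unitary_constant_criterion m1 c1) => [u|x h].
  have [h [f kE]] := dec (Psi u).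
  have h0 : h = 0.
    apply: dot_eq0; have := dot0l h.
    rewrite -{1}(p0 u) -(adjPr bH) kE dotDl iHi.
    by rewrite (dot_eq0C (iHD _ _)) addr0.
  rewrite h0 (lin0 lH) add0r in kE; exists f.
    apply: dot_ext => v; rewrite dotC -embedding_iD -kE embedding_isometric.
    by rewrite -dotC.
  by rewrite -iDi -kE embedding_isometric.
by apply: model_char_vacuum; rewrite factE h (lin0 l2).
Qed.

(** If M = H, then fock D and the range of Psi span K. The vector Phi^* v is
    orthogonal to all iD f - Psi (A1 f), which lie in ker Phi, so it is in the
    range of Psi. *)
Let fullM : csub_set M = setT -> unitary_constant A2.
Proof.
move=> MT.
have K0 w : (forall u, dotp w (Psi u) = 0) ->
    (forall f, dotp w (iD f) = 0) -> w = 0.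
  move=> hP hD; have [h [f kE]] := dec w.
  have f0 : f = 0.
    by apply: dot_eq0; have := hD f; rewrite kE dotDl iHD add0r iDi.
  rewrite f0 (lin0 lD) addr0 in kE.
  suff h0 : h = 0 by rewrite kE h0 (lin0 lH).
  apply: dot_eq0; have : csub_set M h by rewrite MT.
  by apply=> _ [u _ <-]; rewrite -(adjP bH) -kE hP.
apply: (unitary_constant_criterion m2 c2) => [v|y h].
  pose u := adj Psi (adj Phi v).
  have uv : adj Phi v = Psi u.
    apply/eqP; rewrite -subr_eq0; apply/eqP; apply: K0 => [u'|f].
      by rewrite dotBl embedding_isometric -(adjPr bPsi) subrr.
    rewrite dotBl embedding_iD -!(adjPr bPhi) /u -(adjPr bPsi).
    by rewrite -(adjPr bPhi) Phi_embedding -factE subrr.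
  exists u; first by rewrite -Phi_embedding -uv PhiK.
  by rewrite -embedding_isometric -uv (fourier_adj_dot bV oV lj ij jVw).
have r0 : Psi (etens [::] y) = 0.
  apply: total => [x|i l].
    rewrite -[LHS](fourier_etens bV oV lj ij jVw _ [::]).
    by rewrite -/Phi Phi_embedding h dot0l.
  rewrite (adjPr (bV i)) (_ : adj _ _ = 0) ?dot0l//.
  apply: K0 => [u|f]; rewrite -(adjPr (bV i)).
    rewrite embedding_creation embedding_isometric.
    by apply: dot_eq0C; exact: creation_vacuum.
  rewrite ViD embedding_iD m1.2.
  by apply: dot_eq0C; exact: creation_vacuum.
apply: dot_eq0; have := embedding_isometric (etens [::] y) (etens [::] y).
by rewrite r0 dot0l etens_dot eqxx => <-.
Qed.

Lemma factorization_invariant :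
  ~ unitary_constant A1 -> ~ unitary_constant A2 ->
  has_nontrivial_invariant_subspace T.
Proof.
move=> n1 n2; exists M; split=> [/zeroM//|/fullM//|].
exact: factor_csub_invariant.
Qed.

End FactorizationToInvariant.

Theorem model_invariant_iff : has_nontrivial_invariant_subspace T <->
  has_nontrivial_regular_factorization Theta.
Proof.
split=> [[M [M0 MT MI]]|[F [A1 [A2 [reg n1 n2]]]]].
  exact: invariant_factorization MI M0 MT.
exact: factorization_invariant reg n1 n2.
Qed.

End Model.

(** * The minimal isometric dilation of a row contraction *)

Lemma closure_perp (R : realType) (V : hilbertType R) (S : set V) (x z : V) :
  closure S x -> (forall s, S s -> dotp s z = 0) -> dotp x z = 0.
Proof.
move=> /closureP cx h; apply: dot_small => e /cx[s Ss xs].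
by exists s => //; exact: h.
Qed.

Lemma closure_range_image (R : realType) (U V W X : hilbertType R)
    (A : {linear U -> V}) (A' : {linear W -> X}) (B : V -> X) (C : U -> W)
    (x : V) :
  bounded_op B -> (forall f, B (A f) = A' (C f)) ->
  closure (range A) x -> closure (range A') (B x).
Proof.
move=> bB BA cx; apply: (@csub_perp R X (ran_closure A')) => y hy.
rewrite (adjP bB); apply: closure_perp cx _ => _ [f _ <-].
rewrite -(adjP bB) BA; apply: dot_eq0C; apply: hy.
by apply: subset_closure; exists (C f).
Qed.

Section RowContraction.
Variables (R : realType) (n : option nat) (H : hilbertType R).
Variable T : idx n -> H -> H.
Hypothesis T_row : row_contraction T.

Local Notation Hn := (hsum (fun _ : idx n => H)).

Let bT i : bounded_op (T i). Proof. by case: T_row => h _ _; exact: h. Qed.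

(** The left side is a partial sum of <T_i T_i^* h, h>; these increase to
    <row_gram T h, h>, which is at most <h, h>. *)
Lemma row_adj_bound h (A : {fset idx n}) :
  partial_sum (fun i => dotp (adj (T i) h) (adj (T i) h)) A <= dotp h h.
Proof.
have [_ cv le] := T_row; pose s i := dotp (adj (T i) h) (adj (T i) h).
have E B : partial_sum s B =
    dotp (partial_sum (fun i => T i (adj (T i) h)) B) h.
  rewrite !partial_sumE dot_suml; apply: eq_bigr => i _.
  by rewrite (adjP (bT i)).
have lim : (fun B => dotp (partial_sum (fun i => T i (adj (T i) h)) B) h
    : R[i]^o) @ totally --> (dotp (row_gram T h) h : R[i]^o).
  by apply: dot_cvg; exact: cv.
have s0 B : 0 <= partial_sum s B.
  by rewrite partial_sumE sumr_ge0// => i _; exact: dot_ge0.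
apply: norm_le_eps; [exact: s0|exact: dot_ge0|] => e e0.
move/cvgrPdist_lt: lim => /(_ e e0)[B _ hB].
have /= := hB (A `|` B)%fset (fsubsetUr _ _); rewrite -E => hAB.
apply: le_trans (_ : _ <= partial_sum s (A `|` B)%fset) _.
  by apply: le_partial_sum => [i|]; [exact: dot_ge0|exact: fsubsetUl].
rewrite -(subrK (dotp (row_gram T h) h) (partial_sum _ _)) addrC.
apply: lerD; first exact: le.
have gR : dotp (row_gram T h) h \is Num.real.
  by rewrite (ler_real (le h)) ger0_real// dot_ge0.
apply: le_trans (real_ler_norm _) _; first by rewrite realB// ger0_real.
by rewrite distrC ltW.
Qed.

Lemma row_adj_sq h : sq_summable (fun i => adj (T i) h).
Proof.
by exists (dotp h h) => A; under eq_fun do rewrite -dotpE; exact: row_adj_bound.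
Qed.

Definition row_adj (h : H) : Hn := HSum (row_adj_sq h).

Lemma row_adj_contraction : contraction row_adj.
Proof.
apply/contractionP; split.
  by move=> a x y; apply: hsumP => i /=; rewrite (adj_lin (bT i)).
by move=> h; apply: hsum_norm_le; [exact: dot_ge0|exact: row_adj_bound].
Qed.

Let bR : bounded_op row_adj. Proof. exact: row_adj_contraction.1. Qed.

Lemma row_adj_single i x : adj row_adj (single i x) = T i x.
Proof.
apply: dot_ext => k; rewrite -(adjPr bR).
by rewrite [LHS]dotC dot_single -dotC (adjP (bT i)).
Qed.

(** The series that defines the row operator converges at every vector, since
    the adjoint of [row_adj] is bounded and a vector is the sum of its
    components. *)
Lemma row_opE : row_op T = adj row_adj.
Proof.
apply/funext => f; apply: (cvg_lim (@norm_hausdorff _ H)).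
have := bounded_single_sum (f := f) (adj_bounded bR).
by under [X in partial_sum X]eq_fun do rewrite row_adj_single.
Qed.

Lemma row_op_contraction : contraction (row_op T).
Proof.
rewrite row_opE; split; first exact: adj_bounded.
exact: (adj_contraction bR row_adj_contraction.2).
Qed.

Let bP : bounded_op (row_op T). Proof. exact: row_op_contraction.1. Qed.

Lemma row_op_dot f x : dotp (row_op T f) x = dotp f (row_adj x).
Proof. by rewrite row_opE -(adjPr bR). Qed.

Lemma row_op_adj x : adj (row_op T) x = row_adj x.
Proof. by apply: (adj_unique bP) => f y; exact: row_op_dot. Qed.

Lemma row_op_single i x : row_op T (single i x) = T i x.
Proof. by rewrite row_opE row_adj_single. Qed.

Lemma row_gramE h : row_gram T h = row_op T (row_adj h). Proof. by []. Qed.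

Let gramA (h : H) : H := h - row_gram T h.

Lemma gram_unit_positive : unit_positive gramA.
Proof.
split=> [a x y|x].
  rewrite /gramA !row_gramE bR.1 bP.1 scalerBr opprD addrACA//.
have h : dotp (gramA x) x = dotp x x - dotp (row_adj x) (row_adj x).
  by rewrite /gramA dotBl row_gramE row_op_dot.
rewrite h subr_ge0 gerBl dot_ge0 andbT.
exact: ((contractionP row_adj).1 row_adj_contraction).2.
Qed.

Local Notation Delta := (defect (row_op T)).
Local Notation DeltaS := (defect_star T).

Lemma defect_star_lin : linear DeltaS.
Proof. exact: psqrt_lin gram_unit_positive. Qed.

Lemma defect_star_sq x : DeltaS (DeltaS x) = x - row_gram T x.
Proof. exact: psqrt_sq gram_unit_positive x. Qed.

Lemma defect_star_sym x y : dotp (DeltaS x) y = dotp x (DeltaS y).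
Proof. exact: psqrt_sym gram_unit_positive x y. Qed.

Lemma defect_sq f : Delta (Delta f) = f - row_adj (row_op T f).
Proof.
rewrite /defect (psqrt_sq (defect_unit_positive row_op_contraction)).
by rewrite row_op_adj.
Qed.

Lemma defect_sym f g : dotp (Delta f) g = dotp f (Delta g).
Proof. exact: psqrt_sym (defect_unit_positive row_op_contraction) f g. Qed.

Lemma row_op_defect f : row_op T (Delta f) = DeltaS (row_op T f).
Proof.
apply: psqrt_intertwine => //.
- exact: defect_unit_positive row_op_contraction.
- exact: gram_unit_positive.
by move=> x; rewrite row_op_adj (linB bP.1).
Qed.

Lemma row_adj_defect h : row_adj (DeltaS h) = Delta (row_adj h).
Proof.
apply: psqrt_intertwine => //.
- exact: gram_unit_positive.
- exact: defect_unit_positive row_op_contraction.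
by move=> x; rewrite row_op_adj (linB bR.1).
Qed.

Local Notation D := (Dspace T).
Local Notation Ds := (Dstar T).

Lemma to_DstarK x : closure (range DeltaS) x -> val (to_Dstar T x) = x.
Proof. by move=> cx; rewrite /to_Dstar insubdK//; exact: mem_set. Qed.

Lemma row_op_Dstar (d : D) : closure (range DeltaS) (row_op T (val d)).
Proof.
apply: (closure_range_image (C := row_op T) bP _ (csub_val d)).
exact: row_op_defect.
Qed.

Lemma row_adj_Dspace (x : Ds) : closure (range Delta) (row_adj (val x)).
Proof.
apply: (closure_range_image (C := row_adj) bR _ (csub_val x)).
exact: row_adj_defect.
Qed.

Definition row_adj_elem (x : Ds) : D :=
  exist _ (row_adj (val x)) (mem_set (@row_adj_Dspace x)).
Definition defect_elem (i : idx n) (h : H) : D := ran_elem Delta (single i h).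

Local Notation K := (hsum2 H (fock n D)).

Definition dilation (i : idx n) (k : K) : K :=
  hpair (T i (hfst k))
    (etens [::] (defect_elem i (hfst k)) + creation i (hsnd k)).
Definition dil_iH (h : H) : K := hpair h 0.
Definition dil_iD (f : fock n D) : K := hpair 0 f.
Definition dil_j (x : Ds) : K :=
  hpair (DeltaS (val x)) (- etens [::] (row_adj_elem x)).

Local Notation V := dilation.

Lemma defect_elem_lin i : linear (defect_elem i).
Proof.
move=> a x y; apply: val_inj => /=.
by rewrite single_lin (defect_lin row_op_contraction).
Qed.

Lemma defect_elem_dot i i' h h' : dotp (defect_elem i h) (defect_elem i' h') =
  (if i == i' then dotp h h' else 0) - dotp (T i h) (T i' h').
Proof.
by rewrite csub_dot (defect_dot row_op_contraction) single_dot !row_op_single.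
Qed.

Lemma dilation_orth i i' k l :
  dotp (V i k) (V i' l) = if i == i' then dotp k l else 0.
Proof.
rewrite hsum2_dot !(hpair_fst, hpair_snd) dotDl !dotDr creation_orth.
rewrite etens_dot eqxx defect_elem_dot creation_vacuum.
rewrite (dot_eq0C (creation_vacuum _ _ _)) [dotp k l]hsum2_dot.
by case: eqP => _; ring.
Qed.

Lemma dilation_lin i : linear (V i).
Proof.
move=> a x y; rewrite -hpair_linear; congr hpair; first by rewrite -(bT i).1.
rewrite scalerDr addrACA -etens_lin -defect_elem_lin -creation_lin.
by [].
Qed.

Lemma dilation_bounded i : bounded_op (V i).
Proof.
apply: (isometry_contraction (dilation_lin i) _).1 => k.
by rewrite dilation_orth eqxx.
Qed.

Lemma dil_iH_lin : linear dil_iH.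
Proof.
by move=> a x y; rewrite -hpair_linear; congr hpair; rewrite scaler0 addr0.
Qed.

Lemma dil_iD_lin : linear dil_iD.
Proof.
by move=> a x y; rewrite -hpair_linear; congr hpair; rewrite scaler0 addr0.
Qed.

Lemma dil_iH_dot x y : dotp (dil_iH x) (dil_iH y) = dotp x y.
Proof. by rewrite hsum2_dot !(hpair_fst, hpair_snd) dot0l addr0. Qed.

Lemma dil_iD_dot x y : dotp (dil_iD x) (dil_iD y) = dotp x y.
Proof. by rewrite hsum2_dot !(hpair_fst, hpair_snd) dot0l add0r. Qed.

Lemma dil_iHD h f : dotp (dil_iH h) (dil_iD f) = 0.
Proof. by rewrite hsum2_dot !(hpair_fst, hpair_snd) dot0l dot0r addr0. Qed.

Lemma dil_dec k : exists h f, k = dil_iH h + dil_iD f.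
Proof.
exists (hfst k), (hsnd k); apply: hsum2P.
  by rewrite [RHS](addr0 (hfst k)).
by rewrite [RHS](add0r (hsnd k)).
Qed.

Lemma dilation_iD i f : V i (dil_iD f) = dil_iD (creation i f).
Proof.
rewrite /dilation /dil_iD !(hpair_fst, hpair_snd) (lin0 (bT i).1).
by rewrite (lin0 (defect_elem_lin i)) (lin0 (@etens_lin R n D [::])) add0r.
Qed.

Lemma dilation_iH i h h' : dotp (V i (dil_iH h)) (dil_iH h') = dotp (T i h) h'.
Proof. by rewrite hsum2_dot !(hpair_fst, hpair_snd) dot0r addr0. Qed.

Lemma dil_j_lin : linear dil_j.
Proof.
move=> a x y; rewrite -hpair_linear; congr hpair.
  by rewrite -defect_star_lin.
rewrite scalerN -opprD -etens_lin; congr (- etens _ _).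
by apply: val_inj; rewrite /= -bR.1.
Qed.

(** |Delta_T' x|^2 + |T^* x|^2 = |x|^2. *)
Lemma dil_j_dot x y : dotp (dil_j x) (dil_j y) = dotp x y.
Proof.
rewrite hsum2_dot !(hpair_fst, hpair_snd) dotNl dotNr opprK etens_dot eqxx.
rewrite -defect_star_sym defect_star_sq dotBl !csub_dot row_gramE row_op_dot.
by rewrite subrK.
Qed.

(** The two components cancel because Delta_T' T = T Delta_T. *)
Lemma dilation_j i k x : dotp (V i k) (dil_j x) = 0.
Proof.
rewrite hsum2_dot !(hpair_fst, hpair_snd) dotNr dotDl creation_vacuum addr0.
rewrite etens_dot eqxx csub_dot -[dotp (val (defect_elem _ _)) _]row_op_dot.
by rewrite row_op_defect row_op_single defect_star_sym subrr.
Qed.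

(** For k = (h, f) orthogonal to these vectors, f is a constant d with T^* h = -
    Delta_T d and Delta_T' h = T d. Applying T to the first equation gives T T^*
    h + Delta_T'^2 h = 0, that is h = 0. *)
Lemma dilation_total k : (forall x, dotp k (dil_j x) = 0) ->
  (forall i l, dotp k (V i l) = 0) -> k = 0.
Proof.
move=> hj hV; set h := hfst k; set f := hsnd k.
have fE : f = etens [::] ((f : hsum _) [::]).
  apply: vacuumP => i g; have := hV i (dil_iD g).
  by rewrite dilation_iD hsum2_dot !(hpair_fst, hpair_snd) dot0r add0r.
set d := (f : hsum _) [::] in fE.
have e1 : row_adj h + Delta (val d) = 0.
  apply: (@hsum_dot_ext R (idx n) H) => i a; rewrite dot0l dotDl dot_single.
  have := hV i (dil_iH a).
  rewrite hsum2_dot !(hpair_fst, hpair_snd).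
  rewrite (lin0 (@creation_lin R n D i)) addr0.
  rewrite -/h -/f fE etens_dot eqxx csub_dot defect_sym => <-.
  by rewrite (adjPr (bT i)).
have e2 : DeltaS h = row_op T (val d).
  have cz : closure (range DeltaS) (DeltaS h - row_op T (val d)).
    apply: (@csubB R H (ran_closure DeltaS)); last exact: row_op_Dstar.
    by apply: subset_closure; exists h.
  apply/eqP; rewrite -subr_eq0; apply/eqP/dot_eq0.
  rewrite -{2}(to_DstarK cz); set x := to_Dstar T _.
  have := hj x; rewrite hsum2_dot !(hpair_fst, hpair_snd) dotNr -/h -/f fE.
  by rewrite etens_dot eqxx csub_dot -defect_star_sym -row_op_dot -dotBl.
have h0 : h = 0.
  have := congr1 (row_op T) e1.
  rewrite (linD bP.1) (lin0 bP.1) -row_gramE row_op_defect -e2 defect_star_sq.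
  by rewrite addrC subrK.
have d0 : val d = 0.
  have := defect_sq (val d).
  rewrite -e2 h0 (lin0 defect_star_lin) (lin0 bR.1) subr0 => <-.
  move: e1; rewrite h0 (lin0 bR.1) add0r => ->.
  exact: lin0 (defect_lin row_op_contraction).
apply: hsum2P; first exact: h0.
rewrite -/f fE (_ : d = 0); last by apply: val_inj.
exact: lin0 (@etens_lin R n D [::]).
Qed.

End RowContraction.

(** * The characteristic function *)

Section FockSums.
Variables (R : realType) (n : option nat) (K : hilbertType R).

Lemma sum_etens (f : fock n K) :
  summability.sum (fun w : word n => etens w ((f : hsum _) w)) = f.
Proof.
apply: (cvg_lim (@norm_hausdorff _ (fock n K))).
under [X in partial_sum X]eq_fun do rewrite etensE.
exact: single_cvg.
Qed.

Lemma sum_creation_annihilation (f : fock n K) :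
  summability.sum (fun i : idx n => creation i (annihilation i f)) =
  f - etens [::] ((f : hsum _) [::]).
Proof.
pose G := coef (@creation_bounded R n K) (@creation_orth R n K).
have bG : bounded_op G := coef_bounded _ _.
have GK u : G (adj G u) = u := coef_adjK _ _ u.
have Gs i g : adj G (single i g) = creation i g := adj_coef_single _ _ i g.
have Gi g i : (G g : hsum _) i = annihilation i g.
  rewrite (_ : (G g : hsum _) i = adj (@creation R n K i) g)//.
  apply: (adj_unique (creation_bounded K i) (B := @annihilation R n K i)).
  by move=> x y; exact: creation_dot.
apply: (cvg_lim (@norm_hausdorff _ (fock n K))).
have -> : f - etens [::] ((f : hsum _) [::]) = adj G (G f).
  apply/fock_dot_ext => -[|i w] x.
    rewrite dotBl dotp_etens etens_dot eqxx subrr -(adjPr bG).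
    apply/esym/hsum_dot0 => i; rewrite !Gi.
    rewrite (_ : annihilation i (etens [::] x) = 0) ?dot0r//.
    by apply: hsumP => v; rewrite annihilation_app.
  rewrite dotBl etens_dot subr0 -creation_etens.
  rewrite -[in RHS]Gs -(adjPr bG) GK dot_single Gi.
  by rewrite dotC creation_dot -dotC.
have := bounded_single_sum (f := G f) (adj_bounded bG).
by under [X in partial_sum X]eq_fun do rewrite Gs Gi.
Qed.

End FockSums.

Section CharacteristicFunction.
Variables (R : realType) (n : option nat) (H : hilbertType R).
Variable T : idx n -> H -> H.
Hypothesis T_row : row_contraction T.

Local Notation D := (Dspace T).
Local Notation Ds := (Dstar T).
Local Notation V := (@dilation R n H T).

Let bT i : bounded_op (T i). Proof. by case: T_row => h _ _; exact: h. Qed.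

Definition dilation_char : fock n D -> fock n Ds :=
  model_char (dil_iD (T:=T)) (dilation_bounded T_row) (dilation_orth T_row)
    (dil_j_lin T_row) (dil_j_dot T_row) (dilation_j T_row).

Let iH : H -> hsum2 H (fock n D) := @dil_iH R n H T.
Let iD : fock n D -> hsum2 H (fock n D) := @dil_iD R n H T.

Let V_adj_word w h : adj (word_op V w) (iH h) = iH (adj (word_op T w) h).
Proof.
exact: (word_op_V_adj_iH bT (dilation_bounded T_row) (@dil_iH_dot R n H T)
  (@dil_iHD R n H T) (@dil_dec R n H T) (dilation_iD T_row)
  (@dilation_iH R n H T)).
Qed.

(** The step that brings Delta_T into the symbol: V_i^* leads from the constants
    of fock D back to H. *)
Lemma dilation_adj_vacuum i (d : D) :
  adj (V i) (iD (etens [::] d)) = iH ((defect (row_op T) (val d) : hsum _) i).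
Proof.
apply: dot_ext => k; rewrite -(adjPr (dilation_bounded T_row i)).
rewrite [RHS]hsum2_dot [LHS]hsum2_dot !(hpair_fst, hpair_snd).
rewrite dot0l add0r [X in _ = _ + X]dot0l addr0 dotDr.
rewrite (dot_eq0C (creation_vacuum _ _ _)) addr0 etens_dot eqxx csub_dot.
by rewrite -[LHS](defect_sym T_row) dot_single.
Qed.

(** The coefficient at the empty word is j^* (1 (x) d) = - T d; at the word iw
    it is j^* V_w^* V_i^* (1 (x) d), and V_i^* takes 1 (x) d to H, where V_w^*
    is T_w^* and j^* is the defect operator of the symbol. *)
Lemma dilation_char_symbol (d : D) :
  dilation_char (etens [::] d) = char_symbol T d.
Proof.
set u := dilation_char (etens [::] d).
have uE w x : dotp ((u : hsum _) w) x =
    dotp (iD (etens [::] d)) (word_op V w (dil_j T_row x)).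
  by rewrite -dotp_etens; exact: fourier_etens.
have u0 : (u : hsum _) [::] = - to_Dstar T (row_op T (val d)).
  apply: dot_ext => x; rewrite uE.
  rewrite hsum2_dot !(hpair_fst, hpair_snd) dot0l add0r dotNr dotNl.
  rewrite etens_dot eqxx !csub_dot to_DstarK; last exact: row_op_Dstar.
  by rewrite (row_op_dot T_row).
have u1 i w : (u : hsum _) (i :: w) = to_Dstar T (defect_star T
    (adj (word_op T w) ((defect (row_op T) (val d) : hsum _) i))).
  apply: dot_ext => x; rewrite uE.
  have -> : word_op V (i :: w) (dil_j T_row x) =
    V i (word_op V w (dil_j T_row x)) by [].
  rewrite (adjPr (dilation_bounded T_row i)).
  rewrite dilation_adj_vacuum.
  rewrite (adjPr (word_op_bounded (dilation_bounded T_row) w)).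
  rewrite V_adj_word hsum2_dot !(hpair_fst, hpair_snd) dot0l addr0.
  rewrite csub_dot to_DstarK ?(defect_star_sym T_row)//.
  apply: subset_closure; exact: (ex_intro2 _ _ _ I erefl).
rewrite /char_symbol.
have -> : (fun i : idx n => creation i (summability.sum (fun w : word n =>
    etens w (to_Dstar T (defect_star T
      (adj (word_op T w) ((defect (row_op T) (val d) : hsum _) i))))))) =
    (fun i => creation i (annihilation i u)).
  apply/funext => i; congr (creation i _); rewrite -[RHS]sum_etens.
  congr (summability.sum _); apply/funext => w.
  by rewrite annihilation_app u1.
rewrite sum_creation_annihilation u0 (linN (@etens_lin R n Ds [::])) opprK.
by rewrite addrC addrK.
Qed.

Lemma char_funE : char_fun T = dilation_char.
Proof.
have cD : contraction dilation_char.
  by apply: model_char_contraction; [exact: dil_iD_lin|exact: dil_iD_dot].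
have mD : multi_analytic dilation_char.
  apply: model_char_multi_analytic; [exact: dil_iD_lin|exact: dil_iD_dot|].
  exact: dilation_iD.
rewrite /char_fun; case: xgetP => [A _ [cA mA AE]|/(_ dilation_char) []].
  apply/funext => f; apply: (multi_analytic_ext mA mD) => x.
  by rewrite AE dilation_char_symbol.
by split=> // d; exact: dilation_char_symbol.
Qed.

Lemma invariant_iff_factorization : completely_non_coisometric T ->
  has_nontrivial_invariant_subspace T <->
  has_nontrivial_regular_factorization (char_fun T).
Proof.
move=> cnc; rewrite char_funE; apply: model_invariant_iff.
- exact: bT.
- exact: dil_iH_lin.
- exact: dil_iH_dot.
- exact: dil_iD_lin.
- exact: dil_iD_dot.
- exact: dil_iHD.
- exact: dil_dec.
- exact: dilation_iD.
- exact: dilation_iH.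
- exact: dilation_total.
apply: completely_non_coisometric_model => //.
- exact: dil_iH_dot.
- exact: dil_iHD.
- exact: dil_dec.
- exact: dilation_iD.
- exact: dilation_iH.
- exact: dilation_total.
Qed.

End CharacteristicFunction.

Theorem theorem3p7 (R : realType) (n : option nat) (n_gt0 : n <> Some 0%N)
    (H : hilbertType R) (H_separable : separable H)
    (T : idx n -> H -> H) (T_row : row_contraction T)
    (T_cnc : completely_non_coisometric T) :
  has_nontrivial_invariant_subspace T <->
  has_nontrivial_regular_factorization (char_fun T).
Proof. exact: invariant_iff_factorization. Qed.
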